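(* Let $\{(\Gamma^h,\vec U^h,P^h,\vec\kappa^h,\Psi^h)(t)\}_{t\in[0,T]}$ be a solution of the semidiscrete scheme (S1)–(S5) stated in the context. Then $$\frac{\rm d}{{\rm d}t}\left\langle\Psi^h,1\right\rangle_{\Gamma^h(t)}=0.$$ In addition, if $\mathcal D_\Gamma=0$, or if both $$\int_{\sigma^h_j(t)}\nabla_s\chi^h_i\cdot\nabla_s\chi^h_k\,{\rm d}\mathcal H^{d-1}\le0\quad\forall\ i\ne k,\ \forall\ t\in[0,T],\ j=1,\dots,J_\Gamma,$$ and $$\max_{0\le t\le T}\|\nabla_s\cdot\vec{\mathcal V}^h\|_{\infty,\Gamma^h(t)}<\infty$$ hold, then $$\Psi^h(\cdot,t)\ge0\quad\forall\ t\in(0,T]\qquad\text{if}\quad\Psi^h(\cdot,0)\ge0.$$ Moreover, if $d=2$, if $\Psi^h(\cdot,t)\ge0$ on $\Gamma^h(t)$ for all $t\in[0,T]$, and if $\Psi^h(\cdot,t)<\psi_\infty$ on $\Gamma^h(t)$ for all $t\in[0,T]$, then, for almost all $t\in(0,T)$, $$\frac{\rm d}{{\rm d}t}\left(\tfrac12\|[\rho^h]^{\frac12}\vec U^h\|_0^2+\left\langle F(\Psi^h),1\right\rangle^h_{\Gamma^h(t)}\right)+2\,\|[\mu^h]^{\frac12}\underline{\underline D}(\vec U^h)\|_0^2\le\left(\rho^h\vec f^h_1+\vec f^h_2,\vec U^h\right).$$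
   Context: **Bulk.** $d\in\{2,3\}$, $T>0$, $\Omega\subset\mathbb R^d$ is a polyhedral domain, $\partial\Omega=\partial_1\Omega\cup\partial_2\Omega$ (disjoint), with outer unit normal $\vec{\rm n}$. $(\cdot,\cdot)$ and $\|\cdot\|_0$ are the $L^2$ inner product and norm on $\Omega$. $\mathbb U=\{\vec\varphi\in[H^1(\Omega)]^d:\vec\varphi=\vec0\text{ on }\partial_1\Omega,\ \vec\varphi\cdot\vec{\rm n}=0\text{ a.e. on }\partial_2\Omega\}$, $\mathbb P=L^2(\Omega)$, $\widehat{\mathbb P}=\{\eta\in\mathbb P:\int_\Omega\eta=0\}$. $\mathcal T^h$ is a regular partitioning of $\Omega$ into disjoint open simplices; $S^h_k$ ($k\ge1$) are the continuous functions that are piecewise polynomial of degree $k$ on $\mathcal T^h$, $S^h_0$ the piecewise constants; $\vec I^h_2$ is the standard nodal interpolation operator into $[S^h_2]^d$. $\mathbb U^h\subset\mathbb U$ (consisting of continuous functions, e.g. $[S_2^h]^d\cap\mathbb U$) and $\mathbb P^h(t)\subset\mathbb P$ are finite element spaces, $\widehat{\mathbb P}^h(t)=\mathbb P^h(t)\cap\widehat{\mathbb P}$. $\underline{\underline D}(\vec u)=\frac12(\nabla\vec u+(\nabla\vec u)^T)$. $\vec f_i\in L^2(0,T;[C(\overline\Omega)]^d)$, $\vec f^h_i(\cdot,t)=\vec I^h_2\vec f_i(\cdot,t)$, $i=1,2$. **Interface.** For $t\in[0,T]$, $\Gamma^h(t)=\bigcup_{j=1}^{J_\Gamma}\overline{\sigma^h_j(t)}\subset\Omega$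 is a closed polyhedral surface made of mutually disjoint, open, non-degenerate $(d-1)$-simplices without hanging vertices, with vertices $\{\vec q^h_k(t)\}_{k=1}^{K_\Gamma}$ and time-independent connectivity. $W(\Gamma^h(t))$ is the space of scalar continuous piecewise linear functions on $\Gamma^h(t)$ with nodal basis $\{\chi^h_k(\cdot,t)\}_{k=1}^{K_\Gamma}$, $\underline V(\Gamma^h(t))=[W(\Gamma^h(t))]^d$; $\pi^h,\vec\pi^h$ are the nodal interpolation operators into these spaces. $\langle\cdot,\cdot\rangle_{\Gamma^h(t)}$ is the $L^2(\Gamma^h(t))$ inner product, and $\langle\eta,\zeta\rangle^h_{\Gamma^h(t)}=\frac1d\sum_j\mathcal H^{d-1}(\sigma^h_j)\sum_{k=1}^d(\eta\cdot\zeta)((\vec q^h_{j_k})^-)$ is the mass lumped inner product, where $\vec q^h_{j_1},\dots,\vec q^h_{j_d}$ are the vertices of $\sigma^h_j$ and $(\cdot)((\vec q^h_{j_k})^-)$ is the limit from within $\sigma^h_j$. $\|z\|_{\infty,\Gamma^h(t)}={\rm ess\,sup}_{\Gamma^h(t)}|z|$. $\nabla_s$ and $\nabla_s\cdot$ are the piecewise surface gradient and divergence; $\vec{\rm id}$ the identity. $\vec{\mathcal V}^h(\vec z,t)=\sum_k[\frac{\rm d}{{\rm d}t}\vec q^h_k(t)]\chi^h_k(\vec z,t)$; $\mathcal G^h_T=\bigcup_{t\in[0,T]}\Gamma^h(t)\times\{t\}$; $\partial_t^{\circ,h}\zeta=\zeta_t+\vec{\mathcal V}^h\cdot\nabla\zeta$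 (for $\zeta=\sum_k\zeta_k(t)\chi^h_k$: $\partial_t^{\circ,h}\zeta=\sum_k\zeta_k'(t)\chi^h_k$); $W(\mathcal G^h_T)=\{\chi\in C(\mathcal G^h_T):\partial_t^{\circ,h}\chi\in C(\mathcal G^h_T),\ \chi(\cdot,t)\in W(\Gamma^h(t))\ \forall t\in[0,T]\}$. **Coefficients.** $\Omega^h_+(t),\Omega^h_-(t)$ are the exterior and interior of $\Gamma^h(t)$. Given $\rho_\pm,\mu_\pm>0$, $\rho^h(t)\in S^h_0$ equals $\rho_-$ on elements $o\subset\Omega^h_-(t)$, $\rho_+$ on elements $o\subset\Omega^h_+(t)$, and $\frac12(\rho_-+\rho_+)$ on elements with $o\cap\Gamma^h(t)\neq\emptyset$; $\mu^h(t)\in S_0^h$ is defined analogously with $\mu_\pm$. $\mathcal D_\Gamma\ge0$ is a constant. $\gamma\in C^1([0,\psi_\infty))$, $\psi_\infty\in\mathbb R_{>0}\cup\{\infty\}$, $\gamma'\le0$, is the surface tension function, and $F\in C([0,\psi_\infty))\cap C^2(0,\psi_\infty)$ is a surface energy function with $\gamma(r)=F(r)-rF'(r)$ for all $r\in(0,\psi_\infty)$ and $\lim_{r\to0}rF'(r)=F(0)-\gamma(0)=0$ (hence $\gamma'(r)=-rF''(r)$ on $(0,\psi_\infty)$, and $F$ is convex). It is understood that $\gamma(\Psi^h)$ is meaningful for the solutions considered (values of $\gamma$ outside $[0,\psi_\infty)$, if needed, being given by any fixed continuous extension). **Scheme.** Given $\Gamma^h(0)$, $\vec U^h(\cdot,0)\in\mathbb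 U^h$, $\Psi^h(\cdot,0)\in W(\Gamma^h(0))$, a solution consists of $\Gamma^h(t)$ with $\vec{\rm id}|_{\Gamma^h(t)}\in\underline V(\Gamma^h(t))$, $\vec U^h\in H^1(0,T;\mathbb U^h)$, $P^h\in L^2(0,T;\widehat{\mathbb P}^h(t))$, $\vec\kappa^h\in L^2(0,T;\underline V(\Gamma^h(t)))$, $\Psi^h\in W(\mathcal G^h_T)$ such that for almost all $t\in(0,T)$: (S1) for all $\vec\xi\in H^1(0,T;\mathbb U^h)$: $\frac12\left[\frac{\rm d}{{\rm d}t}(\rho^h\vec U^h,\vec\xi)+(\rho^h\vec U^h_t,\vec\xi)-(\rho^h\vec U^h,\vec\xi_t)\right]+2(\mu^h\underline{\underline D}(\vec U^h),\underline{\underline D}(\vec\xi))+\frac12\left(\rho^h,[(\vec I^h_2\vec U^h\cdot\nabla)\vec U^h]\cdot\vec\xi-[(\vec I^h_2\vec U^h\cdot\nabla)\vec\xi]\cdot\vec U^h\right)-(P^h,\nabla\cdot\vec\xi)=(\rho^h\vec f^h_1+\vec f^h_2,\vec\xi)+\langle\gamma(\Psi^h)\vec\kappa^h+\nabla_s\pi^h[\gamma(\Psi^h)],\vec\xi\rangle^h_{\Gamma^h(t)}$; (S2) $(\nabla\cdot\vec U^h,\varphi)=0$ for all $\varphi\in\widehat{\mathbb P}^h(t)$; (S3) $\langle\vec{\mathcal V}^h,\vec\chi\rangle^h_{\Gamma^h(t)}=\langle\vec U^h,\vec\chi\rangle^h_{\Gamma^h(t)}$ for all $\vec\chi\in\underline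 V(\Gamma^h(t))$; (S4) $\langle\vec\kappa^h,\vec\eta\rangle^h_{\Gamma^h(t)}+\langle\nabla_s\vec{\rm id},\nabla_s\vec\eta\rangle_{\Gamma^h(t)}=0$ for all $\vec\eta\in\underline V(\Gamma^h(t))$; (S5) $\frac{\rm d}{{\rm d}t}\langle\Psi^h,\chi\rangle^h_{\Gamma^h(t)}+\mathcal D_\Gamma\langle\nabla_s\Psi^h,\nabla_s\chi\rangle_{\Gamma^h(t)}=\langle\Psi^h,\partial_t^{\circ,h}\chi\rangle^h_{\Gamma^h(t)}$ for all $\chi\in W(\mathcal G^h_T)$. *)

(* Defs.v *)
(* The space dimension is d = m.+1 and a point of R^d is a
   row vector; functions are total, and the values of a function on Omega (resp.
   on the interface) outside the closure of Omega (resp. outside the interface)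
   are irrelevant. *)
From HB Require Import structures.
From mathcomp Require Import all_boot all_order all_algebra.
From mathcomp Require Import all_classical all_reals all_analysis.

Set Implicit Arguments.
Unset Strict Implicit.
Unset Printing Implicit Defensive.

Import Order.TTheory GRing.Theory Num.Theory.
Import numFieldNormedType.Exports.

Local Open Scope classical_set_scope.
Local Open Scope ring_scope.

Section row_measurable.
Context {R : realType}.
Variable n : nat.

Let coord : 'I_n -> 'rV[R]_n -> R := fun i x => x 0 i.

Let row_set0 : g_sigma_preimage coord set0.
Proof. exact: sigma_algebra0. Qed.

Let row_setC A : g_sigma_preimage coord A -> g_sigma_preimage coord (~` A).
Proof. exact: sigma_algebraC. Qed.

Let row_bigcup (F : _^nat) : (forall i, g_sigma_preimage coord (F i)) ->
  g_sigma_preimage coord (\bigcup_i (F i)).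
Proof. exact: sigma_algebra_bigcup. Qed.

(* The sigma-algebra generated by the coordinates, i.e. the Borel sets. *)
HB.instance Definition _ := @isMeasurable.Build default_measure_display
  'rV[R]_n (g_sigma_preimage coord) row_set0 row_setC row_bigcup.

Lemma measurable_row_coord (i : 'I_n) :
  measurable_fun [set: 'rV[R]_n] (fun x : 'rV[R]_n => x 0 i).
Proof.
move=> _ Y mY; rewrite setTI; apply: sub_sigma_algebra => /=.
rewrite -bigcup_seq/=; exists i => /=; first by rewrite mem_index_enum.
by exists Y => //; rewrite setTI.
Qed.

Lemma measurable_fun_row d (T : measurableType d) (f : T -> 'rV[R]_n) :
  (forall i, measurable_fun [set: T] (fun x => f x 0 i)) ->
  measurable_fun [set: T] f.
Proof.
move=> mf; apply: (@measurability _ _ _ _ _ _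
  (\big[setU/set0]_(i < n) preimage_set_system setT (coord i) measurable)) => //.
move=> _ [A + <-]; rewrite -bigcup_seq/= => -[i _ [B mB <-]].
rewrite setTI; have := mf i measurableT _ mB.
by rewrite !setTI.
Qed.

End row_measurable.

Section lebesgue_Rn.
Context {R : realType}.

Definition row_cons n (p : 'rV[R]_n * measurableTypeR R) : 'rV[R]_n.+1 :=
  \row_i oapp (fun j => p.1 0 j) p.2 (unlift ord0 i).

Lemma measurable_row_cons n : measurable_fun setT (@row_cons n).
Proof.
apply: measurable_fun_row => i; rewrite /row_cons.
under eq_fun do rewrite mxE.
case: unliftP => [j _|_] /=; last exact: measurable_snd.
exact: (measurableT_comp (measurable_row_coord j) measurable_fst).
Qed.

Section step.
Variables (n : nat) (mu : {measure set 'rV[R]_n -> \bar R}).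

Definition leb_step : set 'rV[R]_n.+1 -> \bar R :=
  pushforward (mu \x (@lebesgue_measure R))%E (@row_cons n).

Let leb_step0 : leb_step set0 = 0%E.
Proof. by rewrite /leb_step /pushforward preimage_set0 measure0. Qed.

Let leb_step_ge0 A : (0 <= leb_step A)%E.
Proof.
exact: (@measure_ge0 _ _ _
  (measure_function_pushforward__canonical__measure_function_Measure
     (mu \x (@lebesgue_measure R))%E (@measurable_row_cons n))).
Qed.

Let leb_step_sigma_additive : semi_sigma_additive leb_step.
Proof.
have := @measure_semi_sigma_additive _ _ _
  (measure_function_pushforward__canonical__measure_function_Measure
     (mu \x (@lebesgue_measure R))%E (@measurable_row_cons n)).
exact.
Qed.

HB.instance Definition _ := isMeasure.Build _ _ _ leb_step
  leb_step0 leb_step_ge0 leb_step_sigma_additive.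

End step.

Fixpoint lebesgue_row (n : nat) : {measure set 'rV[R]_n -> \bar R} :=
  if n is n'.+1 then leb_step (lebesgue_row n') else \d_(0 : 'rV[R]_0).

End lebesgue_Rn.
Arguments lebesgue_row {R} n.

Section geometry.
Context {R : realType}.

Definition dotv n (u v : 'rV[R]_n) : R := \sum_i u 0 i * v 0 i.
Definition frobenius n (A B : 'M[R]_n) : R := \sum_i \sum_j A i j * B i j.

Definition open_simplex (I : finType) n (v : I -> 'rV[R]_n) : set 'rV[R]_n :=
  [set x | exists l : I -> R, [/\ forall i, 0 < l i, \sum_i l i = 1
                                & x = \sum_i l i *: v i]].

Definition closed_simplex (I : finType) n (v : I -> 'rV[R]_n) : set 'rV[R]_n :=
  [set x | exists l : I -> R, [/\ forall i, 0 <= l i, \sum_i l i = 1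
                                & x = \sum_i l i *: v i]].

Definition subsimplex (I : finType) n (v : I -> 'rV[R]_n) (P : I -> Prop) :
    set 'rV[R]_n :=
  [set x | exists l : I -> R,
    [/\ forall i, 0 <= l i, forall i, l i != 0 -> P i, \sum_i l i = 1
      & x = \sum_i l i *: v i]].

Definition nondegenerate (I : finType) n (v : I -> 'rV[R]_n) : Prop :=
  forall l : I -> R, \sum_i l i = 0 -> \sum_i l i *: v i = 0 ->
    forall i, l i = 0.

Definition tangent (I : finType) n (v : I -> 'rV[R]_n) (w : 'rV[R]_n) : Prop :=
  exists l : I -> R, \sum_i l i = 0 /\ w = \sum_i l i *: v i.

(* Integral over an m-simplex in R^(m+1) with respect to H^m, by the area
   formula for the affine parametrization over the reference simplex. *)
Definition ref_simplex (m : nat) : set 'rV[R]_m :=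
  [set s | (forall i, 0 < s 0 i) /\ \sum_i s 0 i < 1].

Definition edge_mx m (v : 'I_m.+1 -> 'rV[R]_m.+1) : 'M[R]_(m, m.+1) :=
  \matrix_(i < m) (v (lift ord0 i) - v ord0).

Definition simplex_param m (v : 'I_m.+1 -> 'rV[R]_m.+1) (s : 'rV[R]_m) :=
  v ord0 + s *m edge_mx v.

Definition simplex_jac m (v : 'I_m.+1 -> 'rV[R]_m.+1) : R :=
  Num.sqrt (\det (edge_mx v *m (edge_mx v)^T)).

Definition simplex_int m (v : 'I_m.+1 -> 'rV[R]_m.+1) (f : 'rV[R]_m.+1 -> R) :=
  simplex_jac v *
    \int[lebesgue_row m]_(s in @ref_simplex m) f (simplex_param v s).

Definition simplex_area m (v : 'I_m.+1 -> 'rV[R]_m.+1) : R :=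
  simplex_int v (cst 1).

(* H^m-null subsets of R^(m+1), for 0 < m *)
Definition hausdorff_null m (N : set 'rV[R]_m.+1) : Prop :=
  forall e : R, 0 < e ->
    exists (c : nat -> 'rV[R]_m.+1) (r : nat -> R),
      [/\ forall i, 0 <= r i,
          N `<=` \bigcup_i [set y | `|y - c i| <= r i]
        & (\sum_(0 <= i <oo) ((r i) ^+ m)%:E <= e%:E)%E].

End geometry.

Section calculus.
Context {R : realType}.

(* derivative relative to a set, one-sided at the ends of an interval *)
Definition derivable_within (V : normedModType R) (A : set R) (f : R -> V)
    (t : R) : Prop :=
  cvg ((fun s => (s - t)^-1 *: (f s - f t)) @ within A t^').

Definition derive_within (V : normedModType R) (A : set R) (f : R -> V)
    (t : R) : V :=
  lim ((fun s => (s - t)^-1 *: (f s - f t)) @ within A t^').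

Definition C1_on (V : normedModType R) (A : set R) (f : R -> V) : Prop :=
  (forall t, A t -> derivable_within A f t) /\
  {within A, continuous (derive_within A f)}.

Definition ae_time (T : R) (Q : R -> Prop) : Prop :=
  {ae (@lebesgue_measure R), forall t : R, 0 < t < T -> Q t}.

Definition L2_time (T : R) (g : R -> R) : Prop :=
  measurable_fun `]0, T[ g /\
  (@lebesgue_measure R).-integrable `]0, T[ (fun t => ((g t) ^+ 2)%:E).

(* the continuous representatives of the elements of H^1(0,T) *)
Definition H1_time (T : R) (c : R -> R) : Prop :=
  exists2 g : R -> R, L2_time T g &
    forall t, 0 <= t <= T ->
      c t = c 0 + \int[(@lebesgue_measure R)]_(s in `[0, t]) g s.

End calculus.

Section bulk.
Context {R : realType} {m : nat}.
Notation V := 'rV[R]_m.+1.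
Notation leb := (@lebesgue_row R m.+1).
Implicit Types (Om : set V) (f g : V -> R) (u w : V -> V).

Definition ipS Om f g : R := \int[leb]_(x in Om) (f x * g x).
Definition ipV Om u w : R := \int[leb]_(x in Om) dotv (u x) (w x).
Definition ipM Om (A B : V -> 'M[R]_m.+1) : R :=
  \int[leb]_(x in Om) frobenius (A x) (B x).
Definition normV Om u : R := Num.sqrt (ipV Om u u).
Definition normM Om (A : V -> 'M[R]_m.+1) : R := Num.sqrt (ipM Om A A).

Definition L2 Om f : Prop :=
  measurable_fun Om f /\ leb.-integrable Om (fun x => ((f x) ^+ 2)%:E).

Definition basis_vec (i : 'I_m.+1) : V := delta_mx 0 i.
Definition pderiv (i : 'I_m.+1) f : V -> R := fun x => 'D_(basis_vec i) f x.

Definition smooth f : Prop :=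
  forall s : seq 'I_m.+1,
    continuous (foldr pderiv f s) /\
    forall i x, derivable (foldr pderiv f s) x (basis_vec i).

Definition test_fun Om f : Prop :=
  smooth f /\ exists K : set V,
    [/\ compact K, K `<=` Om & forall x, ~ K x -> f x = 0].

Definition is_weak_pderiv Om (i : 'I_m.+1) f g : Prop :=
  L2 Om g /\ forall phi, test_fun Om phi ->
    \int[leb]_(x in Om) (f x * pderiv i phi x) =
    - \int[leb]_(x in Om) (g x * phi x).

Definition H1 Om f : Prop :=
  L2 Om f /\ forall i, exists g, is_weak_pderiv Om i f g.

Definition wpderiv Om (i : 'I_m.+1) f : V -> R :=
  get [set g | is_weak_pderiv Om i f g].

Definition grad Om u : V -> 'M[R]_m.+1 := fun x =>
  \matrix_(i, j) wpderiv Om j (fun y => u y 0 i) x.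
Definition div Om u : V -> R := fun x => \tr (grad Om u x).
Definition strain Om u : V -> 'M[R]_m.+1 := fun x =>
  2^-1 *: (grad Om u x + (grad Om u x)^T).
Definition convect Om w u : V -> V := fun x =>
  \row_i \sum_j w x 0 j * grad Om u x i j.

(* "finite element space" is read as: spanned by finitely many functions *)
Definition fin_dim (E : lmodType R) (S : set (V -> E)) : Prop :=
  exists (N : nat) (phi : 'I_N -> V -> E),
    S = [set u | exists c : 'I_N -> R, forall x, u x = \sum_i c i *: phi i x].

Definition polyhedral_domain Om : Prop :=
  [/\ Om !=set0, connected Om &
      exists (N : nat) (v : 'I_N -> 'I_m.+2 -> V),
        (forall j, nondegenerate (v j)) /\
        Om = interior (\bigcup_j closed_simplex (v j))].

Definition boundary Om : set V := closure Om `\` interior Om.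

Definition outer_normal Om (x n : V) : Prop :=
  dotv n n = 1 /\ \forall y \near x, Om y <-> dotv (y - x) n < 0.

(* The space U intersected with C(closure Om): for such functions the trace is
   the restriction to the boundary. *)
Definition U_cont Om (bd1 bd2 : set V) : set (V -> V) :=
  [set u : V -> V | [/\ forall i, H1 Om (fun x => u x 0 i),
               {within closure Om, continuous u},
               hausdorff_null [set x | bd1 x /\ u x <> 0]
             & hausdorff_null [set x | bd2 x /\
                 ~ exists2 n, outer_normal Om x n & dotv (u x) n = 0]]].

Section mesh.
Variables (Om : set V) (M : nat) (el : 'I_M -> 'I_m.+2 -> V).

Definition regular_partition : Prop :=
  [/\ forall o, nondegenerate (el o),
      closure Om = \bigcup_o closed_simplex (el o),
      forall o, open_simplex (el o) `<=` Om,
      forall o o', o != o' ->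
        open_simplex (el o) `&` open_simplex (el o') = set0
    & forall o o', closed_simplex (el o) `&` closed_simplex (el o') `<=`
        subsimplex (el o) (fun i => exists i', el o i = el o' i')].

Definition poly_on (k : nat) (A : set V) f : Prop :=
  exists c : {ffun 'I_m.+1 -> 'I_k.+1} -> R, forall x, A x ->
    f x = \sum_(a : {ffun 'I_m.+1 -> 'I_k.+1} | (\sum_i a i <= k)%N)
            c a * \prod_i x 0 i ^+ a i.

Definition S_space (k : nat) : set (V -> R) :=
  [set f : V -> R | {within closure Om, continuous f} /\
           forall o, poly_on k (open_simplex (el o)) f].

(* vertices (i = j) and edge midpoints *)
Definition P2_node o (i j : 'I_m.+2) : V := 2^-1 *: (el o i + el o j).

Definition interp2 u : V -> V :=
  get [set w : V -> V | [/\ forall c, S_space 2 (fun x => w x 0 c),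
                   forall o i j, w (P2_node o i j) = u (P2_node o i j)
                 & forall x, ~ closure Om x -> w x = 0]].

(* Interior and exterior in Om of a closed surface G, separated by whether the
   connected component in the complement of G is bounded. *)
Definition inside (G : set V) : set V :=
  [set x | [/\ Om x, ~ G x & bounded_set (connected_component (~` G) x)]].
Definition outside (G : set V) : set V :=
  [set x | [/\ Om x, ~ G x & ~ bounded_set (connected_component (~` G) x)]].

(* element of S_0 equal to am inside G, ap outside, the mean on cut elements *)
Definition two_phase (G : set V) (am ap : R) : V -> R := fun x =>
  if [pick o | `[< open_simplex (el o) x >]] is Some o then
    if `[< open_simplex (el o) `<=` inside G >] then am
    else if `[< open_simplex (el o) `<=` outside G >] then ap
    else 2^-1 * (am + ap)
  else 0.

End mesh.

Definition L2_time_C Om (T : R) (f : R -> V -> V) : Prop :=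
  [/\ ae_time T (fun t => {within closure Om, continuous (f t)}),
      forall x i, closure Om x -> measurable_fun `]0, T[ (fun t => f t x 0 i)
    & (\int[@lebesgue_measure R]_(t in `]0%R, T[)
         ((ereal_sup [set `|f t x|%:E | x in closure Om]) ^+ 2) < +oo)%E].

(* L^2(0,T;S(t)), S(t) a subspace of L^2(Om); measurability in time is the weak
   one, equivalent to the strong one by separability (Pettis) *)
Definition L2_time_L2 Om (T : R) (S : R -> set (V -> R)) (P : R -> V -> R) :
    Prop :=
  [/\ ae_time T (fun t => S t (P t)),
      forall g, L2 Om g -> measurable_fun `]0, T[ (fun t => ipS Om (P t) g)
    & (\int[@lebesgue_measure R]_(t in `]0%R, T[)
         \int[leb]_(x in Om) ((P t x) ^+ 2)%:E < +oo)%E].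

(* H^1(0,T;S) for a finite-dimensional S (continuous representatives) *)
Definition H1_time_in (T : R) (S : set (V -> V)) (xi : R -> V -> V) : Prop :=
  exists (N : nat) (phi : 'I_N -> V -> V) (c : 'I_N -> R -> R),
    [/\ forall i, S (phi i), forall i, H1_time T (c i)
      & forall t, 0 <= t <= T -> forall x, xi t x = \sum_i c i t *: phi i x].

Definition dt_field (xi : R -> V -> V) (t : R) : V -> V :=
  fun x => derive1 (fun s => xi s x) t.

End bulk.

(* q k is the position of vertex k and tri j lists the vertices of simplex j. *)

Section surface.
Context {R : realType} {m K J : nat} (tri : 'I_J -> 'I_m.+1 -> 'I_K).
Notation V := 'rV[R]_m.+1.
Implicit Types (q : 'I_K -> V) (f eta : V -> R) (z : V).

Definition sv q (j : 'I_J) : 'I_m.+1 -> V := fun i => q (tri j i).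

Definition surf q : set V := \bigcup_j closed_simplex (sv q j).

Definition vset (j : 'I_J) : {set 'I_K} := [set tri j i | i : 'I_m.+1].

(* every facet belongs to exactly two simplices, and around every vertex the
   simplices are linked through facets containing that vertex *)
Definition closed_complex : Prop :=
  [/\ forall k, exists j, k \in vset j,
      forall j i, #|[set l | (l != j) && (vset j :\ tri j i \subset vset l)]| = 1%N
    & forall k j l, k \in vset j -> k \in vset l ->
        connect [rel a b | [&& k \in vset a :&: vset b
                             & #|vset a :&: vset b| == m]] j l].

Definition polyhedral_surface q : Prop :=
  [/\ forall j, nondegenerate (sv q j),
      forall j l, j != l ->
        open_simplex (sv q j) `&` open_simplex (sv q l) = set0
    & forall j l, closed_simplex (sv q j) `&` closed_simplex (sv q l) `<=`
        subsimplex (sv q j) (fun i => tri j i \in vset l)].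

Definition Wspace q : set (V -> R) :=
  [set eta : V -> R | {within surf q, continuous eta} /\
     forall j, exists (a : V) (b : R),
       forall z, open_simplex (sv q j) z -> eta z = dotv a z + b].

Definition Vspace q : set (V -> V) :=
  [set eta : V -> V | forall i, Wspace q (fun z => eta z 0 i)].

Definition chi q (k : 'I_K) : V -> R :=
  get [set eta : V -> R | Wspace q eta /\ forall l, eta (q l) = (l == k)%:R].

Definition interp q f : V -> R := fun z => \sum_k f (q k) * chi q k z.

Definition simplex_grad (v : 'I_m.+1 -> V) f z : V :=
  get [set g | tangent v g /\
               forall w, tangent v w -> is_derive z w f (dotv g w)].

Definition sgrad q f : V -> V := fun z =>
  if [pick j | `[< open_simplex (sv q j) z >]] is Some j
  then simplex_grad (sv q j) f z else 0.

Definition sgradv q (eta : V -> V) : V -> 'M[R]_m.+1 := fun z =>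
  \matrix_(i, l) sgrad q (fun y => eta y 0 i) z 0 l.

Definition sdiv q (eta : V -> V) : V -> R := fun z => \tr (sgradv q eta z).

Definition surf_int q f : R := \sum_j simplex_int (sv q j) f.

Definition surf_ess_sup q f : \bar R :=
  ereal_inf [set y | forall j, {ae (@lebesgue_row R m), forall s,
    ref_simplex s -> (`|f (simplex_param (sv q j) s)|%:E <= y)%E}].

(* mass lumping of the integral of f; the values at the vertices are the limits
   from within the simplices *)
Definition lumped q f : R :=
  (m.+1%:R)^-1 * \sum_j simplex_area (sv q j) *
    \sum_i lim (f @ within (open_simplex (sv q j)) (nbhs (sv q j i))).

Definition ip_lumpS q f eta : R := lumped q (fun z => f z * eta z).
Definition ip_lumpV q (u w : V -> V) : R := lumped q (fun z => dotv (u z) (w z)).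
Definition ip_surfS q f eta : R := surf_int q (fun z => f z * eta z).
Definition ip_surfV q (u w : V -> V) : R :=
  surf_int q (fun z => dotv (u z) (w z)).
Definition ip_surfM q (A B : V -> 'M[R]_m.+1) : R :=
  surf_int q (fun z => frobenius (A z) (B z)).

Section evolving.
Variables (T : R) (q : R -> 'I_K -> V).

Definition space_time : set (V * R) :=
  [set p | 0 <= p.2 <= T /\ surf (q p.2) p.1].

Definition mesh_velocity (t : R) : V -> V := fun z =>
  \sum_k chi (q t) k z *: derive_within `[0, T] (fun s => q s k) t.

Definition nodal (zeta : R -> V -> R) (k : 'I_K) : R -> R^o :=
  fun t => zeta t (q t k).

(* for zeta = sum_k zeta_k(t) chi_k, this is sum_k zeta_k'(t) chi_k *)
Definition material_deriv (zeta : R -> V -> R) (t : R) : V -> R := fun z =>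
  \sum_k derive_within `[0, T] (nodal zeta k) t * chi (q t) k z.

Definition W_time : set (R -> V -> R) :=
  [set zeta |
    [/\ {within space_time, continuous (fun p : V * R => zeta p.2 p.1)},
        forall k t, 0 <= t <= T -> derivable_within `[0, T] (nodal zeta k) t,
        {within space_time,
           continuous (fun p : V * R => material_deriv zeta p.2 p.1)}
      & forall t, 0 <= t <= T -> Wspace (q t) (zeta t)]].

Definition L2_time_V (kappa : R -> V -> V) : Prop :=
  [/\ ae_time T (fun t => Vspace (q t) (kappa t)),
      forall k i, measurable_fun `]0, T[ (fun t => kappa t (q t k) 0 i)
    & (\int[@lebesgue_measure R]_(t in `]0%R, T[)
         (ip_surfV (q t) (kappa t) (kappa t))%:E < +oo)%E].

End evolving.
End surface.

(* Dgam is the surface diffusivity, Uh and Ph t the bulk finite element spaces. *)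
Record problem (R : realType) (m : nat) := Problem {
  Tend : R;
  Omega : set 'rV[R]_m.+1;
  bd1 : set 'rV[R]_m.+1;
  bd2 : set 'rV[R]_m.+1;
  nel : nat;
  el : 'I_nel -> 'I_m.+2 -> 'rV[R]_m.+1;
  Uh : set ('rV[R]_m.+1 -> 'rV[R]_m.+1);
  Ph : R -> set ('rV[R]_m.+1 -> R);
  rho_m : R; rho_p : R; mu_m : R; mu_p : R;
  Dgam : R;
  (* surface tension and surface energy; nothing is assumed about their values
     outside [0, psi_inf) *)
  gam : R -> R;
  Fen : R -> R;
  psi_inf : \bar R;
  f1 : R -> 'rV[R]_m.+1 -> 'rV[R]_m.+1;
  f2 : R -> 'rV[R]_m.+1 -> 'rV[R]_m.+1;
  nvert : nat;
  nsimp : nat;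
  tri : 'I_nsimp -> 'I_m.+1 -> 'I_nvert }.

Section scheme.
Context {R : realType} {m : nat} (p : problem R m).
Notation V := 'rV[R]_m.+1.
Notation T := (Tend p).
Notation Om := (Omega p).

Definition psi_range : set R := [set r | 0 <= r /\ (r%:E < psi_inf p)%E].
Definition psi_range_open : set R := [set r | 0 < r /\ (r%:E < psi_inf p)%E].

Definition Phat (t : R) : set (V -> R) :=
  [set eta | Ph p t eta /\ \int[lebesgue_row m.+1]_(x in Om) eta x = 0].

Record admissible : Prop := Admissible {
  adm_T : 0 < T;
  adm_domain : polyhedral_domain Om;
  adm_bdU : bd1 p `|` bd2 p = boundary Om;
  adm_bdI : bd1 p `&` bd2 p = set0;
  adm_mesh : regular_partition Om (@el _ _ p);
  adm_Uh : Uh p `<=` U_cont Om (bd1 p) (bd2 p);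
  adm_Uh_dim : fin_dim (Uh p);
  adm_Ph : forall t, 0 <= t <= T -> Ph p t `<=` L2 Om;
  adm_Ph_dim : forall t, 0 <= t <= T -> @fin_dim R m R^o (Ph p t);
  adm_rho_m : 0 < rho_m p;
  adm_rho_p : 0 < rho_p p;
  adm_mu_m : 0 < mu_m p;
  adm_mu_p : 0 < mu_p p;
  adm_D : 0 <= Dgam p;
  adm_psi : (0 < psi_inf p)%E;
  adm_gam : C1_on psi_range (gam p : R -> R^o);
  adm_gam_le0 : forall r, psi_range r ->
    derive_within psi_range (gam p : R -> R^o) r <= 0;
  adm_F_cont : {within psi_range, continuous (Fen p)};
  adm_F_C2 : forall r, psi_range_open r ->
    [/\ derivable (Fen p) r 1, derivable (derive1 (Fen p)) r 1
      & {for r, continuous (derive1 (derive1 (Fen p)))}];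
  adm_gamF : forall r, psi_range_open r ->
    gam p r = Fen p r - r * derive1 (Fen p) r;
  adm_F0_lim : (fun r => r * derive1 (Fen p) r) @ 0^'+ --> (0 : R);
  adm_F0 : Fen p 0 - gam p 0 = 0;
  adm_f1 : L2_time_C Om T (f1 p);
  adm_f2 : L2_time_C Om T (f2 p);
  adm_complex : closed_complex (@tri _ _ p) }.

Variables (q : R -> 'I_(nvert p) -> V) (U : R -> V -> V) (P : R -> V -> R)
  (kappa : R -> V -> V) (Psi : R -> V -> R).
Notation tr := (@tri _ _ p).
Notation Gam t := (surf tr (q t)).

Definition rhoh (t : R) : V -> R :=
  two_phase Om (@el _ _ p) (Gam t) (rho_m p) (rho_p p).
Definition muh (t : R) : V -> R :=
  two_phase Om (@el _ _ p) (Gam t) (mu_m p) (mu_p p).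

Definition I2 : (V -> V) -> V -> V := interp2 Om (@el _ _ p).

Definition force (t : R) : V -> V := fun x =>
  rhoh t x *: I2 (f1 p t) x + I2 (f2 p t) x.

Definition rhoU_ip (xi : R -> V -> V) (t : R) : R :=
  ipV Om (fun x => rhoh t x *: U t x) (xi t).

Definition capillary (t : R) : V -> V := fun z =>
  gam p (Psi t z) *: kappa t z +
  sgrad tr (q t) (interp tr (q t) (fun y => gam p (Psi t y))) z.

Definition momentum_eq (t : R) (xi : R -> V -> V) : Prop :=
  2^-1 * (derive1 (rhoU_ip xi) t
          + ipV Om (fun x => rhoh t x *: dt_field U t x) (xi t)
          - ipV Om (fun x => rhoh t x *: U t x) (dt_field xi t))
  + 2 * ipM Om (fun x => muh t x *: strain Om (U t) x) (strain Om (xi t))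
  + 2^-1 * ipS Om (rhoh t) (fun x =>
        dotv (convect Om (I2 (U t)) (U t) x) (xi t x)
        - dotv (convect Om (I2 (U t)) (xi t) x) (U t x))
  - ipS Om (P t) (div Om (xi t))
  = ipV Om (force t) (xi t) + ip_lumpV tr (q t) (capillary t) (xi t).

Record solution : Prop := Solution {
  sol_q : forall k, C1_on `[0, T] (fun t => q t k);
  sol_surf : forall t, 0 <= t <= T -> polyhedral_surface tr (q t);
  sol_surf_in : forall t, 0 <= t <= T -> Gam t `<=` Om;
  sol_id : forall t, 0 <= t <= T -> Vspace tr (q t) id;
  sol_U : H1_time_in T (Uh p) U;
  sol_P : L2_time_L2 Om T Phat P;
  sol_kappa : L2_time_V tr T q kappa;
  sol_Psi : W_time tr T q Psi;
  (* The exceptional null set may depend on the time-dependent test functions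
     xi and chi: xi_t need only exist almost everywhere. *)
  sol_S1 : forall xi, H1_time_in T (Uh p) xi ->
    ae_time T (fun t => derivable (rhoU_ip xi : R -> R^o) t 1 /\
                        momentum_eq t xi);
  sol_S2 : ae_time T (fun t =>
    forall phi, Phat t phi -> ipS Om (div Om (U t)) phi = 0);
  sol_S3 : ae_time T (fun t =>
    forall w, Vspace tr (q t) w ->
      ip_lumpV tr (q t) (mesh_velocity tr T q t) w
      = ip_lumpV tr (q t) (U t) w);
  sol_S4 : ae_time T (fun t =>
    forall w, Vspace tr (q t) w ->
      ip_lumpV tr (q t) (kappa t) w
      + ip_surfM tr (q t) (sgradv tr (q t) id) (sgradv tr (q t) w) = 0);
  sol_S5 : forall zeta, W_time tr T q zeta ->
    ae_time T (fun t =>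
      let mass s := ip_lumpS tr (q s) (Psi s) (zeta s) in
      derivable (mass : R -> R^o) t 1 /\
      derive1 mass t
      + Dgam p * ip_surfV tr (q t) (sgrad tr (q t) (Psi t))
                                   (sgrad tr (q t) (zeta t))
      = ip_lumpS tr (q t) (Psi t) (material_deriv tr T q zeta t)) }.

Definition nonobtuse : Prop :=
  forall i k, i != k -> forall t, 0 <= t <= T -> forall j,
    simplex_int (sv tr (q t) j) (fun z =>
      dotv (sgrad tr (q t) (chi tr (q t) i) z)
           (sgrad tr (q t) (chi tr (q t) k) z)) <= 0.

Definition bounded_divergence : Prop :=
  (ereal_sup [set surf_ess_sup tr (q t)
                    (sdiv tr (q t) (mesh_velocity tr T q t))
             | t in `[0%R, T]] < +oo)%E.

Definition energy (t : R) : R :=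
  2^-1 * (normV Om (fun x => Num.sqrt (rhoh t x) *: U t x)) ^+ 2
  + ip_lumpS tr (q t) (fun z => Fen p (Psi t z)) (cst 1).

End scheme.

(* Main.v *)
(** Testing (S5) with the moving hat functions turns the surfactant equation into
    the system (m_k psi_k)' = - D sum_l A_kl psi_l for the nodal values psi_k,
    with m_k > 0 the lumped masses and A the stiffness matrix; it holds for almost
    every time, hence for every time since both sides are continuous.

    Conservation follows from sum_k A_kl = 0 and from the fact that mass lumping
    is exact for piecewise linear functions.

    For nonnegativity let z_S be the sum of m_k psi_k over a set S of vertices;
    the minimum of z_S over S is minus the total negative mass.  A minimizing S
    contains only vertices with psi_k <= 0 and all those with psi_k < 0, and then
    A_kl <= 0 for k <> l and the zero column sums give z_S' >= 0.

    For the energy, (S1) is tested with the velocity itself.  By (S3) the fluid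
    velocity at a vertex is the velocity of the vertex, so that for d = 2, with
    (S4), the capillary term is - sum_k m_k' gamma(psi_k).  The surface energy has
    derivative sum_k m_k' gamma(psi_k) - D <grad Psi, grad pi F'(Psi)>, and the last
    term has a sign as F is convex.  F' may be singular at 0, but for d = 2 the
    system implies (m_k psi_k)' >= - c m_k psi_k, so psi_k vanishes exactly on an
    initial time interval: at almost every time each psi_k is either positive or
    identically zero nearby, and diffusion then forces its neighbours to be zero. *)

From HB Require Import structures.
Require Import Defs.
From mathcomp Require Import all_boot all_order all_algebra.
From mathcomp Require Import all_classical all_reals all_analysis.
From mathcomp Require Import measurable_realfun ring lra.
Import Order.TTheory GRing.Theory Num.Theory.
Import numFieldNormedType.Exports.
Local Open Scope classical_set_scope.
Local Open Scope ring_scope.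

Set Implicit Arguments.
Unset Strict Implicit.

(** * Barycentric coordinates *)

(** Hat functions, surface gradients, vertex values and one-sided time derivatives are all given by
    a choice or a limit, so each must be identified with a formula before it can be used.
    Barycentric coordinates built from the inverse Gram matrix of the edges serve for this: they
    settle existence and uniqueness, and they depend on the vertices explicitly enough to be
    continuous in time. The sums over vertex sets [S] replace the negative part of the nodal values
    because that part is not differentiable where a value changes sign, whereas each of the finitely
    many sums is. In the energy estimate, the values of gamma and of the velocity at the two ends of
    a segment obey an exact product rule; through it the curvature and gradient terms combine into
    the change of length weighted by the mean of gamma. The chain rule for F is available only
    outside the times at which a nodal value leaves 0, at most one per vertex. Testing (S1) with the
    velocity leaves a single time derivative, that of (rho U, U), whose existence is part of
    (S1). *)

Section dot_product.
Context {R : realType} {n : nat}.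
Implicit Types (u v w : 'rV[R]_n) (a : R).

Lemma dotv_mx u v : dotv u v = (u *m v^T) 0 0.
Proof. by rewrite mxE; apply: eq_bigr => i _; rewrite mxE. Qed.

Lemma dotvC u v : dotv u v = dotv v u.
Proof. by apply: eq_bigr => i _; rewrite mulrC. Qed.

Lemma dotvDl u v w : dotv (u + v) w = dotv u w + dotv v w.
Proof. by rewrite !dotv_mx mulmxDl mxE. Qed.

Lemma dotvDr u v w : dotv w (u + v) = dotv w u + dotv w v.
Proof. by rewrite dotvC dotvDl ![dotv _ w]dotvC. Qed.

Lemma dotvZl a u v : dotv (a *: u) v = a * dotv u v.
Proof. by rewrite !dotv_mx -scalemxAl mxE. Qed.

Lemma dotvZr a u v : dotv u (a *: v) = a * dotv u v.
Proof. by rewrite dotvC dotvZl dotvC. Qed.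

Lemma dotvNl u v : dotv (- u) v = - dotv u v.
Proof. by rewrite -scaleN1r dotvZl mulN1r. Qed.

Lemma dotvNr u v : dotv u (- v) = - dotv u v.
Proof. by rewrite dotvC dotvNl dotvC. Qed.

Lemma dotvBl u v w : dotv (u - v) w = dotv u w - dotv v w.
Proof. by rewrite dotvDl dotvNl. Qed.

Lemma dotvBr u v w : dotv w (u - v) = dotv w u - dotv w v.
Proof. by rewrite dotvDr dotvNr. Qed.

Lemma dotv0l u : dotv 0 u = 0.
Proof. by rewrite -(scale0r u) dotvZl mul0r. Qed.

Lemma dotv0r u : dotv u 0 = 0.
Proof. by rewrite dotvC dotv0l. Qed.

Lemma dotv_suml (I : Type) (r : seq I) (P : pred I) (F : I -> 'rV[R]_n) u :
  dotv (\sum_(i <- r | P i) F i) u = \sum_(i <- r | P i) dotv (F i) u.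
Proof.
by elim/big_rec2: _ => [|i x y _ <-]; rewrite ?dotv0l// dotvDl.
Qed.

Lemma dotv_sumr (I : Type) (r : seq I) (P : pred I) (F : I -> 'rV[R]_n) u :
  dotv u (\sum_(i <- r | P i) F i) = \sum_(i <- r | P i) dotv u (F i).
Proof. by rewrite dotvC dotv_suml; apply: eq_bigr => i _; rewrite dotvC. Qed.

Lemma dotv_ge0 u : 0 <= dotv u u.
Proof. by apply: sumr_ge0 => i _; rewrite -expr2 sqr_ge0. Qed.

Lemma dotv_eq0 u : dotv u u = 0 -> u = 0.
Proof.
move=> /eqP; rewrite psumr_eq0; last by move=> i _; rewrite -expr2 sqr_ge0.
move=> /allP u0; apply/rowP => i; have := u0 i (mem_index_enum i).
by rewrite -expr2 sqrf_eq0 mxE => /eqP.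
Qed.

End dot_product.

Section barycentric.
Context {R : realType} {m : nat}.
Notation V := 'rV[R]_m.+1.
Implicit Types (v : 'I_m.+1 -> V) (z w : V).

Definition edge_gram v : 'M[R]_m := edge_mx v *m (edge_mx v)^T.

(** With [E] the edge matrix and [G = E E^T], the rows of [G^-1 E] are the basis of the tangent
    space dual to the edges. The first vertex takes minus their sum because the coordinates add up
    to one. *)
Definition bary_grad v (i : 'I_m.+1) : V :=
  let g j := row j (invmx (edge_gram v) *m edge_mx v) in
  oapp g (- \sum_j g j) (unlift ord0 i).

(** An affine function on the whole space, constant in the normal direction. *)
Definition bary v (i : 'I_m.+1) z : R :=
  (i == ord0)%:R + dotv (bary_grad v i) (z - v ord0).

(** A row [u] with [u G = 0] has [|u E|^2 = u G u^T = 0], and [u E = 0] is a relation between the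
    vertices with weights of sum zero. *)
Lemma edge_gram_unit v : Defs.nondegenerate v -> edge_gram v \in unitmx.
Proof.
move=> ndv; rewrite -row_free_unit; apply: inj_row_free => u uG0.
have uE0 : u *m edge_mx v = 0.
  apply: dotv_eq0; rewrite dotv_mx trmx_mul mulmxA -(mulmxA u).
  by rewrite uG0 mul0mx mxE.
pose l i := oapp (fun j => u 0 j) (- \sum_j u 0 j) (unlift ord0 i).
have l0 : l ord0 = - \sum_j u 0 j by rewrite /l unlift_none.
have lS i : l (lift ord0 i) = u 0 i by rewrite /l liftK.
apply/rowP => j; rewrite mxE -lS; apply: ndv.
  by rewrite big_ord_recl l0 (eq_bigr _ (fun i _ => lS i)) addNr.
rewrite big_ord_recl l0; under [X in _ + X]eq_bigr do rewrite lS.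
move: uE0; rewrite mulmx_sum_row => uE0; rewrite -[RHS]uE0.
rewrite scaleNr scaler_suml -sumrN -big_split/=; apply: eq_bigr => i _.
by rewrite /edge_mx rowK scalerBr addrC.
Qed.

Lemma bary_grad_ord0 v : bary_grad v ord0 = - \sum_j bary_grad v (lift ord0 j).
Proof.
rewrite {1}/bary_grad unlift_none/=; congr (- _); apply: eq_bigr => j _.
by rewrite /bary_grad liftK.
Qed.

Lemma bary_grad_sum v : \sum_i bary_grad v i = 0.
Proof. by rewrite big_ord_recl bary_grad_ord0 addNr. Qed.

Lemma bary_grad_edge v i k : Defs.nondegenerate v ->
  dotv (bary_grad v i) (v k - v ord0) = (k == i)%:R - (i == ord0)%:R.
Proof.
move=> ndv; have [k' ->|->] := unliftP ord0 k; last first.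
  by rewrite subrr dotv0r eq_sym subrr.
pose B := invmx (edge_gram v) *m edge_mx v.
have dB j : dotv (row j B) (v (lift ord0 k') - v ord0) = (k' == j)%:R.
  rewrite dotv_mx -(_ : row k' (edge_mx v) = v (lift ord0 k') - v ord0).
    rewrite tr_row -row_mul mxE.
    have -> : (B *m col k' (edge_mx v)^T) = col k' (B *m (edge_mx v)^T).
      by rewrite !colE mulmxA.
    by rewrite /B -mulmxA mulVmx ?edge_gram_unit// !mxE eq_sym.
  by rewrite /edge_mx rowK.
have [i' ->|->] := unliftP ord0 i.
  rewrite /bary_grad liftK/= dB (inj_eq (@lift_inj _ ord0)).
  by rewrite subr0.
rewrite /bary_grad unlift_none/= dotvNl dotv_suml.
under eq_bigr do rewrite dB.
rewrite (bigD1 k')//= eqxx big1 ?addr0.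
  by rewrite sub0r.
by move=> j; rewrite eq_sym => /negbTE ->.
Qed.

Lemma bary_vertex v i k : Defs.nondegenerate v -> bary v i (v k) = (k == i)%:R.
Proof. by move=> ndv; rewrite /bary bary_grad_edge// addrC subrK. Qed.

Lemma baryB v i z w : bary v i z - bary v i w = dotv (bary_grad v i) (z - w).
Proof.
by rewrite /bary opprD addrACA subrr add0r -dotvBr opprB addrA subrK.
Qed.

Lemma bary_comb v i (l : 'I_m.+1 -> R) : Defs.nondegenerate v -> \sum_k l k = 1 ->
  bary v i (\sum_k l k *: v k) = l i.
Proof.
move=> ndv l1; rewrite /bary.
have -> : \sum_k l k *: v k - v ord0 = \sum_k l k *: (v k - v ord0).
  under [RHS]eq_bigr do rewrite scalerBr.
  by rewrite sumrB -scaler_suml l1 scale1r.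
rewrite dotv_sumr; under eq_bigr do rewrite dotvZr bary_grad_edge// mulrBr.
rewrite sumrB -mulr_suml l1 mul1r addrC subrK (bigD1 i)//= eqxx mulr1 big1 ?addr0//.
by move=> k /negbTE ->; rewrite mulr0.
Qed.

Lemma bary_sum1 v z : \sum_i bary v i z = 1.
Proof.
rewrite big_split/= -dotv_suml bary_grad_sum dotv0l addr0 (bigD1 ord0)//= big1 ?addr0//.
by move=> k /negbTE ->.
Qed.

Lemma bary_grad_tangent v i : tangent v (bary_grad v i).
Proof.
have T0 (u : 'rV[R]_m) : tangent v (u *m edge_mx v).
  exists (fun i => oapp (fun j => u 0 j) (- \sum_j u 0 j) (unlift ord0 i)).
  split; rewrite big_ord_recl unlift_none/=.
    by under [X in _ + X]eq_bigr do rewrite liftK/=; rewrite addNr.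
  rewrite mulmx_sum_row scaleNr scaler_suml -sumrN -big_split/=.
  by apply: eq_bigr => j _; rewrite liftK /edge_mx rowK scalerBr addrC.
rewrite /bary_grad; case: (unlift ord0 i) => [j|]/=; first by rewrite row_mul; exact: T0.
by under eq_bigr do rewrite row_mul; rewrite -mulmx_suml -mulNmx; exact: T0.
Qed.

(** Since [bary] does not see the normal direction, the second condition is what puts [z] into the
    affine hull. *)
Lemma closed_simplexE v z : Defs.nondegenerate v ->
  closed_simplex v z <->
  (forall i, 0 <= bary v i z) /\ z = \sum_i bary v i z *: v i.
Proof.
move=> ndv; split=> [[l [l0 l1 ->]]|[b0 zE]].
  have bl i : bary v i (\sum_k l k *: v k) = l i by exact: bary_comb.
  by split=> [i|]; rewrite ?bl//; apply: eq_bigr => i _; rewrite bl.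
by exists (fun i => bary v i z); split=> //; exact: bary_sum1.
Qed.

Lemma open_simplexE v z : Defs.nondegenerate v ->
  open_simplex v z <->
  (forall i, 0 < bary v i z) /\ z = \sum_i bary v i z *: v i.
Proof.
move=> ndv; split=> [[l [l0 l1 ->]]|[b0 zE]].
  have bl i : bary v i (\sum_k l k *: v k) = l i by exact: bary_comb.
  by split=> [i|]; rewrite ?bl//; apply: eq_bigr => i _; rewrite bl.
by exists (fun i => bary v i z); split=> //; exact: bary_sum1.
Qed.

Lemma open_closed_simplex v : open_simplex v `<=` closed_simplex v.
Proof. by move=> z [l [l0 l1 ->]]; exists l; split=> // i; exact: ltW. Qed.

Lemma closed_simplex_vertex v i : closed_simplex v (v i).
Proof.
exists (fun k => (k == i)%:R); split=> //.
  by rewrite (bigD1 i)//= eqxx big1 ?addr0// => k /negbTE ->.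
by rewrite (bigD1 i)//= eqxx scale1r big1 ?addr0// => k /negbTE ->; rewrite scale0r.
Qed.

Lemma nondegenerate_inj v : Defs.nondegenerate v -> injective v.
Proof.
move=> ndv i k vik; have := bary_vertex i k ndv.
rewrite -vik bary_vertex// eqxx; case: eqP => // _ /eqP.
by rewrite oner_eq0.
Qed.

Lemma tangent_expand v w : Defs.nondegenerate v -> tangent v w ->
  w = \sum_i dotv (bary_grad v i) w *: v i.
Proof.
move=> ndv [l [l0 ->]]; apply: eq_bigr => i _; congr (_ *: _).
(* Adding the tangent vector to the vertex [v i] gives a point with weights of sum one, so that
   [bary_comb] applies. *)
have /(_ (fun k => l k + (k == i)%:R) ) := @bary_comb v i ^~ ndv.
have s1 : \sum_k (k == i)%:R = 1 :> R.
  by rewrite (bigD1 i)//= eqxx big1 ?addr0// => k /negbTE ->.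
have sv : \sum_k (k == i)%:R *: v k = v i.
  by rewrite (bigD1 i)//= eqxx scale1r big1 ?addr0// => k /negbTE ->; rewrite scale0r.
rewrite big_split/= l0 s1 add0r eqxx => /(_ erefl).
under eq_bigr do rewrite scalerDl.
rewrite big_split/= sv => /eqP; rewrite -subr_eq -[X in _ - X](_ : bary v i (v i) = 1).
  by rewrite baryB addrK => /eqP.
by rewrite bary_vertex// eqxx.
Qed.

End barycentric.

(** * Differentiation rules for real functions in pointwise form *)

Section real_derivatives.
Context {R : realType}.
Implicit Types (f g : R -> R) (x : R).

Lemma is_derive1_cst (c x : R) : is_derive x 1 (fun _ : R => c) 0.
Proof. exact: is_derive_cst. Qed.

Lemma is_derive1D f g x df dg : is_derive x 1 f df -> is_derive x 1 g dg ->
  is_derive x 1 (fun y => f y + g y) (df + dg).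
Proof. exact: is_deriveD. Qed.

Lemma is_derive1N f x df : is_derive x 1 f df ->
  is_derive x 1 (fun y => - f y) (- df).
Proof. exact: is_deriveN. Qed.

Lemma is_derive1B f g x df dg : is_derive x 1 f df -> is_derive x 1 g dg ->
  is_derive x 1 (fun y => f y - g y) (df - dg).
Proof. exact: is_deriveB. Qed.

Lemma is_derive1M f g x df dg : is_derive x 1 f df -> is_derive x 1 g dg ->
  is_derive x 1 (fun y => f y * g y) (df * g x + f x * dg).
Proof.
move=> df' dg'; apply: (is_derive_eq (is_deriveM df' dg')).
by rewrite addrC [df * _]mulrC.
Qed.

Lemma is_derive1Zl c f x df : is_derive x 1 f df ->
  is_derive x 1 (fun y => c * f y) (c * df).
Proof.
move=> df'; have := is_derive1M (is_derive1_cst c x) df'.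
by rewrite mul0r add0r.
Qed.

Lemma is_derive1Zr c f x df : is_derive x 1 f df ->
  is_derive x 1 (fun y => f y * c) (df * c).
Proof.
move=> df'; have := is_derive1M df' (is_derive1_cst c x).
by rewrite mulr0 addr0.
Qed.

Lemma is_derive1X f n x df : is_derive x 1 f df ->
  is_derive x 1 (fun y => f y ^+ n) (n%:R * f x ^+ n.-1 * df).
Proof.
move=> df'; have <- : f ^+ n = (fun y => f y ^+ n).
  by apply/funext => y; rewrite exprfctE.
exact: is_deriveX.
Qed.

Lemma is_derive1_sum (I : Type) (r : seq I) (P : pred I) (F : I -> R -> R) (dF : I -> R) x :
  (forall i, P i -> is_derive x 1 (F i) (dF i)) ->
  is_derive x 1 (fun y => \sum_(i <- r | P i) F i y) (\sum_(i <- r | P i) dF i).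
Proof.
move=> dFi; elim: r => [|i r IHr].
  by rewrite big_nil; under eq_fun do rewrite big_nil; exact: is_derive1_cst.
rewrite big_cons; under eq_fun do rewrite big_cons.
by case: ifPn => // Pi; apply: is_derive1D => //; exact: dFi.
Qed.

Lemma is_derive1_continuous f x df : is_derive x 1 f df -> {for x, continuous f}.
Proof.
move=> df'; apply/differentiable_continuous/derivable1_diffP.
by case: df'.
Qed.

End real_derivatives.

(** * Integrals over simplices *)

Section row_integral.
Context {R : realType}.
Local Notation leb1 := (@lebesgue_measure R).

Definition box n (k : R) : set 'rV[R]_n := [set s | forall i, s 0 i \in `[- k, k]].

Lemma measurable_box n k : measurable (@box n k).
Proof.
rewrite (_ : box k = \bigcap_(i in [set: 'I_n]) [set s : 'rV[R]_n | s 0 i \in `[- k, k]]).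
  apply: fin_bigcap_measurable => // i _.
  rewrite -[X in measurable X]setTI.
  exact: (measurable_row_coord i measurableT (measurable_itv `[- k, k])).
by apply/seteqP; split => s /= sk i; [move=> _|]; apply: sk.
Qed.

Lemma row_cons0 n (p : 'rV[R]_n * measurableTypeR R) : row_cons p 0 ord0 = p.2.
Proof. by rewrite mxE unlift_none. Qed.

Lemma row_consS n (p : 'rV[R]_n * measurableTypeR R) i :
  row_cons p 0 (lift ord0 i) = p.1 0 i.
Proof. by rewrite mxE liftK. Qed.

Lemma lebesgue_row_box n k : (lebesgue_row n (@box n k) < +oo)%E.
Proof.
elim: n => [|n IHn] /=; first by rewrite diracE ltry.
rewrite /leb_step /pushforward.
have -> : @row_cons R n @^-1` box k = box k `*` `[- k, k]%classic.
  apply/seteqP; split=> [x xk|x [xk1 xk2] i]; last first.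
    have [j ->|->] := unliftP ord0 i; first by rewrite row_consS; exact: xk1.
    by rewrite row_cons0.
  split=> [i|] /=; first by have := xk (lift ord0 i); rewrite row_consS.
  by have := xk ord0; rewrite row_cons0.
rewrite product_measure1E//; last exact: measurable_box.
have mk : (leb1 `[(- k)%R, k]%classic < +oo)%E.
  by rewrite lebesgue_measure_itv/=; case: ifPn => _; rewrite ltry.
rewrite lte_mul_pinfty ?measure_ge0// ge0_fin_numE ?measure_ge0//.
Qed.

Lemma lebesgue_row_sigma_finite n : sigma_finite setT (@lebesgue_row R n).
Proof.
exists (fun k => box k%:R) => [|k]; last first.
  by split; [exact: measurable_box|exact: lebesgue_row_box].
apply/seteqP; split => // s _.
exists (\max_i Num.truncn (`|s 0 i|)%R).+1 => // i.
rewrite /= in_itv/= -ler_norml ltW//.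
apply: lt_le_trans (truncnS_gt _) _; rewrite ler_nat ltnS.
exact: (leq_bigmax i).
Qed.

(* A copy of [lebesgue_row] that can carry the sigma-finite structure required by
   Tonelli's theorem. *)
Definition lebesgue_row_fun n : set 'rV[R]_n -> \bar R := lebesgue_row n.

HB.instance Definition _ n :=
  Measure.copy (@lebesgue_row_fun n) (lebesgue_row n).
HB.instance Definition _ n := @Measure_isSigmaFinite.Build _ 'rV[R]_n R
  (@lebesgue_row_fun n) (lebesgue_row_sigma_finite n).

Lemma lebesgue_row_recr n (f : 'rV[R]_n.+1 -> \bar R) :
  measurable_fun [set: 'rV[R]_n.+1] f -> (forall x, 0 <= f x)%E ->
  (\int[lebesgue_row n.+1]_x f x =
   \int[leb1]_y \int[lebesgue_row n]_x f (row_cons (x, y)))%E.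
Proof.
move=> mf f0 /=.
transitivity (\int[(@lebesgue_row_fun n) \x leb1]_z f (row_cons z))%E.
  rewrite [LHS](@ge0_integral_pushforward _ _ _ _ _ _ (@measurable_row_cons _ n) _ setT)//.
rewrite fubini_tonelli2//.
exact: (measurableT_comp mf (@measurable_row_cons _ n)).
Qed.

(** A slice of the reference simplex at height [y] is a simplex of size [1 - y]; induction on the
    dimension therefore needs all sizes at once. *)
Definition dilated_simplex n (r : R) : set 'rV[R]_n :=
  [set s | (forall i, 0 < s 0 i) /\ \sum_i s 0 i < r].

Lemma measurable_dilated_simplex n r : measurable (@dilated_simplex n r).
Proof.
rewrite (_ : dilated_simplex r =
    (\bigcap_(i in [set: 'I_n]) [set s : 'rV[R]_n | s 0 i \in `]0, +oo[]) `&`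
    [set s : 'rV[R]_n | \sum_i s 0 i \in `]-oo, r[]).
  apply: measurableI.
    apply: fin_bigcap_measurable => // i _.
    rewrite -[X in measurable X]setTI.
    exact: (measurable_row_coord i measurableT (measurable_itv `]0, +oo[)).
  rewrite -[X in measurable X]setTI.
  have ms : measurable_fun [set: 'rV[R]_n] (fun s : 'rV[R]_n => \sum_i s 0 i).
    apply: measurable_sum => i; exact: measurable_row_coord.
  exact: (ms measurableT _ (measurable_itv `]-oo, r[)).
apply/seteqP; split=> s /= [s0 s1]; split=> [i|].
- by move=> _ /=; rewrite in_itv/= s0.
- by rewrite in_itv.
- by have := s0 i Logic.I; rewrite /= in_itv/= andbT.
- by move: s1; rewrite in_itv.
Qed.

Lemma dilated_simplex_row_cons n r (x : 'rV[R]_n) (y : R) :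
  dilated_simplex r (row_cons (x, y : measurableTypeR R)) <->
  0 < y /\ dilated_simplex (r - y) x.
Proof.
rewrite /dilated_simplex/= big_ord_recl row_cons0/=.
under eq_bigr do rewrite row_consS/=.
rewrite -ltrBrDl; split=> [[s0 s1]|[y0 [x0 x1]]].
  split; first by have := s0 ord0; rewrite row_cons0.
  by split=> // i; have := s0 (lift ord0 i); rewrite row_consS.
split=> // i; have [j ->|->] := unliftP ord0 i; first by rewrite row_consS.
by rewrite row_cons0.
Qed.

Lemma dilated_simplex_le0 n r (x : 'rV[R]_n) : r <= 0 -> ~ dilated_simplex r x.
Proof.
move=> r0 [x0 xr]; have : 0 <= \sum_i x 0 i by apply: sumr_ge0 => i _; exact: ltW.
by rewrite leNgt (lt_le_trans xr r0).
Qed.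

Lemma integral_dilated_simplex_recr n (r : R) (f : R -> 'rV[R]_n -> R)
    (g : 'rV[R]_n.+1 -> R) :
  0 < r ->
  measurable_fun [set: 'rV[R]_n.+1] g ->
  (forall s, dilated_simplex r s -> 0 <= g s) ->
  (forall x y, g (row_cons (x, y : measurableTypeR R)) = f y x) ->
  (\int[lebesgue_row n.+1]_(s in dilated_simplex r) (g s)%:E =
   \int[leb1]_(y in `]0%R, r[)
     \int[lebesgue_row n]_(x in dilated_simplex (r - y)) (f y x)%:E)%E.
Proof.
move=> r0 mg g0 gf.
rewrite integral_mkcond lebesgue_row_recr; last 2 first.
- apply/(measurable_restrictT _ (measurable_dilated_simplex r)).
  apply: measurable_funTS; exact/measurable_EFinP.
- by move=> s; rewrite patchE; case: ifPn => // /set_mem/g0; rewrite lee_fin.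
rewrite [RHS]integral_mkcond; apply: eq_integral => y _ /=.
rewrite [RHS]patchE; case: ifPn => [|yr].
  rewrite inE/= in_itv/= => /andP[y0 yr].
  rewrite [RHS]integral_mkcond; apply: eq_integral => x _ /=.
  rewrite !patchE gf.
  by congr (if _ then _ else _); apply/idP/idP => /set_mem sx; apply/mem_set;
    [case/dilated_simplex_row_cons : sx|apply/dilated_simplex_row_cons].
apply: integral0_eq => x _; rewrite patchE; case: ifPn => // /set_mem.
move=> /dilated_simplex_row_cons[y0 xy]; move: yr; rewrite notin_setE/= in_itv/= y0/=.
by move=> /negP; rewrite -leNgt -subr_le0 => /dilated_simplex_le0 /(_ xy).
Qed.

End row_integral.

(** * Volume and first moments of the reference simplex *)

Section moments.
Context {R : realType}.
Local Notation leb1 := (@lebesgue_measure R).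

Lemma integral_oo_is_derive (f F : R -> R) (a b : R) : a < b ->
  (forall x : R, is_derive x 1 F (f x)) -> continuous f ->
  (\int[leb1]_(x in `]a, b[) (f x)%:E = (F b - F a)%:E)%E.
Proof.
move=> ab dF cf.
have cF : continuous F.
  by move=> x; apply/differentiable_continuous/derivable1_diffP; have := dF x; case.
rewrite -(@integral_itv_bndoo _ a b (EFin \o f) true false)/=; last first.
  apply: measurable_funTS; apply/measurable_EFinP; exact: continuous_measurable_fun.
rewrite (@continuous_FTC2 _ f F)//.
- exact: continuous_subspaceT.
- split=> [x _||].
  + by have := dF x; case.
  + by apply: cvg_at_right_filter; exact: cF.
  + by apply: cvg_at_left_filter; exact: cF.
- by move=> x _; rewrite derive1E; have := dF x => /@derive_val.
Qed.

Lemma continuous_subrX (r : R) n : continuous (fun y : R => (r - y) ^+ n).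
Proof.
move=> y; apply: (@continuous_comp _ _ _ (fun y => r - y) (fun y => y ^+ n)).
  by apply: cvgB; [exact: cvg_cst|exact: cvg_id].
exact: exprn_continuous.
Qed.

Lemma is_derive_subrX (r : R) n (y : R) :
  is_derive y 1 (fun y : R => - (r - y) ^+ n.+1 / n.+1`!%:R) ((r - y) ^+ n / n`!%:R).
Proof.
have dr := is_derive1B (is_derive1_cst r y) (is_derive_id y 1).
apply: (is_derive_eq (is_derive1Zr _ (is_derive1N (is_derive1X n.+1 dr)))).
rewrite sub0r mulrN1 opprK factS natrM invfM mulrA /=.
by congr (_ * _); rewrite mulrC mulrA mulVf ?mul1r// pnatr_eq0.
Qed.

Lemma integral_dilated_simplex n (r : R) : 0 < r ->
  (\int[lebesgue_row n]_(s in dilated_simplex r) 1%:E = (r ^+ n / n`!%:R)%:E)%E.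
Proof.
elim: n r => [|n IHn] r r0.
  rewrite integral_cst ?mul1e/=; last exact: measurable_dilated_simplex.
  rewrite diracE expr0 divr1 (_ : (_ \in _) = true)//.
  by apply/mem_set; split=> [[]//|]; rewrite big_ord0.
rewrite (@integral_dilated_simplex_recr _ _ _ (fun _ _ => 1))//.
rewrite (@eq_integral _ (measurableTypeR R) R leb1 _
    (fun y : R => ((r - y) ^+ n / n`!%:R)%:E)); last first.
  move=> y; rewrite inE/= in_itv/= => /andP[y0 yr].
  by rewrite -IHn// subr_gt0.
rewrite (integral_oo_is_derive r0 (is_derive_subrX r n)).
  by rewrite subrr subr0 expr0n/= oppr0 mul0r sub0r mulNr opprK.
move=> y; apply: cvgM; [exact: continuous_subrX|exact: cvg_cst].
Qed.

Lemma integral_dilated_simplex_coord n (r : R) (i : 'I_n) : 0 < r ->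
  (\int[lebesgue_row n]_(s in dilated_simplex r) (s 0%R i)%:E =
   (r ^+ n.+1 / n.+1`!%:R)%:E)%E.
Proof.
elim: n r i => [|n IHn] r i r0; first by case: i.
have s_ge0 (s : 'rV[R]_n.+1) : dilated_simplex r s -> 0 <= s 0 i.
  by case=> + _ => /(_ i)/ltW.
(* Either the coordinate is one of the slice, and induction applies, or it is the height of the
   slice. *)
have [j ij|ij] := unliftP ord0 i.
  rewrite (@integral_dilated_simplex_recr _ _ _ (fun _ x => x 0 j))//; last 2 first.
  - exact: measurable_row_coord.
  - by move=> x y; rewrite ij row_consS.
  rewrite (@eq_integral _ (measurableTypeR R) R leb1 _
    (fun y : R => ((r - y) ^+ n.+1 / n.+1`!%:R)%:E)); last first.
    move=> y; rewrite inE/= in_itv/= => /andP[y0 yr].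
    by rewrite -(IHn _ j)// subr_gt0.
  rewrite (integral_oo_is_derive r0 (is_derive_subrX r n.+1)).
    by rewrite subrr subr0 expr0n/= oppr0 mul0r sub0r mulNr opprK.
  by move=> y; apply: cvgM; [exact: continuous_subrX|exact: cvg_cst].
rewrite (@integral_dilated_simplex_recr _ _ _ (fun y _ => y))//; last 2 first.
- exact: measurable_row_coord.
- by move=> x y; rewrite ij row_cons0.
(* The antiderivative of [y (r - y)^n / n!] obtained by parts. *)
pose F (y : R) := y * (- (r - y) ^+ n.+1 / n.+1`!%:R) +
  - (r - y) ^+ n.+2 / n.+2`!%:R.
have dF (y : R) : is_derive y 1 F (y * ((r - y) ^+ n / n`!%:R)).
  have d1 := is_derive1M (is_derive_id y 1) (is_derive_subrX r n y).
  apply: (is_derive_eq (is_derive1D d1 (is_derive_subrX r n.+1 y))).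
  by rewrite mul1r mulNr addrAC addNr add0r.
rewrite (@eq_integral _ (measurableTypeR R) R leb1 _
    (fun y : R => (y * ((r - y) ^+ n / n`!%:R))%:E)); last first.
  move=> y; rewrite inE/= in_itv/= => /andP[y0 yr].
  have ry0 : 0 < r - y by rewrite subr_gt0.
  rewrite integral_cst; last exact: measurable_dilated_simplex.
  rewrite EFinM; congr (_ * _)%E; rewrite -integral_dilated_simplex//.
  by rewrite integral_cst ?mul1e//; exact: measurable_dilated_simplex.
rewrite (integral_oo_is_derive r0 dF).
  by rewrite /F !subrr subr0 !expr0n/= !(oppr0, mul0r, mulr0, add0r, addr0) mulNr opprK.
move=> y; apply: cvgM; first exact: cvg_id.
by apply: cvgM; [exact: continuous_subrX|exact: cvg_cst].
Qed.

End moments.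

Section simplex_integral.
Context {R : realType} {m : nat}.
Notation V := 'rV[R]_m.+1.
Implicit Types (v : 'I_m.+1 -> V) (f : V -> R).
Local Notation leb := (@lebesgue_row R m).

Let measurable_ref : measurable (@ref_simplex R m).
Proof. exact: (@measurable_dilated_simplex R m 1). Qed.

Let Rint1 : \int[leb]_(s in @ref_simplex R m) (1 : R) = (m`!%:R)^-1.
Proof. by rewrite /Rintegral (integral_dilated_simplex m ltr01)/= expr1n mul1r. Qed.

Lemma simplex_param_open v s : ref_simplex s -> open_simplex v (simplex_param v s).
Proof.
move=> [s0 s1].
exists (fun i => oapp (fun j => s 0 j) (1 - \sum_j s 0 j) (unlift ord0 i)); split.
- by move=> i; case: unliftP => [j _|_] /=; [exact: s0|rewrite subr_gt0].
- rewrite big_ord_recl unlift_none/=; under [X in _ + X]eq_bigr do rewrite liftK/=.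
  by rewrite subrK.
- rewrite big_ord_recl unlift_none/= /simplex_param mulmx_sum_row.
  under [X in _ = _ + X]eq_bigr do rewrite liftK/=.
  rewrite scalerBl scale1r -addrA scaler_suml -sumrN -big_split/=; congr (_ + _).
  by apply: eq_bigr => j _; rewrite /edge_mx rowK scalerBr addrC.
Qed.

Lemma simplex_areaE v : simplex_area v = simplex_jac v / m`!%:R.
Proof. by rewrite /simplex_area /simplex_int/= Rint1. Qed.

Lemma simplex_int_cst v f c : (forall z, open_simplex v z -> f z = c) ->
  simplex_int v f = simplex_area v * c.
Proof.
move=> fc; rewrite simplex_areaE /simplex_int -mulrA; congr (_ * _).
rewrite (@eq_Rintegral _ _ _ _ _ (cst c)).
  rewrite Rintegral_cst// mulrC; congr (_ * _).
  by rewrite -Rint1 Rintegral_cst// mul1r.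
by move=> s /set_mem sref /=; rewrite fc//; exact: simplex_param_open.
Qed.

Let integrable1 : leb.-integrable (@ref_simplex R m) (EFin \o cst 1).
Proof.
apply/integrableP; split; first exact/measurable_EFinP.
rewrite (eq_integral (fun=> 1%:E)).
  by rewrite (integral_dilated_simplex m ltr01) ltry.
by move=> s _ /=; rewrite normr1.
Qed.

Let integrable_coord i : leb.-integrable (@ref_simplex R m) (EFin \o (fun s => s 0 i)).
Proof.
apply/integrableP; split.
  apply: measurable_funTS; apply/measurable_EFinP; exact: measurable_row_coord.
rewrite (eq_integral (fun s : 'rV_m => (s 0 i)%:E)).
  by rewrite (integral_dilated_simplex_coord i ltr01) ltry.
by move=> s /set_mem[s0 _] /=; rewrite ger0_norm// ltW.
Qed.

Let Rint_coord i : \int[leb]_(s in @ref_simplex R m) s 0 i = (m.+1`!%:R)^-1.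
Proof. by rewrite /Rintegral (integral_dilated_simplex_coord i ltr01)/= expr1n mul1r. Qed.

Let Rint_affine (b : R) (c : 'I_m -> R) :
  \int[leb]_(s in @ref_simplex R m) (b + \sum_i c i * s 0 i) =
  b / m`!%:R + \sum_i c i / m.+1`!%:R.
Proof.
have ic i : leb.-integrable (@ref_simplex R m) (EFin \o (fun s => c i * s 0 i)).
  exact: (integrableZl measurable_ref (c i) (integrable_coord i)).
have ib : leb.-integrable (@ref_simplex R m) (EFin \o cst b).
  have := integrableZl measurable_ref b integrable1.
  by apply: eq_integrable => // s _ /=; rewrite mule1.
have hsum (r : seq 'I_m) :
    leb.-integrable (@ref_simplex R m) (EFin \o (fun s => \sum_(i <- r) c i * s 0 i)) /\
    \int[leb]_(s in @ref_simplex R m) (\sum_(i <- r) c i * s 0 i) =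
    \sum_(i <- r) c i / m.+1`!%:R.
  elim: r => [|i r [IH1 IH2]].
    rewrite big_nil; split.
      apply: (@eq_integrable _ _ _ leb _ measurable_ref _ _ _ (integrable0 leb _)) => // s _ /=.
      by rewrite big_nil.
    under eq_Rintegral do rewrite big_nil.
    by rewrite Rintegral_cst// mul0r.
  split.
    apply: (@eq_integrable _ _ _ leb _ measurable_ref _ _ _
      (integrableD measurable_ref (ic i) IH1)) => // s _ /=.
    by rewrite big_cons.
  rewrite big_cons -IH2 -(Rint_coord i) -RintegralZl//; last exact: integrable_coord.
  have := RintegralD measurable_ref (ic i) IH1 => <-.
  by apply: eq_Rintegral => s _; rewrite big_cons.
have [i1 i2] := hsum (index_enum 'I_m).
rewrite RintegralD// i2; congr (_ + _).
by rewrite -Rint1 !Rintegral_cst// mul1r.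
Qed.

(** Each coordinate has moment [1 / m.+1!] over the reference simplex, the fraction [1 / m.+1] of
    its volume [1 / m!]. Hence the mean of the vertex values is exact for affine integrands, which
    is the exactness of mass lumping on piecewise linear functions. *)
Lemma simplex_int_affine v f a b :
  (forall z, open_simplex v z -> f z = dotv a z + b) ->
  simplex_int v f = simplex_area v * (m.+1%:R^-1 * \sum_i (dotv a (v i) + b)).
Proof.
move=> fab; rewrite simplex_areaE /simplex_int -mulrA; congr (_ * _).
pose c i := dotv a (v (lift ord0 i) - v ord0).
rewrite (@eq_Rintegral _ _ _ _ _
  (fun s : 'rV[R]_m => (dotv a (v ord0) + b) + \sum_i c i * s 0 i)).
  rewrite Rint_affine.
  set S := \sum_(i < m.+1) _.
  have -> : S = m.+1%:R * (dotv a (v ord0) + b) + \sum_i c i.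
    rewrite /S big_ord_recl.
    rewrite (eq_bigr (fun i => (dotv a (v ord0) + b) + c i)); last first.
      by move=> i _; rewrite /c dotvBr; lra.
    by rewrite big_split/= sumr_const card_ord addrA -mulrS mulr_natl.
  rewrite mulrDr mulKf ?pnatr_eq0// mulrDr -mulr_suml [X in X + _]mulrC; congr (_ + _).
  by rewrite factS natrM invfM mulrCA mulrA mulrC mulrA.
move=> s /set_mem sref /=; rewrite fab; last exact: simplex_param_open.
rewrite /simplex_param dotvDr addrAC; congr (_ + _).
rewrite mulmx_sum_row dotv_sumr; apply: eq_bigr => i _.
by rewrite dotvZr /edge_mx rowK mulrC.
Qed.

End simplex_integral.

(** * Limits at the vertices and piecewise linear functions *)

Section limits.
Context {R : realType}.

Lemma cvg_rowP (T : Type) (F : set_system T) (FF : Filter F) n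
    (f : T -> 'rV[R]_n) (a : 'rV[R]_n) :
  (forall i, f x 0 i @[x --> F] --> a 0 i) -> f @ F --> a.
Proof.
move=> fa A [P aP PA].
suff : \forall x \near F, forall i j, P i j (f x i j).
  by apply: filterS => x Px; exact: PA.
have : \forall x \near F, forall i, P 0 i (f x 0 i).
  by apply: filter_forall => i; exact: (fa i _ (aP 0 i)).
by apply: filterS => x Px i j; rewrite ord1.
Qed.

Lemma cvg_row_coord (T : Type) (F : set_system T) (FF : Filter F) n
    (f : T -> 'rV[R]_n) (a : 'rV[R]_n) i :
  f @ F --> a -> f x 0 i @[x --> F] --> a 0 i.
Proof.
by move=> fa; exact: (cvg_comp _ _ fa (@coord_continuous R 1 n 0 i a)).
Qed.

Lemma cvg_sumr (T : Type) (F : set_system T) (FF : Filter F) (I : Type)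
    (r : seq I) (P : pred I) (f : I -> T -> R) (a : I -> R) :
  (forall i, P i -> f i @ F --> a i) ->
  (\sum_(i <- r | P i) f i x) @[x --> F] --> \sum_(i <- r | P i) a i.
Proof.
move=> fa; elim: r => [|i r IHr].
  by rewrite big_nil; under eq_fun do rewrite big_nil; exact: cvg_cst.
rewrite big_cons; under eq_fun do rewrite big_cons.
by case: ifPn => // Pi; apply: cvgD => //; exact: fa.
Qed.

Lemma continuous_sumr (X : topologicalType) (I : Type) (r : seq I) (P : pred I)
    (f : I -> X -> R) :
  (forall i, P i -> continuous (f i)) ->
  continuous (fun x => \sum_(i <- r | P i) f i x).
Proof. by move=> cf x; apply: cvg_sumr => i Pi; exact: cf. Qed.

Lemma continuous_prodr (X : topologicalType) (I : Type) (r : seq I) (P : pred I)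
    (f : I -> X -> R) :
  (forall i, P i -> continuous (f i)) ->
  continuous (fun x => \prod_(i <- r | P i) f i x).
Proof.
move=> cf x; elim: r => [|i r IHr].
  by rewrite /continuous_at big_nil; under eq_fun do rewrite big_nil; exact: cvg_cst.
rewrite /continuous_at big_cons; under eq_fun do rewrite big_cons.
by case: ifPn => // Pi; apply: cvgM => //; exact: cf.
Qed.

Lemma continuousMr (X : topologicalType) (f g : X -> R) :
  continuous f -> continuous g -> continuous (fun x => f x * g x).
Proof. by move=> cf cg x; apply: cvgM; [exact: cf|exact: cg]. Qed.

Lemma cvg_dotv (T : Type) (F : set_system T) (FF : Filter F) n
    (f g : T -> 'rV[R]_n) (a b : 'rV[R]_n) :
  f @ F --> a -> g @ F --> b -> dotv (f x) (g x) @[x --> F] --> dotv a b.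
Proof.
move=> fa gb; apply: cvg_sumr => i _.
by apply: cvgM; exact: cvg_row_coord.
Qed.

Lemma cvg_withinS (T U : Type) (F : set_system T) (FF : Filter F) (A B : set T)
    (g : T -> U) (G : set_system U) : A `<=` B ->
  g @ within B F `=>` G -> g @ within A F `=>` G.
Proof.
by move=> AB gB W /gB; apply: (@filterS _ F) => x gx /AB /gx.
Qed.

(** Pasting over finitely many closed pieces: near a point, the pieces that miss it can be
    discarded, and on each of the others the function agrees with a continuous one having the same
    value at the point. *)
Lemma closed_within_patch (X : topologicalType) (U : topologicalType) (I : finType)
    (B : I -> set X) (f : X -> U) (g : I -> X -> U) (A : set X) :
  (forall i, closed (B i)) -> A `<=` \bigcup_i B i ->
  (forall i x, B i x -> A x -> f x = g i x) ->
  (forall i, continuous (g i)) ->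
  {within A, continuous f}.
Proof.
move=> cB AB fg cg; apply/subspace_continuousP => x Ax W fxW.
have : \forall y \near within A (nbhs x), forall i, B i y -> W (f y).
  apply: filter_forall => i; have [Bx|nBx] := pselect (B i x); last first.
    apply: cvg_within; have : open_nbhs x (~` B i) by split=> //; exact: closed_openC.
    by move=> /open_nbhs_nbhs; apply: filterS.
  have gW : nbhs x (g i @^-1` W) by apply: cg; rewrite -fg.
  by apply: filterS gW => y gyW Ay By; rewrite (fg i).
move=> h; have hA : \forall y \near within A (nbhs x), A y by exact: withinT.
apply: filterS2 h hA => y h /AB[i _ By]; exact: h By.
Qed.

End limits.

Section simplex_limits.
Context {R : realType} {m : nat}.
Notation V := 'rV[R]_m.+1.
Implicit Types (v : 'I_m.+1 -> V) (z w : V).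

Lemma cvg_bary (T : Type) (F : set_system T) (FF : Filter F)
    (u : T -> 'I_m.+1 -> V) (f : T -> V) v z i :
  bary_grad (u x) i @[x --> F] --> bary_grad v i ->
  u x ord0 @[x --> F] --> v ord0 -> f @ F --> z ->
  bary (u x) i (f x) @[x --> F] --> bary v i z.
Proof.
move=> cg cu cf; apply: cvgD; first exact: cvg_cst.
by apply: cvg_dotv => //; exact: cvgB.
Qed.

Lemma bary_continuous v i : continuous (bary v i).
Proof.
move=> z; apply: (@cvg_bary _ (nbhs z) _ (fun=> v)); by [exact: cvg_cst|exact: cvg_id].
Qed.

(** The segment to the barycentre approaches [z] through interior points. Properness makes limits
    from within a simplex unique, so that the [lim] in [lumped] can be computed. *)
Lemma within_open_simplex_proper v z : closed_simplex v z ->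
  ProperFilter (within (open_simplex v) (nbhs z)).
Proof.
move=> [l [l0 l1 zE]]; apply: within_nbhs_proper.
pose b := \sum_i m.+1%:R^-1 *: v i.
pose g (s : R) := (1 - s) *: z + s *: b.
have gz : g s @[s --> 0^'+] --> z.
  have -> : z = (1 - 0) *: z + 0 *: b by rewrite subr0 scale1r scale0r addr0.
  apply: cvg_at_right_filter; apply: cvgD; apply: cvgZr_tmp; try exact: cvg_id.
  by apply: cvgB; [exact: cvg_cst|exact: cvg_id].
have go : \forall s \near 0^'+, open_simplex v (g s).
  near=> s.
  have s0 : 0 < s by [].
  have s1 : s < 1 by near: s; apply: nbhs_right_lt.
  exists (fun i => (1 - s) * l i + s / m.+1%:R); split.
  - move=> i; apply: ltr_wpDl; first by rewrite mulr_ge0// subr_ge0 ltW.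
    by rewrite divr_gt0.
  - rewrite big_split/= -mulr_sumr l1 mulr1 sumr_const card_ord.
    by rewrite -[_ *+ _]mulr_natr divfK// subrK.
  - under eq_bigr do rewrite scalerDl -!scalerA.
    by rewrite /g /b big_split/= -!scaler_sumr [in LHS]zE.
move=> B zB; have gB : \forall s \near 0^'+, B (g s) by exact: gz.
have [s [so sB]] : exists s, open_simplex v (g s) /\ B (g s).
  by apply: (@filter_ex _ (0 : R)^'+); exact: filterI.
by exists (g s).
Unshelve. all: by end_near. Qed.

End simplex_limits.

(** * Gradient of an affine function on a simplex *)

Section simplex_functions.
Context {R : realType} {m : nat}.
Notation V := 'rV[R]_m.+1.
Implicit Types (v : 'I_m.+1 -> V) (z w : V) (f : V -> R).

(** A tangent displacement stays in the affine hull, and the finitely many positive coordinates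
    remain positive for small [h]. *)
Lemma open_simplex_tangent_near v z w : Defs.nondegenerate v -> open_simplex v z ->
  tangent v w -> \forall h \near (0 : R), open_simplex v (h *: w + z).
Proof.
move=> ndv /(open_simplexE _ ndv)[z0 zE] tw.
have hz : h *: w + z @[h --> (0 : R)] --> z.
  have : h *: w + z @[h --> (0 : R)] --> 0 *: w + z.
    by apply: cvgD; [apply: cvgZr_tmp; exact: cvg_id|exact: cvg_cst].
  by rewrite scale0r add0r.
have : \forall h \near (0 : R), forall i, 0 < bary v i (h *: w + z).
  apply: (@filter_forall _ _ _ (nbhs (0 : R))) => i.
  have cb : bary v i (h *: w + z) @[h --> (0 : R)] --> bary v i z.
    apply: (@cvg_bary _ _ _ (nbhs (0 : R)) _ (fun=> v) (fun h => h *: w + z));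
      by [exact: cvg_cst|exact: cvg_cst|].
  exact: (cvgr_gt _ cb).
apply: filterS => h h0; apply/(open_simplexE _ ndv); split => //.
have bE i : bary v i (h *: w + z) = h * dotv (bary_grad v i) w + bary v i z.
  by apply/eqP; rewrite -subr_eq baryB addrK dotvZr.
under eq_bigr do rewrite bE scalerDl -scalerA.
by rewrite big_split/= -zE -scaler_sumr -tangent_expand.
Qed.

(** The gradient is a chosen vector, so uniqueness is required: two tangent vectors with the same
    products against all tangent vectors differ by a tangent vector orthogonal to itself. *)
Lemma simplex_grad_bary v f (c : 'I_m.+1 -> R) z : Defs.nondegenerate v ->
  (forall y, open_simplex v y -> f y = \sum_i c i * bary v i y) ->
  open_simplex v z -> simplex_grad v f z = \sum_i c i *: bary_grad v i.
Proof.
move=> ndv fE oz; set g := \sum_i _.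
have tD (a b : V) : tangent v a -> tangent v b -> tangent v (a - b).
  move=> [l [l0 ->]] [k [k0 ->]]; exists (fun i => l i - k i).
  by split; [rewrite sumrB l0 k0 subrr|under [RHS]eq_bigr do rewrite scalerBl; rewrite sumrB].
have tg : tangent v g.
  have [l lP] := choice (bary_grad_tangent v).
  exists (fun k => \sum_i c i * l i k); split.
    by rewrite exchange_big big1// => i _; rewrite -mulr_sumr (lP i).1 mulr0.
  under [RHS]eq_bigr do rewrite scaler_suml.
  rewrite exchange_big; apply: eq_bigr => i _.
  by rewrite (lP i).2 scaler_sumr; apply: eq_bigr => k _; rewrite scalerA.
have dg w : tangent v w -> is_derive z w f (dotv g w).
  move=> tw.
  have L : h^-1 *: (f (h *: w + z) - f z) @[h --> 0^'] --> dotv g w.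
    apply: cvg_near_cst; near=> h.
    have h0 : h != 0 by near: h; exact: nbhs_dnbhs_neq.
    rewrite !fE//; last first.
      near: h; apply: cvg_within.
      exact: open_simplex_tangent_near.
    rewrite -sumrB; under eq_bigr do rewrite -mulrBr baryB addrK dotvZr.
    rewrite scaler_sumr /g dotv_suml; apply: eq_bigr => i _.
    by rewrite dotvZl /GRing.scale/= mulrCA [_^-1 * (_ * _)]mulrA mulVf// mul1r.
  apply: DeriveDef; first by apply/cvg_ex; exists (dotv g w).
  exact: cvg_lim L.
have [tG dG] : [set g | tangent v g /\
    forall w, tangent v w -> is_derive z w f (dotv g w)] (simplex_grad v f z).
  by apply: (@getPex _ [set g | _]); exists g.
set G := simplex_grad v f z in tG dG *.
apply/eqP; rewrite -subr_eq0; apply/eqP; apply: dotv_eq0.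
have tGg := tD _ _ tG tg.
rewrite dotvBl; apply/eqP; rewrite subr_eq0; apply/eqP.
by have [_ <-] := dG _ tGg; have [_ <-] := dg _ tGg.
Unshelve. all: by end_near. Qed.

End simplex_functions.

Lemma sum_delta (R : pzRingType) (I : finType) (F : I -> R) i :
  \sum_k (k == i)%:R * F k = F i.
Proof.
rewrite (bigD1 i)//= eqxx mul1r big1 ?addr0// => k /negbTE ->.
by rewrite mul0r.
Qed.

(** The parameter space is arbitrary so that one statement covers the simplices of a fixed surface,
    with [u] constant, and the space-time simplices of a moving one. *)
Lemma closed_simplex_preimage (R : realType) (m : nat) (X : topologicalType)
    (u : X -> 'I_m.+1 -> 'rV[R]_m.+1) (f : X -> 'rV[R]_m.+1) :
  (forall x, Defs.nondegenerate (u x)) ->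
  (forall i, continuous (fun x => u x i)) ->
  (forall i, continuous (fun x => bary_grad (u x) i)) ->
  continuous f -> closed [set x | closed_simplex (u x) (f x)].
Proof.
move=> ndu cu cg cf.
have cb i : continuous (fun x => bary (u x) i (f x)).
  by move=> x; apply: cvg_bary; [exact: cg|exact: cu|exact: cf].
have -> : [set x | closed_simplex (u x) (f x)] =
    (\bigcap_(i in [set: 'I_m.+1])
      ((fun x => bary (u x) i (f x)) @^-1` [set r | 0 <= r])) `&`
    \bigcap_(k in [set: 'I_m.+1])
      ((fun x => f x 0 k - \sum_i bary (u x) i (f x) * u x i 0 k) @^-1` [set 0]).
  have E x k : (\sum_i bary (u x) i (f x) *: u x i) 0 k =
      \sum_i bary (u x) i (f x) * u x i 0 k.
    by rewrite summxE; apply: eq_bigr => i _; rewrite mxE.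
  apply/seteqP; split=> [x /(closed_simplexE _ (ndu x))[x0 xE]|x [x0 xE]].
    split=> [i _|k _] /=; first exact: x0.
    by rewrite -E -xE subrr.
  apply/(closed_simplexE _ (ndu x)); split=> [i|]; first exact: x0.
  by apply/rowP => k; rewrite E; apply/eqP; rewrite -subr_eq0; apply/eqP; exact: xE.
apply: closedI; apply: closed_bigI => i _.
  by apply: preimage_closed; [move=> x _; exact: cb|exact: closed_ge].
apply: preimage_closed; last exact: closed_eq.
move=> x _; apply: cvgB; first by apply: cvg_row_coord; exact: cf.
apply: cvg_sumr => k _; apply: cvgM; first exact: cb.
by apply: cvg_row_coord; exact: cu.
Qed.

(** * Piecewise linear functions on a polyhedral surface *)

Section polyhedral_surfaces.
Context {R : realType} {m K J : nat} (tri : 'I_J -> 'I_m.+1 -> 'I_K).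
Notation V := 'rV[R]_m.+1.
Implicit Types (q : 'I_K -> V) (f eta : V -> R) (z : V).

Notation sv := (sv tri).
Notation surf := (surf tri).

Lemma surf_simplex q j : closed_simplex (sv q j) `<=` surf q.
Proof. by move=> z jz; exists j. Qed.

Lemma surf_vertex q j i : surf q (sv q j i).
Proof. by exists j => //; exact: closed_simplex_vertex. Qed.

Lemma cvg_within_open q j i (U : topologicalType) (g : V -> U) (A : set V) :
  {within A, continuous g} -> open_simplex (sv q j) `<=` A -> A (sv q j i) ->
  g @ within (open_simplex (sv q j)) (nbhs (sv q j i)) --> g (sv q j i).
Proof.
move=> /subspace_continuousP cg sA Av.
by apply: cvg_withinS (cg _ Av).
Qed.

Lemma open_simplex_surf q j : open_simplex (sv q j) `<=` surf q.
Proof. by move=> z oz; apply: (@surf_simplex _ j); exact: open_closed_simplex. Qed.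

Section fixed.
Variable q : 'I_K -> V.
Hypothesis qP : polyhedral_surface tri q.

Lemma surface_nondegenerate j : Defs.nondegenerate (sv q j).
Proof. by case: qP. Qed.
Local Notation ndq := (@surface_nondegenerate).

Lemma tri_inj j : injective (tri j).
Proof.
have inj := nondegenerate_inj (ndq j).
by move=> i k ik; apply: inj; rewrite /Defs.sv ik.
Qed.

(** Membership in [Wspace] gives an affine formula on the open simplex only; continuity carries it
    to the closed simplex, where the vertex values determine it. *)
Lemma Wspace_bary eta j z : Wspace tri q eta -> closed_simplex (sv q j) z ->
  eta z = \sum_i eta (q (tri j i)) * bary (sv q j) i z.
Proof.
move=> [ceta /(_ j)[a [b ab]]].
have ext y : closed_simplex (sv q j) y -> eta y = dotv a y + b.
  move=> jy; have pF := within_open_simplex_proper jy.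
  have c1 : eta @ within (open_simplex (sv q j)) (nbhs y) --> eta y.
    move: ceta => /subspace_continuousP/(_ _ (surf_simplex jy)).
    by apply: cvg_withinS; exact: open_simplex_surf.
  have c2 : (dotv a x + b) @[x --> within (open_simplex (sv q j)) (nbhs y)] --> dotv a y + b.
    apply: cvgD; last exact: cvg_cst.
    by apply: cvg_dotv; [exact: cvg_cst|exact: cvg_within].
  have c3 : eta @ within (open_simplex (sv q j)) (nbhs y) --> dotv a y + b.
    apply: cvg_trans c2; apply: near_eq_cvg.
    have : \forall x \near within (open_simplex (sv q j)) (nbhs y), open_simplex (sv q j) x.
      exact: withinT.
    by apply: filterS => x /ab.
  exact: (cvg_unique _ c1 c3).
move=> jz; rewrite ext//.
rewrite (eq_bigr (fun i => dotv a (sv q j i) * bary (sv q j) i z +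
    b * bary (sv q j) i z)); last first.
  by move=> i _; rewrite ext ?mulrDl//; exact: (closed_simplex_vertex (sv q j)).
have [b0 zE] := (closed_simplexE z (ndq j)).1 jz.
rewrite big_split/= -mulr_sumr bary_sum1 mulr1; congr (_ + _).
rewrite [in LHS]zE dotv_sumr; apply: eq_bigr => i _.
by rewrite dotvZr mulrC.
Qed.

(** There are no hanging vertices: a common point of two simplices is a combination of common
    vertices, so its two sets of barycentric coordinates coincide there and vanish at all other
    vertices. *)
Lemma hat_glue (c : 'I_K -> R) j l z :
  closed_simplex (sv q j) z -> closed_simplex (sv q l) z ->
  \sum_i c (tri j i) * bary (sv q j) i z = \sum_i c (tri l i) * bary (sv q l) i z.
Proof.
move=> jz lz; have [_ _ /(_ j l z (conj jz lz))] := qP.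
move=> [k [k0 kv k1 ->]].
under eq_bigr do rewrite (bary_comb _ (ndq j))//.
(* The weights carried over to simplex [l]; as [tri j] is injective, each inner sum has at most one
   term. *)
have -> : \sum_i k i *: sv q j i = \sum_i' (\sum_(i | tri j i == tri l i') k i) *: sv q l i'.
  under [RHS]eq_bigr do rewrite scaler_suml.
  rewrite (exchange_big_dep predT)//=; apply: eq_bigr => i _.
  have [ki0|/kv/imsetP[i' _ ii']] := eqVneq (k i) 0.
    by rewrite ki0 scale0r big1// => ? _; rewrite scale0r.
  rewrite (big_pred1 i') => [|i'']; first by rewrite /Defs.sv ii'.
  by rewrite ii' (inj_eq (@tri_inj l)) eq_sym.
have k1' : \sum_i' (\sum_(i | tri j i == tri l i') k i) = 1.
  rewrite (exchange_big_dep predT)//= -k1; apply: eq_bigr => i _.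
  have [ki0|/kv/imsetP[i' _ ii']] := eqVneq (k i) 0.
    by rewrite ki0 big1.
  by rewrite (big_pred1 i') => [//|i'']; rewrite ii' (inj_eq (@tri_inj l)) eq_sym.
under [RHS]eq_bigr do rewrite (bary_comb _ (ndq l))// mulr_sumr.
rewrite (exchange_big_dep predT)//=; apply: eq_bigr => i _.
have [ki0|/kv/imsetP[i' _ ii']] := eqVneq (k i) 0.
  by rewrite ki0 mulr0 big1// => ? _; rewrite mulr0.
rewrite (big_pred1 i') => [|i'']; first by rewrite ii'.
by rewrite ii' (inj_eq (@tri_inj l)) eq_sym.
Qed.

(** An explicit element of [Wspace] with prescribed vertex values, the witness behind the chosen
    function [chi]. By [hat_glue] the simplex that is picked is immaterial. *)
Definition nodal_fun (c : 'I_K -> R) z : R :=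
  if [pick j | `[< closed_simplex (sv q j) z >]] is Some j
  then \sum_i c (tri j i) * bary (sv q j) i z else 0.

Lemma nodal_funE c j z : closed_simplex (sv q j) z ->
  nodal_fun c z = \sum_i c (tri j i) * bary (sv q j) i z.
Proof.
move=> jz; rewrite /nodal_fun; case: pickP => [l /asboolP lz|/(_ j)/asboolP//].
exact: hat_glue.
Qed.

Lemma Wspace_nodal_fun c : Wspace tri q (nodal_fun c).
Proof.
split.
  apply: (@closed_within_patch _ _ 'I_J (fun j => closed_simplex (sv q j)) _
    (fun j z => \sum_i c (tri j i) * bary (sv q j) i z)).
  - move=> j; apply: (@closed_simplex_preimage R m V (fun=> sv q j) id).
    + by move=> _; exact: ndq.
    + by move=> i; exact: cst_continuous.
    + by move=> i; exact: cst_continuous.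
    + by move=> z W.
  - by [].
  - by move=> j z jz _; exact: nodal_funE.
  - move=> j; apply: continuous_sumr => i _; apply: continuousMr; last exact: bary_continuous.
    exact: cst_continuous.
move=> j; exists (\sum_i c (tri j i) *: bary_grad (sv q j) i).
exists (\sum_i c (tri j i) * bary (sv q j) i 0) => z oz.
rewrite (nodal_funE _ (open_closed_simplex oz)) dotv_suml -big_split/=.
apply: eq_bigr => i _; rewrite dotvZl -mulrDr; congr (_ * _).
by apply/eqP; rewrite -subr_eq baryB subr0.
Qed.

Lemma nodal_fun_vertex c j i : nodal_fun c (q (tri j i)) = c (tri j i).
Proof.
rewrite (nodal_funE _ (closed_simplex_vertex (sv q j) i)).
under eq_bigr do rewrite (bary_vertex _ _ (ndq j)) mulrC.
under eq_bigr do rewrite eq_sym.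
by rewrite sum_delta.
Qed.

Hypothesis tri_surj : forall k, exists j, k \in vset tri j.

Lemma vertex_ind (P : 'I_K -> Prop) : (forall j i, P (tri j i)) -> forall k, P k.
Proof. by move=> Ptri k; have [j /imsetP[i _ ->]] := tri_surj k. Qed.

Lemma chiP k : Wspace tri q (chi tri q k) /\ forall l, chi tri q k (q l) = (l == k)%:R.
Proof.
apply: (@getPex _ [set eta : V -> R | Wspace tri q eta /\ forall l, eta (q l) = (l == k)%:R]).
exists (nodal_fun (fun l => (l == k)%:R)); split; first exact: Wspace_nodal_fun.
by apply: vertex_ind => j i; exact: nodal_fun_vertex.
Qed.

Lemma chiE k j z : closed_simplex (sv q j) z ->
  chi tri q k z = \sum_i (tri j i == k)%:R * bary (sv q j) i z.
Proof.
have [Wchi chiq] := chiP k.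
by move=> jz; rewrite (Wspace_bary Wchi jz); under eq_bigr do rewrite chiq.
Qed.

Lemma sum_chiE (c : 'I_K -> R) j z : closed_simplex (sv q j) z ->
  \sum_k c k * chi tri q k z = \sum_i c (tri j i) * bary (sv q j) i z.
Proof.
move=> jz; under eq_bigr do rewrite (chiE _ jz) mulr_sumr.
rewrite exchange_big; apply: eq_bigr => i _.
under eq_bigr do rewrite mulrA [_ * (_ == _)%:R]mulrC eq_sym -mulrA.
by rewrite sum_delta.
Qed.

Lemma sgrad_bary f j (c : 'I_m.+1 -> R) z :
  (forall y, open_simplex (sv q j) y -> f y = \sum_i c i * bary (sv q j) i y) ->
  open_simplex (sv q j) z ->
  sgrad tri q f z = \sum_i c i *: bary_grad (sv q j) i.
Proof.
move=> fE oz; rewrite /sgrad; case: pickP => [l /asboolP lz|/(_ j)/asboolP//].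
(* [sgrad] picks some simplex whose interior contains [z]; disjointness of the interiors leaves only
   [j]. *)
have <- : j = l.
  have [_ + _] := qP => /(_ j l) disj.
  have [//|/eqP/disj jl0] := pselect (j = l).
  by have : set0 z by rewrite -jl0.
exact: simplex_grad_bary (ndq j) fE oz.
Qed.

Lemma sgrad_Wspace eta j z : Wspace tri q eta -> open_simplex (sv q j) z ->
  sgrad tri q eta z = \sum_i eta (q (tri j i)) *: bary_grad (sv q j) i.
Proof.
move=> We oz; apply: sgrad_bary (oz) => y oy.
by rewrite (Wspace_bary We (open_closed_simplex oy)).
Qed.

Lemma lumpedE f (F : 'I_J -> 'I_m.+1 -> R) :
  (forall j i, f @ within (open_simplex (sv q j)) (nbhs (sv q j i)) --> F j i) ->
  lumped tri q f = m.+1%:R^-1 * \sum_j simplex_area (sv q j) * \sum_i F j i.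
Proof.
move=> fF; congr (_ * _); apply: eq_bigr => j _; congr (_ * _); apply: eq_bigr => i _.
have pF := within_open_simplex_proper (closed_simplex_vertex (sv q j) i).
exact: (cvg_lim _ (fF j i)).
Qed.

End fixed.
End polyhedral_surfaces.

Lemma cvg_comp_within (T : Type) (Y Z : topologicalType) (F : set_system T)
    (FF : Filter F) (A : set Y) (f : T -> Y) (g : Y -> Z) (l : Y) :
  (\forall x \near F, A (f x)) -> A l -> f @ F --> l -> {within A, continuous g} ->
  g (f x) @[x --> F] --> g l.
Proof.
move=> fA Al fl /subspace_continuousP/(_ l Al) gl P /gl Pgl.
have h : \forall y \near l, A y -> P (g y) by exact: Pgl.
have h' : \forall x \near F, A (f x) -> P (g (f x)) by exact: (fl _ h).
change (\forall x \near F, P (g (f x))).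
by apply: filterS2 fA h' => x Afx; apply.
Qed.

Section nodal_vectors.
Context {R : realType} {m K J : nat} (tri : 'I_J -> 'I_m.+1 -> 'I_K).
Notation V := 'rV[R]_m.+1.
Variable q : 'I_K -> V.
Hypothesis qP : polyhedral_surface tri q.
Hypothesis tri_surj : forall k, exists j, k \in vset tri j.

Lemma Wspace_eq (f g : V -> R) : {in surf tri q, f =1 g} ->
  Wspace tri q f -> Wspace tri q g.
Proof.
move=> fg [cf af]; split; first exact: subspace_eq_continuous cf.
move=> j; have [a [b ab]] := af j; exists a, b => z oz.
by rewrite -fg ?ab// inE; exact: open_simplex_surf oz.
Qed.

Lemma Wspace_sum_chi (c : 'I_K -> R) : Wspace tri q (fun z => \sum_k c k * chi tri q k z).
Proof.
apply: Wspace_eq (Wspace_nodal_fun qP c) => z /set_mem[j _ jz].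
by rewrite (nodal_funE qP c jz) (sum_chiE qP tri_surj c jz).
Qed.

Lemma sum_chi_vertex (c : 'I_K -> R) k : \sum_l c l * chi tri q l (q k) = c k.
Proof.
under eq_bigr do rewrite (chiP qP tri_surj _).2 mulrC eq_sym.
by rewrite sum_delta.
Qed.

Definition nodal_vec (b : 'I_K -> V) (z : V) : V := \sum_k chi tri q k z *: b k.

Lemma nodal_vec_coord b z i : nodal_vec b z 0 i = \sum_k b k 0 i * chi tri q k z.
Proof. by rewrite summxE; apply: eq_bigr => k _; rewrite mxE mulrC. Qed.

Lemma Vspace_nodal_vec b : Vspace tri q (nodal_vec b).
Proof. by move=> i; under eq_fun do rewrite nodal_vec_coord; exact: Wspace_sum_chi. Qed.

Lemma nodal_vec_vertex b k : nodal_vec b (q k) = b k.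
Proof. by apply/rowP => i; rewrite nodal_vec_coord (sum_chi_vertex (fun k => b k 0 i)). Qed.

(** The limit at a vertex is required to be the same from all simplices around it. Functions
    continuous on the surface qualify; surface gradients, which jump, in general do not. *)
Definition vertex_limit (U : topologicalType) (u : V -> U) (a : 'I_K -> U) : Prop :=
  forall j i, u @ within (open_simplex (sv tri q j)) (nbhs (sv tri q j i)) --> a (tri j i).

Lemma vertex_limit_Wspace eta : Wspace tri q eta -> vertex_limit eta (eta \o q).
Proof.
move=> [ceta _] j i; apply: (cvg_within_open ceta); first exact: open_simplex_surf.
exact: surf_vertex.
Qed.

Lemma vertex_limit_Vspace w : Vspace tri q w -> vertex_limit w (w \o q).
Proof. by move=> Vw j i; apply: cvg_rowP => l; exact: (vertex_limit_Wspace (Vw l)). Qed.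

Lemma vertex_limit_within (U : topologicalType) (u : V -> U) (A : set V) :
  surf tri q `<=` A -> {within A, continuous u} -> vertex_limit u (u \o q).
Proof.
move=> sA cu j i; apply: (cvg_within_open cu); last by apply: sA; exact: surf_vertex.
by move=> z oz; apply: sA; exact: open_simplex_surf oz.
Qed.

(** Continuity of [g] within [A] suffices because the values of [eta] on the surface stay in [A]; in
    this way nothing is asked of gamma and F outside their range. *)
Lemma vertex_limit_comp (A : set R) (g : R -> R) eta : Wspace tri q eta ->
  (forall z, surf tri q z -> A (eta z)) -> {within A, continuous g} ->
  vertex_limit (fun z => g (eta z)) (fun k => g (eta (q k))).
Proof.
move=> We etaA cg j i.
apply: (@cvg_comp_within _ _ _ _ _ A eta g (eta (q (tri j i)))) => //.
- have oA : open_simplex (sv tri q j) `<=` [set z | A (eta z)].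
    by move=> z oz; apply: etaA; exact: open_simplex_surf oz.
  by apply: filterS oA _; exact: withinT.
- by apply: etaA; exact: surf_vertex.
- exact: vertex_limit_Wspace.
Qed.

End nodal_vectors.

(** * Regularity in time *)

Section continuous_matrices.
Context {R : realType} {X : topologicalType}.

Lemma continuous_det n (A : X -> 'M[R]_n) :
  (forall i j, continuous (fun x => A x i j)) -> continuous (fun x => \det (A x)).
Proof.
move=> cA; apply: continuous_sumr => s _; apply: continuousMr.
  exact: cst_continuous.
by apply: continuous_prodr => i _; exact: cA.
Qed.

Lemma continuous_invmx n (A : X -> 'M[R]_n) i j :
  (forall x, A x \in unitmx) -> (forall i j, continuous (fun x => A x i j)) ->
  continuous (fun x => invmx (A x) i j).
Proof.
move=> uA cA.
have -> : (fun x => invmx (A x) i j) = (fun x => (\det (A x))^-1 * \adj (A x) i j).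
  by apply/funext => x; rewrite /invmx uA mxE.
apply: continuousMr.
  move=> x; apply: cvgV; last exact: continuous_det.
  by have := uA x; rewrite unitmxE unitfE.
have -> : (fun x => \adj (A x) i j) =
    (fun x => (-1) ^+ (j + i) * \det (row' j (col' i (A x)))).
  by apply/funext => x; rewrite mxE.
apply: continuousMr; first exact: cst_continuous.
apply: continuous_det => k l.
have -> : (fun x => row' j (col' i (A x)) k l) = (fun x => A x (lift j k) (lift i l)).
  by apply/funext => x; rewrite !mxE.
exact: cA.
Qed.

Lemma continuous_mulmx_entry n p r (A : X -> 'M[R]_(n, p)) (B : X -> 'M[R]_(p, r)) i j :
  (forall i j, continuous (fun x => A x i j)) ->
  (forall i j, continuous (fun x => B x i j)) ->
  continuous (fun x => (A x *m B x) i j).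
Proof.
move=> cA cB; have -> : (fun x => (A x *m B x) i j) = (fun x => \sum_k A x i k * B x k j).
  by apply/funext => x; rewrite mxE.
by apply: continuous_sumr => k _; apply: continuousMr.
Qed.

End continuous_matrices.

Section moving_simplex.
Context {R : realType} {m : nat} {X : topologicalType}.
Notation V := 'rV[R]_m.+1.
Variable u : X -> 'I_m.+1 -> V.
Hypothesis cu : forall i k, continuous (fun x => u x i 0 k).

Lemma continuous_edge_mx i k : continuous (fun x => edge_mx (u x) i k).
Proof.
have -> : (fun x => edge_mx (u x) i k) = (fun x => u x (lift ord0 i) 0 k - u x ord0 0 k).
  by apply/funext => x; rewrite !mxE.
by move=> x; apply: cvgB; exact: cu.
Qed.

Lemma continuous_gram i k : continuous (fun x => edge_gram (u x) i k).
Proof.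
apply: continuous_mulmx_entry => [|a b]; first exact: continuous_edge_mx.
have -> : (fun x => (edge_mx (u x))^T a b) = (fun x => edge_mx (u x) b a).
  by apply/funext => x; rewrite mxE.
exact: continuous_edge_mx.
Qed.

Lemma continuous_bary_grad i k : (forall x, Defs.nondegenerate (u x)) ->
  continuous (fun x => bary_grad (u x) i 0 k).
Proof.
move=> ndu.
have cg j : continuous (fun x => (invmx (edge_gram (u x)) *m edge_mx (u x)) j k).
  apply: continuous_mulmx_entry => a b; last exact: continuous_edge_mx.
  apply: continuous_invmx => [x|]; first exact: edge_gram_unit.
  exact: continuous_gram.
rewrite /bary_grad; case: (unlift ord0 i) => [j|]/=.
  by under eq_fun do rewrite mxE; exact: cg.
have -> : (fun x => (- \sum_j row j (invmx (edge_gram (u x)) *m edge_mx (u x))) 0 k) =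
    (fun x => - \sum_j (invmx (edge_gram (u x)) *m edge_mx (u x)) j k).
  by apply/funext => x; rewrite mxE summxE; congr (- _); apply: eq_bigr => j _; rewrite mxE.
by move=> x; apply: cvgN; apply: continuous_sumr.
Qed.

Lemma continuous_jac : continuous (fun x => simplex_jac (u x)).
Proof.
move=> x; apply: (@continuous_comp _ _ _ (fun x => \det (edge_gram (u x))) Num.sqrt).
  exact: continuous_det continuous_gram x.
exact: sqrt_continuous.
Qed.

End moving_simplex.

Lemma det_gram_gt0 (R : realType) (m : nat) (v : 'I_m.+1 -> 'rV[R]_m.+1) :
  Defs.nondegenerate v -> 0 < \det (edge_gram v).
Proof.
(* (1 - s) I + s G is invertible for s in [0, 1], so its determinant keeps the sign
   it has at s = 0. *)
move=> ndv; pose A (s : R) : 'M[R]_m := (1 - s)%:M + s *: edge_gram v.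
have uA s : 0 <= s <= 1 -> \det (A s) != 0.
  move=> /andP[s0 s1]; rewrite -unitfE -unitmxE -row_free_unit; apply: inj_row_free => w wA0.
  have wE : 0 = (1 - s) * dotv w w + s * dotv (w *m edge_mx v) (w *m edge_mx v).
    rewrite !dotv_mx trmx_mul mulmxA -(mulmxA w) -/(edge_gram v).
    have -> : 0 = (w *m A s *m w^T) 0 0 by rewrite wA0 mul0mx mxE.
    rewrite mulmxDr mulmxDl mxE mul_mx_scalar -!scalemxAl -scalemxAr.
    by rewrite -scalemxAl !mxE.
  have := dotv_ge0 w; have := dotv_ge0 (w *m edge_mx v).
  move: s0; rewrite le_eqVlt => /predU1P[s0 _ _|s0 wE0 w0].
    by apply: dotv_eq0; move: wE; rewrite -s0 subr0 mul1r mul0r addr0.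
  have /dotv_eq0 wE00 : dotv (w *m edge_mx v) (w *m edge_mx v) = 0.
    apply/eqP; rewrite eq_le wE0 andbT leNgt; apply/negP => wE1.
    suff : 0 < (1 - s) * dotv w w + s * dotv (w *m edge_mx v) (w *m edge_mx v).
      by rewrite -wE ltxx.
    by rewrite ltr_wpDl ?mulr_gt0// mulr_ge0// subr_ge0.
  have := edge_gram_unit ndv; rewrite -row_free_unit => /row_free_inj/(_ w 0).
  by apply; rewrite mul0mx /edge_gram mulmxA wE00 mul0mx.
have cA : continuous (fun s => \det (A s)).
  apply: continuous_det => i j.
  have -> : (fun s => A s i j) = (fun s => (1 - s) * (i == j)%:R + s * edge_gram v i j).
    by apply/funext => s; rewrite !mxE mulr_natr.
  move=> s; apply: cvgD; apply: cvgM; try exact: cvg_cst; last exact: cvg_id.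
  by apply: cvgB; [exact: cvg_cst|exact: cvg_id].
have A0 : \det (A 0) = 1 by rewrite /A subr0 scale0r addr0 det_scalar expr1n.
have A1 : \det (A 1) = \det (edge_gram v).
  by rewrite /A subrr scale1r (_ : 0%:M = 0) ?add0r//; apply/matrixP => i j; rewrite !mxE mul0rn.
rewrite -A1 lt_neqAle eq_sym uA ?ler01 ?lexx//= leNgt; apply/negP => A1lt.
have [//||c] := @IVT R (fun s => \det (A s)) 0 1 0 ler01.
- exact: continuous_subspaceT.
- by rewrite A0 ge_min le_max ler01 (ltW A1lt) orbT.
- by rewrite in_itv/= => /uA /eqP.
Qed.

(** * Derivatives relative to a set *)

Section derive_within_lemmas.
Context {R : realType} {W : normedModType R}.
Implicit Types (A : set R) (f : R -> W) (t : R).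

Lemma derivable_within_continuous A f t : derivable_within A f t ->
  f @ within A (nbhs t) --> f t.
Proof.
move=> df.
have ct : f @ within A t^' --> f t.
  have : (f t + (s - t) *: ((s - t)^-1 *: (f s - f t))) @[s --> within A t^'] -->
      f t + 0 *: derive_within A f t.
    apply: cvgD; first exact: cvg_cst.
    apply: cvgZ; last exact: df.
    rewrite -[X in _ --> X](subrr t); apply: cvgB; last exact: cvg_cst.
    by apply: cvg_within_filter; apply: cvg_within_filter; exact: cvg_id.
  rewrite scale0r addr0; apply: cvg_trans; apply: near_eq_cvg.
  rewrite near_withinE near_withinE; near=> s => st _.
  by rewrite scalerA mulfV ?subr_eq0// scale1r addrC subrK.
move=> P Pft.
have Pn : \forall s \near t, s != t -> A s -> P (f s) by exact: (ct _ Pft).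
change (\forall s \near t, A s -> P (f s)); near=> s => As.
have [->|st] := eqVneq s t; first exact: nbhs_singleton.
by move: st As; near: s.
Unshelve. all: by end_near. Qed.

Lemma is_derive_within A f t : nbhs t A -> derivable_within A f t ->
  is_derive t 1 f (derive_within A f t).
Proof.
move=> At df.
have L : h^-1 *: (f (h *: 1 + t) - f t) @[h --> 0^'] --> derive_within A f t.
  have sh : (h *: 1 + t) @[h --> (0 : R)^'] --> within A t^'.
    move=> P Pt.
    have {}Pt : \forall s \near t, s != t -> A s -> P s by exact: Pt.
    have ct : (h *: 1 + t) @[h --> (0 : R)] --> t.
      have : (h *: 1 + t) @[h --> (0 : R)] --> (0 : R) *: (1 : R) + t.
        by apply: cvgD; [apply: cvgZr_tmp; exact: cvg_id|exact: cvg_cst].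
      by rewrite scale0r add0r.
    have P0 := ct _ Pt; have A0 := ct _ At.
    change (\forall h \near (0 : R), h != 0 -> P (h *: 1 + t)).
    near=> h => h0; have : h *: 1 + t != t by rewrite -subr_eq0 addrK scaler_eq0 oner_eq0 orbF.
    have : A (h *: 1 + t) by near: h.
    by move=> /[swap]; near: h.
  have := cvg_comp _ _ sh df; apply: cvg_trans; apply: near_eq_cvg.
  by near=> h; rewrite /= addrK /GRing.scale/= mulr1.
apply: DeriveDef; first by apply/cvg_ex; exists (derive_within A f t).
exact: cvg_lim L.
Unshelve. all: by end_near. Qed.

End derive_within_lemmas.

(** * Functions of time and almost every time *)

Section time_functions.
Context {R : realType}.

Lemma is_derive_coord n (f : R -> 'rV[R]_n) (t : R) (df : 'rV[R]_n) i :
  is_derive t 1 f df -> is_derive t 1 (fun s => f s 0 i) (df 0 i).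
Proof.
move=> [/cvg_ex[/= l0 fl] <-]; pose l : 'rV[R]_n := l0; rewrite -/l in fl.
have L : h^-1 *: (f (h *: 1 + t) 0 i - f t 0 i) @[h --> 0^'] --> l 0 i.
  have cl : (fun h => (h^-1 *: (f (h *: 1 + t) - f t)) 0 i) @ (0 : R)^' --> l 0 i.
    exact: cvg_row_coord.
  apply: cvg_trans cl; apply: near_eq_cvg.
  by near=> h; rewrite /= !mxE.
apply: DeriveDef; first by apply/cvg_ex; exists (l 0 i).
rewrite [LHS](cvg_lim _ L)//; congr (fun_of_matrix _ _ _).
by apply/esym; exact: cvg_lim fl.
Unshelve. all: by end_near. Qed.

Variable T : R.
Hypothesis T0 : 0 < T.

(* Turns functions that are continuous on [0, T] into continuous functions on R. *)
Definition clamp (t : R) : R := Num.max 0 (Num.min t T).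

Lemma clamp_bound t : 0 <= clamp t <= T.
Proof. by rewrite le_max lexx/= ge_max ge_min lexx orbT ltW. Qed.

Lemma clampE t : 0 <= t <= T -> clamp t = t.
Proof. by move=> /andP[t0 tT]; rewrite /clamp (min_idPl tT) (max_idPr t0). Qed.

Lemma clamp_continuous : continuous clamp.
Proof.
move=> t; apply: (@continuous_max _ _ (cst 0) (fun t => Num.min t T)).
  exact: cvg_cst.
by apply: (@continuous_min _ _ id (cst T)); [exact: cvg_id|exact: cvg_cst].
Qed.

Lemma continuous_clamp (U : topologicalType) (f : R -> U) :
  (forall t, 0 <= t <= T -> f @ within `[0, T] (nbhs t) --> f t) ->
  continuous (fun t => f (clamp t)).
Proof.
move=> cf t P Pft.
have h : \forall s \near clamp t, s \in `[0, T] -> P (f s).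
  by have := cf _ (clamp_bound t) _ Pft.
have cl : \forall s \near t, clamp s \in `[0, T] -> P (f (clamp s)).
  exact: (clamp_continuous h).
change (\forall s \near t, P (f (clamp s))); near=> s.
have : clamp s \in `[0, T] by rewrite in_itv/= clamp_bound.
by near: s.
Unshelve. all: by end_near. Qed.

Lemma near_itv t : 0 < t < T -> \forall s \near t, 0 < s < T.
Proof.
move=> t0T; have : t \in `]0, T[ by rewrite in_itv.
by move=> /near_in_itvoo; apply: filterS => s; rewrite in_itv.
Qed.

Lemma nbhs_itvcc t : 0 < t < T -> nbhs t `[0, T]%classic.
Proof.
move=> /near_itv; apply: filterS => s /andP[s0 sT].
by rewrite /= in_itv/= !ltW.
Qed.

Lemma clamp_near t : 0 < t < T -> \forall s \near t, clamp s = s.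
Proof.
by move=> /near_itv; apply: filterS => s /andP[s0 sT]; rewrite clampE// !ltW.
Qed.

Lemma continuous_unclamp (U : topologicalType) (f : R -> U) t : 0 < t < T ->
  continuous (fun s => f (clamp s)) -> {for t, continuous f}.
Proof.
move=> tT /(_ t); rewrite /continuous_at clampE; last first.
  by move: tT => /andP[t0 tT']; rewrite !ltW.
apply: cvg_trans; apply: near_eq_cvg; near=> s.
by have -> : clamp s = s by near: s; exact: clamp_near.
Unshelve. all: by end_near. Qed.

Lemma ae_timeS (Q Q' : R -> Prop) :
  (forall t, 0 < t < T -> Q t -> Q' t) -> ae_time T Q -> ae_time T Q'.
Proof.
move=> QQ' aeQ; rewrite /ae_time.
apply: (@filterS _ (almost_everywhere (@lebesgue_measure R)) _ _ _ _ aeQ) => t /= Qt tT.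
by apply: QQ' => //; exact: Qt.
Qed.

Lemma ae_timeI (Q Q' : R -> Prop) :
  ae_time T Q -> ae_time T Q' -> ae_time T (fun t => Q t /\ Q' t).
Proof.
move=> aeQ aeQ'; rewrite /ae_time.
apply: (@filterS2 _ (almost_everywhere (@lebesgue_measure R)) _ _ _ _ _ aeQ aeQ').
move=> t /= Qt Qt' tT.
by split; [exact: Qt|exact: Qt'].
Qed.

(** A null set contains no interval, so a property valid almost everywhere is met in every
    neighbourhood. *)
Lemma ae_time_dense (Q : R -> Prop) t (P : set R) : ae_time T Q -> 0 < t < T ->
  nbhs t P -> exists s, [/\ P s, 0 < s < T & Q s].
Proof.
move=> [N [mN N0 QN]] tT nP; apply: contrapT => nex.
have : nbhs t N.
  change (\forall s \near t, N s); near=> s.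
  have sT : 0 < s < T by near: s; exact: near_itv.
  by apply: QN => /= Qs; apply: nex; exists s; split; [near: s| |exact: Qs].
move=> /nbhs_ballP[e /= e0 eN].
have itvN : `]t - e, t + e[ `<=` N by rewrite -ball_itv.
have : (@lebesgue_measure R `](t - e)%R, (t + e)%R[%classic <= @lebesgue_measure R N)%E.
  by apply: le_measure; rewrite ?inE.
rewrite N0 lebesgue_measure_itv/= lte_fin.
have te : t - e < t + e by rewrite ltrBlDr -addrA ltrDl addr_gt0.
rewrite te -EFinB lee_fin leNgt => /negP; apply.
by rewrite subr_gt0.
Unshelve. all: by end_near. Qed.

Lemma ae_time_eq (f g : R -> R) t : ae_time T (fun s => f s = g s) -> 0 < t < T ->
  {for t, continuous f} -> {for t, continuous g} -> f t = g t.
Proof.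
move=> fg tT cf cg; apply/eqP; rewrite -subr_eq0; apply/negPn/negP => fgt.
have cfg : {for t, continuous (fun s => f s - g s)} by exact: cvgB.
have nz : \forall s \near t, f s - g s != 0 by exact: (cvgr_neq0 _ cfg).
have [s [/= + _ fgs]] := ae_time_dense fg tT nz.
by rewrite fgs subrr eqxx.
Qed.

(** The derivative is kept continuous so that an equation for it can be passed from almost every
    time to every time by [ae_time_eq]. *)
Definition C1oo (f : R -> R) : Prop := exists f' : R -> R, forall t, 0 < t < T ->
  is_derive t 1 f (f' t) /\ {for t, continuous f'}.

Lemma C1oo_cst c : C1oo (fun=> c).
Proof. by exists (fun=> 0) => t _; split; [exact: is_derive1_cst|exact: cvg_cst]. Qed.

Lemma C1ooD f g : C1oo f -> C1oo g -> C1oo (fun t => f t + g t).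
Proof.
move=> [f' ff'] [g' gg']; exists (fun t => f' t + g' t) => t tT.
have [df cf] := ff' _ tT; have [dg cg] := gg' _ tT.
by split; [exact: is_derive1D|exact: cvgD].
Qed.

Lemma C1ooB f g : C1oo f -> C1oo g -> C1oo (fun t => f t - g t).
Proof.
move=> [f' ff'] [g' gg']; exists (fun t => f' t - g' t) => t tT.
have [df cf] := ff' _ tT; have [dg cg] := gg' _ tT.
by split; [exact: is_derive1B|exact: cvgB].
Qed.

Lemma C1ooM f g : C1oo f -> C1oo g -> C1oo (fun t => f t * g t).
Proof.
move=> [f' ff'] [g' gg']; exists (fun t => f' t * g t + f t * g' t) => t tT.
have [df cf] := ff' _ tT; have [dg cg] := gg' _ tT.
split; first exact: is_derive1M.
apply: cvgD; apply: cvgM => //; exact: is_derive1_continuous; eassumption.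
Qed.

Lemma C1oo_sum (I : Type) (r : seq I) (P : pred I) (F : I -> R -> R) :
  (forall i, P i -> C1oo (F i)) -> C1oo (fun t => \sum_(i <- r | P i) F i t).
Proof.
move=> cF; elim: r => [|i r IHr].
  have -> : (fun t => \sum_(i <- [::] | P i) F i t) = (fun=> 0).
    by apply/funext => t; rewrite big_nil.
  exact: C1oo_cst.
have [Pi|Pi] := boolP (P i).
  have -> : (fun t => \sum_(k <- i :: r | P k) F k t) =
      (fun t => F i t + \sum_(k <- r | P k) F k t).
    by apply/funext => t; rewrite big_cons Pi.
  by apply: C1ooD => //; exact: cF.
have -> : (fun t => \sum_(k <- i :: r | P k) F k t) =
    (fun t => \sum_(k <- r | P k) F k t) => //.
by apply/funext => t; rewrite big_cons (negbTE Pi).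
Qed.

Lemma C1oo_prod (I : Type) (r : seq I) (P : pred I) (F : I -> R -> R) :
  (forall i, P i -> C1oo (F i)) -> C1oo (fun t => \prod_(i <- r | P i) F i t).
Proof.
move=> cF; elim: r => [|i r IHr].
  have -> : (fun t => \prod_(i <- [::] | P i) F i t) = (fun=> 1).
    by apply/funext => t; rewrite big_nil.
  exact: C1oo_cst.
have [Pi|Pi] := boolP (P i).
  have -> : (fun t => \prod_(k <- i :: r | P k) F k t) =
      (fun t => F i t * \prod_(k <- r | P k) F k t).
    by apply/funext => t; rewrite big_cons Pi.
  by apply: C1ooM => //; exact: cF.
have -> : (fun t => \prod_(k <- i :: r | P k) F k t) =
    (fun t => \prod_(k <- r | P k) F k t) => //.
by apply/funext => t; rewrite big_cons (negbTE Pi).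
Qed.

Lemma C1oo_sqrt f : (forall t, 0 < t < T -> 0 < f t) -> C1oo f ->
  C1oo (fun t => Num.sqrt (f t)).
Proof.
move=> f0 [f' ff']; exists (fun t => (2 * Num.sqrt (f t))^-1 * f' t) => t tT.
have [df cf'] := ff' _ tT; have ft0 := f0 _ tT.
have cf := is_derive1_continuous df.
split; first by apply: is_derive1_comp; exact: is_derive1_sqrt.
apply: cvgM => //; apply: cvgV.
  by rewrite mulf_neq0// sqrtr_eq0 -ltNge.
apply: cvgM; first exact: cvg_cst.
by apply: (@continuous_comp _ _ _ f Num.sqrt) => //; exact: sqrt_continuous.
Qed.

Lemma C1oo_det n (A : R -> 'M[R]_n) :
  (forall i j, C1oo (fun t => A t i j)) -> C1oo (fun t => \det (A t)).
Proof.
move=> cA; apply: C1oo_sum => s _; apply: C1ooM; first exact: C1oo_cst.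
by apply: C1oo_prod.
Qed.

Lemma C1oo_jac m (u : R -> 'I_m.+1 -> 'rV[R]_m.+1) :
  (forall t, 0 < t < T -> Defs.nondegenerate (u t)) ->
  (forall i k, C1oo (fun t => u t i 0 k)) -> C1oo (fun t => simplex_jac (u t)).
Proof.
move=> ndu cu; apply: C1oo_sqrt => [t /ndu|]; first exact: det_gram_gt0.
apply: C1oo_det => i j.
have -> : (fun t => (edge_mx (u t) *m (edge_mx (u t))^T) i j) =
    (fun t => \sum_k (u t (lift ord0 i) 0 k - u t ord0 0 k) *
                    (u t (lift ord0 j) 0 k - u t ord0 0 k)).
  by apply/funext => t; rewrite mxE; apply: eq_bigr => k _; rewrite !mxE.
by apply: C1oo_sum => k _; apply: C1ooM; apply: C1ooB.
Qed.

Lemma C1oo_within n (f : R -> 'rV[R]_n) i :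
  C1_on `[0, T] f -> C1oo (fun t => f t 0 i).
Proof.
move=> [df cf]; exists (fun t => derive_within `[0, T] f t 0 i) => t tT.
have ntT := nbhs_itvcc tT; split.
  apply: is_derive_coord; apply: is_derive_within => //; apply: df.
  exact: nbhs_singleton.
apply: (@cvg_row_coord R _ (nbhs t)).
move/subspace_continuousP: cf => /(_ t (nbhs_singleton ntT)).
move=> cf P /cf Pt.
have {}Pt : \forall s \near t, s \in `[0, T] -> P (derive_within `[0, T] f s).
  by exact: Pt.
by near=> s; near: s; apply: filterS2 Pt ntT => s Ps /Ps.
Unshelve. all: by end_near. Qed.

End time_functions.

(** Makes [derive_within] on the interval unique, at its ends too: the point is approached from the
    right if [t < T] and from the left if [t = T]. *)
Lemma within_itv_dnbhs_proper (R : realType) (T t : R) : 0 < T -> 0 <= t <= T ->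
  ProperFilter (within `[0, T] t^').
Proof.
move=> T0 /andP[t0 tT]; apply: Build_ProperFilter_ex => P Pt.
have {}Pt : \forall s \near t, s != t -> s \in `[0, T] -> P s by exact: Pt.
have [tT'|Tt] := ltP t T.
  have : \forall s \near t^'+, [/\ t < s, s < T & P s].
    near=> s; have ts : t < s by near: s; exact: nbhs_right_gt.
    have sT : s < T by near: s; exact: nbhs_right_lt.
    split => //; have : s \in `[0, T] by rewrite in_itv/= !ltW// (le_lt_trans t0).
    have : s != t by rewrite gt_eqF.
    by near: s; exact: cvg_within.
  by move=> /filter_ex[s [_ _ Ps]]; exists s.
have tE : t = T by apply/eqP; rewrite eq_le tT.
have : \forall s \near t^'-, [/\ s < t, 0 < s & P s].
  near=> s; have ts : s < t by near: s; exact: nbhs_left_lt.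
  have s0 : 0 < s by near: s; apply: nbhs_left_gt; rewrite tE.
  split => //; have : s \in `[0, T] by rewrite in_itv/= !ltW// (lt_le_trans ts).
  have : s != t by rewrite lt_eqF.
  by near: s; exact: cvg_within.
by move=> /filter_ex[s [_ _ Ps]]; exists s.
Unshelve. all: by end_near. Qed.

Lemma derive_within_cst (R : realType) (W : normedModType R) (T t : R) (f : R -> W) (c : W) :
  0 < T -> 0 <= t <= T -> (forall s, 0 <= s <= T -> f s = c) ->
  derivable_within `[0, T] f t /\ derive_within `[0, T] f t = 0.
Proof.
move=> T0 tT fc; have PF := within_itv_dnbhs_proper T0 tT.
have L : (fun s => (s - t)^-1 *: (f s - f t)) @ within `[0, T] t^' --> (0 : W).
  apply: cvg_near_cst; rewrite near_withinE near_withinE; near=> s => _.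
  rewrite /= in_itv/= => sT; rewrite (fc s)// (fc t)//.
  by rewrite subrr scaler0.
split; first by apply/cvg_ex; exists 0.
exact: cvg_lim L.
Unshelve. all: by end_near. Qed.

(** * Geometry of the moving surface *)

Section moving_surface.
Context {R : realType} {m K J : nat} (tri : 'I_J -> 'I_m.+1 -> 'I_K).
Notation V := 'rV[R]_m.+1.
Variables (T : R) (q : R -> 'I_K -> V).
Hypothesis T0 : 0 < T.
Hypothesis cq : forall k, C1_on `[0, T] (fun t => q t k).
Hypothesis qP : forall t, 0 <= t <= T -> polyhedral_surface tri (q t).
Hypothesis tri_surj : forall k, exists j, k \in vset tri j.

Let qc t := q (clamp T t).

Lemma ndqc t j : Defs.nondegenerate (sv tri (qc t) j).
Proof. by apply: surface_nondegenerate; apply: qP; exact: clamp_bound. Qed.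

Lemma qc_continuous k : continuous (fun t => qc t k).
Proof.
apply: (@continuous_clamp R T T0 _ (fun t => q t k)) => t tT.
by apply: derivable_within_continuous; apply: (cq k).1; rewrite /= in_itv.
Qed.

Lemma qc_entry_continuous k i : continuous (fun t => qc t k 0 i).
Proof. by move=> t; apply: cvg_row_coord; exact: qc_continuous. Qed.

Lemma grad_entry_continuous j i k : continuous (fun t => bary_grad (sv tri (qc t) j) i 0 k).
Proof.
apply: continuous_bary_grad => [a b|t]; last exact: ndqc.
exact: qc_entry_continuous.
Qed.

Lemma grad_continuous j i : continuous (fun t => bary_grad (sv tri (qc t) j) i).
Proof. by move=> t; apply: cvg_rowP => k; exact: grad_entry_continuous. Qed.

Definition surf_area t j := simplex_area (sv tri (q t) j).

Lemma area_gt0 t j : 0 <= t <= T -> 0 < surf_area t j.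
Proof.
move=> tT; rewrite /surf_area simplex_areaE divr_gt0 ?ltr0n ?fact_gt0//.
by rewrite sqrtr_gt0; apply: det_gram_gt0; apply: surface_nondegenerate; exact: qP.
Qed.

Lemma area_continuous j : continuous (fun t => surf_area (clamp T t) j).
Proof.
under eq_fun do rewrite /surf_area simplex_areaE.
apply: continuousMr; last exact: cst_continuous.
apply: (@continuous_jac _ _ _ (fun t => sv tri (qc t) j)) => i k.
exact: qc_entry_continuous.
Qed.

Lemma area_C1oo j : C1oo T (surf_area^~ j).
Proof.
rewrite /surf_area; under eq_fun do rewrite simplex_areaE.
apply: C1ooM; last exact: C1oo_cst.
apply: (C1oo_jac (u := fun t => sv tri (q t) j)) => [t /andP[t0 tT]|i k].
  by apply: surface_nondegenerate; apply: qP; rewrite !ltW.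
exact: (C1oo_within k (cq (tri j i))).
Qed.

(** The space-time simplices, extended to all times through [qc], are closed and finitely many, so
    continuity follows by pasting. The nodal values of a transported hat function are constant in
    time, hence its material derivative is zero. *)
Lemma W_time_chi k : W_time tri T q (fun t => chi tri (q t) k).
Proof.
have nodal_chi l s : 0 <= s <= T -> nodal q (fun t => chi tri (q t) k) l s = (l == k)%:R.
  by move=> sT; rewrite /nodal (chiP (qP sT) tri_surj k).2.
split.
- apply: (@closed_within_patch _ _ 'I_J
    (fun j => [set x : V * R | closed_simplex (sv tri (qc x.2) j) x.1]) _
    (fun j x => \sum_i (tri j i == k)%:R * bary (sv tri (qc x.2) j) i x.1)).
  + move=> j; apply: closed_simplex_preimage => [x|i x|i x|].
    * exact: ndqc.
    * by apply: (@continuous_comp _ _ _ snd (fun t => qc t (tri j i)));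
        [exact: cvg_snd|exact: qc_continuous].
    * by apply: (@continuous_comp _ _ _ snd (fun t => bary_grad (sv tri (qc t) j) i));
        [exact: cvg_snd|exact: grad_continuous].
    * by move=> x; exact: cvg_fst.
  + move=> x [xT [j _ jx]]; exists j => //=.
    by rewrite /qc clampE.
  + move=> j x; rewrite /= => jx [xT _]; rewrite /qc clampE// in jx *.
    exact: (chiE (qP xT) tri_surj k jx).
  + move=> j; apply: continuous_sumr => i _; apply: continuousMr; first exact: cst_continuous.
    move=> x; apply: cvg_bary; last exact: cvg_fst.
      by apply: (@continuous_comp _ _ _ snd (fun t => bary_grad (sv tri (qc t) j) i));
        [exact: cvg_snd|exact: grad_continuous].
    by apply: (@continuous_comp _ _ _ snd (fun t => qc t (tri j ord0)));
        [exact: cvg_snd|exact: qc_continuous].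
- by move=> l t tT; have [] := derive_within_cst T0 tT (nodal_chi l).
- apply: (@closed_within_patch _ _ 'I_1 (fun=> setT) _ (fun _ _ => 0)) => //.
  + by move=> x _; exists ord0.
  + move=> _ x _ [xT _]; apply: big1 => l _.
    by have [_ ->] := derive_within_cst T0 xT (nodal_chi l); rewrite mul0r.
  + by move=> _; exact: cst_continuous.
- by move=> t tT; exact: (chiP (qP tT) tri_surj k).1.
Qed.

Lemma material_deriv_chi k t z : 0 <= t <= T ->
  material_deriv tri T q (fun t => chi tri (q t) k) t z = 0.
Proof.
move=> tT; apply: big1 => l _.
have nodal_chi s : 0 <= s <= T -> nodal q (fun t => chi tri (q t) k) l s = (l == k)%:R.
  by move=> sT; rewrite /nodal (chiP (qP sT) tri_surj k).2.
by have [_ ->] := derive_within_cst T0 tT nodal_chi; rewrite mul0r.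
Qed.

End moving_surface.

(** * The surfactant equation at the vertices *)

Lemma within_continuous_comp (X Y Z : topologicalType) (A : set Y) (c : X -> Y) (f : Y -> Z) :
  (forall x, A (c x)) -> continuous c -> {within A, continuous f} ->
  continuous (fun x => f (c x)).
Proof.
move=> Ac cc /subspace_continuousP cf x P Pfc.
have h : \forall y \near c x, A y -> P (f y) by exact: (cf _ (Ac x) _ Pfc).
have h' : \forall s \near x, A (c s) -> P (f (c s)) by exact: (cc x _ h).
change (\forall s \near x, P (f (c s))); near=> s; move: (Ac s).
by near: s.
Unshelve. all: by end_near. Qed.

Section surfactant.
Context {R : realType} {m K J : nat} (tri : 'I_J -> 'I_m.+1 -> 'I_K).
Notation V := 'rV[R]_m.+1.
Variables (T : R) (q : R -> 'I_K -> V).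
Hypothesis T0 : 0 < T.
Hypothesis cq : forall k, C1_on `[0, T] (fun t => q t k).
Hypothesis qP : forall t, 0 <= t <= T -> polyhedral_surface tri (q t).
Hypothesis tri_surj : forall k, exists j, k \in vset tri j.
Variable Psi : R -> V -> R.
Hypothesis WPsi : W_time tri T q Psi.

Local Notation area := (surf_area tri q).
Local Notation grad t j i := (bary_grad (sv tri (q t) j) i).

Let le_oo t : 0 < t < T -> 0 <= t <= T.
Proof. by move=> /andP[t0 tT]; rewrite !ltW. Qed.

Definition psi k t := Psi t (q t k).

Lemma surf_q t k : surf tri (q t) (q t k).
Proof. by have [j /imsetP[i _ ->]] := tri_surj k; exact: surf_vertex. Qed.

(** [Psi] is continuous only within the space-time surface, so its nodal values are read along a
    trajectory that never leaves it. *)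
Let path k t : V * R := (q (clamp T t) k, clamp T t).

Let path_space_time k t : space_time tri T q (path k t).
Proof. by split; [exact: clamp_bound|exact: surf_q]. Qed.

Let path_continuous k : continuous (path k).
Proof.
move=> t; apply: (@cvg_pair _ _ _ (nbhs t) (nbhs (q (clamp T t) k)) (nbhs (clamp T t))).
  exact: (qc_continuous T0 cq).
exact: clamp_continuous.
Qed.

Lemma psi_continuous k : continuous (fun t => psi k (clamp T t)).
Proof.
have [c _ _ _] := WPsi.
exact: (within_continuous_comp (path_space_time k) (@path_continuous k) c).
Qed.

(** At a vertex the material derivative is the derivative of the nodal value, and it is continuous
    on the space-time surface. *)
Lemma psi_C1oo k : C1oo T (psi k).
Proof.
have [_ d c _] := WPsi.
have mE t : 0 <= t <= T ->
    derive_within `[0, T] (nodal q Psi k) t = material_deriv tri T q Psi t (q t k).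
  move=> tT; rewrite /material_deriv.
  under eq_bigr do rewrite (chiP (qP tT) tri_surj _).2 mulrC eq_sym.
  by rewrite sum_delta.
exists (fun t => derive_within `[0, T] (nodal q Psi k) t) => t tT; split.
  apply: is_derive_within; first exact: nbhs_itvcc.
  exact: (d k t (le_oo tT)).
have cc : continuous (fun s => material_deriv tri T q Psi (clamp T s) (q (clamp T s) k)).
  exact: (within_continuous_comp (path_space_time k) (@path_continuous k) c).
have := cc t; rewrite /continuous_at /= clampE ?le_oo// -mE ?le_oo//.
apply: cvg_trans; apply: near_eq_cvg; near=> s.
have -> : clamp T s = s by near: s; exact: clamp_near.
by rewrite mE// le_oo//; near: s; exact: near_itv.
Unshelve. all: by end_near. Qed.

(** The integral of the hat function of vertex [k]: a share [1 / m.+1] of the area of each simplex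
    around it. *)
Definition mass k t : R :=
  m.+1%:R^-1 * \sum_j area t j * \sum_i (tri j i == k)%:R.

Lemma mass_gt0 k t : 0 <= t <= T -> 0 < mass k t.
Proof.
move=> tT; rewrite mulr_gt0//.
have a0 j : 0 < area t j by exact: (area_gt0 qP).
have [j /imsetP[i _ kE]] := tri_surj k.
have s0 l : 0 <= \sum_i (tri l i == k)%:R :> R by exact: sumr_ge0.
rewrite (bigD1 j)//= ltr_pwDl//; last first.
  by apply: sumr_ge0 => l _; rewrite mulr_ge0// ltW.
rewrite mulr_gt0// (bigD1 i)//= kE eqxx ltr_pwDl//.
exact: sumr_ge0.
Qed.

Lemma mass_C1oo k : C1oo T (mass k).
Proof.
apply: C1ooM; first exact: C1oo_cst.
apply: C1oo_sum => j _; apply: C1ooM; last exact: C1oo_cst.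
exact: (area_C1oo cq qP).
Qed.

Lemma mass_continuous k : continuous (fun t => mass k (clamp T t)).
Proof.
apply: continuousMr; first exact: cst_continuous.
apply: continuous_sumr => j _; apply: continuousMr; last exact: cst_continuous.
exact: (area_continuous T0 cq).
Qed.

Lemma sum_mass (F : 'I_K -> R) t :
  \sum_k mass k t * F k = m.+1%:R^-1 * \sum_j area t j * \sum_i F (tri j i).
Proof.
under eq_bigr do rewrite -mulrA mulr_suml.
rewrite -mulr_sumr exchange_big; congr (_ * _); apply: eq_bigr => j _.
under eq_bigr do rewrite -mulrA mulr_suml.
rewrite -mulr_sumr exchange_big; congr (_ * _); apply: eq_bigr => i _.
by under eq_bigr do rewrite eq_sym; rewrite sum_delta.
Qed.

Lemma lump_chi k t eta : 0 <= t <= T -> Wspace tri (q t) eta ->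
  ip_lumpS tri (q t) eta (chi tri (q t) k) = mass k t * eta (q t k).
Proof.
move=> tT We; have [Wc cq'] := chiP (qP tT) tri_surj k.
rewrite /ip_lumpS.
rewrite (lumpedE (F := fun j i => eta (q t (tri j i)) * (tri j i == k)%:R)); last first.
  move=> j i; rewrite -cq'; apply: cvgM; exact: vertex_limit_Wspace.
rewrite -(sum_mass (fun l => eta (q t l) * (l == k)%:R)).
by under eq_bigr do rewrite mulrA mulrC; rewrite sum_delta.
Qed.

(** The constant value on simplex [j] of the product of the gradients of two piecewise linear
    functions. *)
Definition stiff t j (a b : 'I_K -> R) : R :=
  \sum_i \sum_l a (tri j i) * b (tri j l) * dotv (grad t j i) (grad t j l).

(** The stiffness matrix applied to the nodal values, component [k]. *)
Definition flux k t : R :=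
  \sum_j area t j * stiff t j (psi ^~ t) (fun l => (l == k)%:R).

Lemma sgrad_dot t j z (eta zeta : V -> R) : 0 <= t <= T ->
  Wspace tri (q t) eta -> Wspace tri (q t) zeta -> open_simplex (sv tri (q t) j) z ->
  dotv (sgrad tri (q t) eta z) (sgrad tri (q t) zeta z) =
  stiff t j (fun k => eta (q t k)) (fun k => zeta (q t k)).
Proof.
move=> tT We Wz oz; rewrite (sgrad_Wspace (qP tT) We oz) (sgrad_Wspace (qP tT) Wz oz).
rewrite dotv_suml; apply: eq_bigr => i _; rewrite dotv_sumr; apply: eq_bigr => l _.
by rewrite dotvZl dotvZr mulrA.
Qed.

Lemma flux_chi k t : 0 <= t <= T ->
  ip_surfV tri (q t) (sgrad tri (q t) (Psi t)) (sgrad tri (q t) (chi tri (q t) k)) =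
  flux k t.
Proof.
move=> tT; have [_ _ _ WP] := WPsi; have [Wc cq'] := chiP (qP tT) tri_surj k.
apply: eq_bigr => j _; apply: simplex_int_cst => z oz.
rewrite (sgrad_dot tT (WP _ tT) Wc oz); congr stiff.
by apply/funext => l; rewrite cq'.
Qed.

Lemma stiff_continuous j (a b : 'I_K -> R -> R) :
  (forall k, continuous (a k)) -> (forall k, continuous (b k)) ->
  continuous (fun t => stiff (clamp T t) j (a ^~ t) (b ^~ t)).
Proof.
move=> ca cb; apply: continuous_sumr => i _; apply: continuous_sumr => l _.
apply: continuousMr; first exact: continuousMr.
move=> t; apply: cvg_dotv; exact: (@grad_continuous _ _ _ _ _ _ _ T0 cq qP).
Qed.

Lemma flux_continuous k t : 0 < t < T -> {for t, continuous (flux k)}.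
Proof.
move=> tT.
apply: (continuous_unclamp tT); apply: continuous_sumr => j _; apply: continuousMr.
  exact: (area_continuous T0 cq).
apply: (@stiff_continuous j (fun l t => psi l (clamp T t)) (fun l _ => (l == k)%:R)) => l.
  exact: psi_continuous.
exact: cst_continuous.
Qed.

Variable D : R.
Hypothesis S5 : forall zeta, W_time tri T q zeta ->
  ae_time T (fun t =>
    let mass s := ip_lumpS tri (q s) (Psi s) (zeta s) in
    derivable (mass : R -> R^o) t 1 /\
    derive1 mass t
    + D * ip_surfV tri (q t) (sgrad tri (q t) (Psi t)) (sgrad tri (q t) (zeta t))
    = ip_lumpS tri (q t) (Psi t) (material_deriv tri T q zeta t)).

Lemma nodal_equation k t : 0 < t < T ->
  is_derive t 1 (fun s => mass k s * psi k s) (- D * flux k t).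
Proof.
move=> tT; have [y' y'P] := C1ooM (mass_C1oo k) (psi_C1oo k).
have [_ _ _ WP] := WPsi.
suff <- : y' t = - D * flux k t by have [] := y'P t tT.
apply: (@ae_time_eq _ T y' (fun t => - D * flux k t)) => //; last 2 first.
- by have [] := y'P t tT.
- apply: cvgM; [exact: cvg_cst|exact: flux_continuous].
apply: ae_timeS (S5 (W_time_chi T0 cq qP tri_surj k)) => s sT [_ S5E].
have sT' := le_oo sT.
have [dy _] := y'P s sT.
have dm : is_derive s 1 (fun u => ip_lumpS tri (q u) (Psi u) (chi tri (q u) k)) (y' s).
  apply: near_eq_is_derive dy; near=> u.
  have uT : 0 <= u <= T by apply: le_oo; near: u; exact: near_itv.
  by rewrite (lump_chi _ uT (WP _ uT)).
move: S5E; rewrite derive1E; have -> := @derive_val _ _ _ _ _ _ _ dm.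
rewrite flux_chi//.
(* Hat functions are transported with the surface, so the right-hand side of (S5) vanishes for
   them. *)
have -> : ip_lumpS tri (q s) (Psi s)
    (material_deriv tri T q (fun t => chi tri (q t) k) s) = 0.
  rewrite /ip_lumpS (lumpedE (F := fun _ _ => 0)).
    by rewrite big1 ?mulr0// => j _; rewrite big1 ?mulr0.
  move=> j i; apply: cvg_near_cst; near=> z.
  by rewrite (material_deriv_chi T0 qP)// mulr0.
by move=> /eqP; rewrite addr_eq0 mulNr => /eqP.
Unshelve. all: by end_near. Qed.

End surfactant.

(** * Conservation and nonnegativity *)

Lemma simplex_int_bary (R : realType) (m : nat) (v : 'I_m.+1 -> 'rV[R]_m.+1)
    (f : 'rV[R]_m.+1 -> R) (c : 'I_m.+1 -> R) : Defs.nondegenerate v ->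
  (forall z, open_simplex v z -> f z = \sum_i c i * bary v i z) ->
  simplex_int v f = simplex_area v * (m.+1%:R^-1 * \sum_i c i).
Proof.
move=> ndv fE; pose a := \sum_i c i *: bary_grad v i; pose b := \sum_i c i * bary v i 0.
have ab z : \sum_i c i * bary v i z = dotv a z + b.
  rewrite dotv_suml -big_split/=; apply: eq_bigr => i _.
  rewrite dotvZl -mulrDr; congr (_ * _).
  by apply/eqP; rewrite -subr_eq baryB subr0.
rewrite (simplex_int_affine (a := a) (b := b)); last by move=> z /fE ->.
congr (_ * (_ * _)); apply: eq_bigr => k _; rewrite -ab.
under eq_bigr do rewrite bary_vertex// mulrC eq_sym.
by rewrite sum_delta.
Qed.

(** Only earlier times are compared, so that the statement also applies to a minimum attained at the
    right end of a compact interval. *)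
Lemma is_derive_min_left (R : realType) (f : R -> R) (t d e : R) : 0 < e ->
  is_derive t 1 f d -> (forall s, t - e < s -> s < t -> f t <= f s) -> d <= 0.
Proof.
move=> e0 [df <-] fmin; rewrite leNgt; apply/negP => d0.
have /nbhs_ballP[r /= r0 pos] : \forall h \near (0 : R), h != 0 ->
    0 < h^-1 *: (f (h *: 1 + t) - f t) by exact: (cvgr_gt _ df).
pose k := Num.min e r / 2.
have k0 : 0 < k by rewrite divr_gt0// lt_min e0.
have [ke kr] : k < e /\ k < r.
  by split; rewrite /k ltr_pdivrMr// gt_min; apply/orP; [left|right]; lra.
have := pos (- k).
rewrite -ball_normE /ball_/= sub0r opprK gtr0_norm// oppr_eq0 gt_eqF//.
move=> /(_ kr isT); rewrite /GRing.scale/= mulr1 invrN mulNr oppr_gt0.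
rewrite pmulr_rlt0 ?invr_gt0// subr_lt0 ltNge fmin//; lra.
Qed.

Section min_principle.
Context {R : realType}.

(** A finite family stands in for its pointwise minimum, which need not be differentiable; the sign
    of a derivative is asked only of members that attain the minimum. *)
Lemma family_min_principle (I : finType) (g dg : I -> R -> R) (T : R) : 0 < T ->
  (forall i, continuous (fun t => g i (clamp T t))) ->
  (forall i t, 0 < t < T -> is_derive t 1 (g i) (dg i t)) ->
  (forall i, 0 <= g i 0) ->
  (forall t, 0 < t < T -> forall i, (forall k, g i t <= g k t) -> 0 <= dg i t) ->
  forall t, 0 <= t <= T -> forall i, 0 <= g i t.
Proof.
move=> T0 cg dgP g0 dg0.
have le_oo t : 0 < t < T -> 0 <= t <= T by move=> /andP[t0 tT]; rewrite !ltW.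
have pos e t1 : 0 < e -> 0 < t1 < T -> forall i, 0 <= g i t1 + e * t1.
  (* minimize g_i(t) + e t over i and t in [0, t1]: an interior minimizer is excluded
     because its derivative would be at least e *)
  move=> e0 t1T i0; have t10 : 0 <= t1 by case/andP: t1T => /ltW.
  pose h i t := g i (clamp T t) + e * t.
  have ch i : {within `[0, t1], continuous (h i)}.
    apply: continuous_subspaceT => t; apply: cvgD; first exact: cg.
    by apply: cvgM; [exact: cvg_cst|exact: cvg_id].
  have /choice[c cP] i : exists c, c \in `[0, t1] /\ forall t, t \in `[0, t1] -> h i c <= h i t.
    by have [c ? ?] := EVT_min t10 (ch i); exists c.
  pose i1 := [arg min_(i < i0) h i (c i)]%O.
  have hmin i t : t \in `[0, t1] -> h i1 (c i1) <= h i t.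
    move=> tt1; apply: le_trans ((cP i).2 t tt1).
    by rewrite /i1; case: arg_minP => // j _; apply.
  have [c01 _] := cP i1; move: c01; rewrite in_itv/= => /andP[c0 c1].
  have cT : c i1 < T by case/andP: t1T => _; exact: le_lt_trans.
  have -> : g i0 t1 + e * t1 = h i0 t1 by rewrite /h clampE// le_oo.
  apply: le_trans (hmin i0 t1 _); last by rewrite in_itv/= t10 lexx.
  move: c0; rewrite le_eqVlt => /predU1P[c0|c0].
    by rewrite /h -c0 clampE ?lexx ?(ltW T0)// mulr0 addr0.
  have ciT : 0 < c i1 < T by rewrite c0.
  have hE i : h i (c i1) = g i (c i1) + e * c i1 by rewrite /h clampE// le_oo.
  have : is_derive (c i1) 1 (fun t => g i1 t + e * t) (dg i1 (c i1) + e).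
    have dd := is_derive1D (dgP i1 _ ciT) (is_derive1Zl e (is_derive_id (c i1) 1)).
    apply: (is_derive_eq dd).
    by rewrite mulr1.
  have cle i t : 0 < t -> t <= c i1 -> g i1 (c i1) + e * c i1 <= g i t + e * t.
    move=> t0 tc; have := hmin i t; rewrite in_itv/= (ltW t0) (le_trans tc c1) => /(_ isT).
    by rewrite hE /h clampE// (ltW t0)/= (le_trans tc)// ltW.
  move=> /(@is_derive_min_left _ _ _ _ (c i1) c0); rewrite subrr.
  move=> /(_ (fun s s0 sc => cle i1 s s0 (ltW sc))).
  rewrite leNgt ltr_wpDl//; apply: dg0 => // i.
  by have := cle i _ c0 (lexx _); rewrite lerD2r.
have oo t i : 0 < t < T -> 0 <= g i t.
  move=> tT; rewrite leNgt; apply/negP => gt0; have t0 : 0 < t by case/andP: tT.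
  (* With this [e] the perturbed value [g i t + e t] is half of [g i t], hence negative. *)
  have e0 : 0 < - g i t / (2 * t) by rewrite divr_gt0 ?oppr_gt0// mulr_gt0.
  have := pos _ _ e0 tT i; rewrite invfM mulrA -[X in _ + X]mulrA mulVf ?gt_eqF// mulr1.
  lra.
move=> t /andP[t0 tT] i; move: t0; rewrite le_eqVlt => /predU1P[<-//|t0].
move: tT; rewrite le_eqVlt => /predU1P[->|tT]; last by apply: oo; rewrite t0.
rewrite leNgt; apply/negP => gT.
(* The end time [T] carries no derivative and is reached by continuity from earlier times. *)
have /nbhs_ballP[r /= r0 rP] : \forall s \near T, g i (clamp T s) < 0.
  by apply: (cvgr_lt _ (cg i T)); rewrite clampE// lexx ltW.
pose k := Num.min T r / 2.
have k0 : 0 < k by rewrite divr_gt0// lt_min T0.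
have [kT kr] : k < T /\ k < r.
  by split; rewrite /k ltr_pdivrMr// gt_min; apply/orP; [left|right]; lra.
have := rP (T - k); rewrite -ball_normE /ball_/= opprB addrC subrK gtr0_norm// => /(_ kr).
have TkT : 0 < T - k < T by rewrite subr_gt0 kT gtrDl oppr_lt0.
by rewrite clampE ?le_oo// ltNge oo.
Qed.
End min_principle.

Section conservation.
Context {R : realType} {m K J : nat} (tri : 'I_J -> 'I_m.+1 -> 'I_K).
Notation V := 'rV[R]_m.+1.
Variables (T : R) (q : R -> 'I_K -> V).
Hypothesis T0 : 0 < T.
Hypothesis cq : forall k, C1_on `[0, T] (fun t => q t k).
Hypothesis qP : forall t, 0 <= t <= T -> polyhedral_surface tri (q t).
Hypothesis tri_surj : forall k, exists j, k \in vset tri j.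
Variable Psi : R -> V -> R.
Hypothesis WPsi : W_time tri T q Psi.
Variable D : R.
Hypothesis S5 : forall zeta, W_time tri T q zeta ->
  ae_time T (fun t =>
    let mass s := ip_lumpS tri (q s) (Psi s) (zeta s) in
    derivable (mass : R -> R^o) t 1 /\
    derive1 mass t
    + D * ip_surfV tri (q t) (sgrad tri (q t) (Psi t)) (sgrad tri (q t) (zeta t))
    = ip_lumpS tri (q t) (Psi t) (material_deriv tri T q zeta t)).

Local Notation area := (surf_area tri q).
Local Notation mass := (mass tri q).
Local Notation psi := (psi q Psi).
Local Notation flux := (flux tri q Psi).
Local Notation stiff := (stiff tri q).
Local Notation grad t j i := (bary_grad (sv tri (q t) j) i).

Lemma sum_flux t (S : {set 'I_K}) :
  \sum_(k in S) flux k t =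
  \sum_j area t j * stiff t j (psi ^~ t) (fun l => (l \in S)%:R).
Proof.
rewrite exchange_big; apply: eq_bigr => j _; rewrite -mulr_sumr; congr (_ * _).
rewrite exchange_big; apply: eq_bigr => i _; rewrite exchange_big; apply: eq_bigr => l _.
rewrite -mulr_suml -mulr_sumr; congr (_ * _ * _).
have [lS|lS] := boolP (tri j l \in S); last first.
  by apply: big1 => k kS; case: eqP => // lk; move: lS; rewrite lk kS.
rewrite (bigD1 _ lS)/= eqxx big1 ?addr0// => k /andP[_].
by rewrite eq_sym => /negbTE ->.
Qed.

Lemma stiff_unit t j (a : 'I_K -> R) : stiff t j a (fun=> 1) = 0.
Proof.
apply: big1 => i _; under eq_bigr do rewrite mulr1.
by rewrite -mulr_sumr -dotv_sumr bary_grad_sum dotv0r mulr0.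
Qed.

Lemma surf_int_psi t : 0 <= t <= T ->
  ip_surfS tri (q t) (Psi t) (cst 1) = \sum_k mass k t * psi k t.
Proof.
move=> tT; have [_ _ _ WP] := WPsi.
rewrite sum_mass mulr_sumr; apply: eq_bigr => j _.
rewrite (simplex_int_bary (c := fun i => psi (tri j i) t)).
- by rewrite mulrCA.
- by apply: surface_nondegenerate; exact: qP.
- move=> z oz; rewrite mulr1.
  exact: (Wspace_bary (qP tT) (WP t tT) (open_closed_simplex oz)).
Qed.

Let le_oo t : 0 < t < T -> 0 <= t <= T.
Proof. by move=> /andP[t0 tT]; rewrite !ltW. Qed.

Lemma total_mass_conserved t : 0 < t < T ->
  is_derive t 1 (fun s => ip_surfS tri (q s) (Psi s) (cst 1)) 0.
Proof.
move=> tT.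
have : is_derive t 1 (fun s => \sum_k mass k s * psi k s) (\sum_k - D * flux k t).
  by apply: is_derive1_sum => k _; exact: (nodal_equation T0 cq qP tri_surj WPsi S5).
rewrite -mulr_sumr; have -> : \sum_k flux k t = 0.
  have -> : \sum_k flux k t = \sum_(k in [set: 'I_K]%SET) flux k t.
    by apply: eq_bigl => k; rewrite finset.in_setT.
  rewrite sum_flux big1// => j _.
  rewrite (_ : (fun l => (l \in _)%:R) = (fun=> 1)); first by rewrite stiff_unit mulr0.
  by apply/funext => l; rewrite finset.in_setT.
rewrite mulr0; apply: near_eq_is_derive; near=> s.
by rewrite surf_int_psi// le_oo//; near: s; exact: near_itv.
Unshelve. all: by end_near. Qed.

Hypothesis D0 : 0 <= D.
Hypothesis nonobt : D = 0 \/ forall i k, i != k -> forall t, 0 <= t <= T -> forall j,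
    simplex_int (sv tri (q t) j) (fun z =>
      dotv (sgrad tri (q t) (chi tri (q t) i) z)
           (sgrad tri (q t) (chi tri (q t) k) z)) <= 0.

(** The angle condition concerns integrals, but the integrand is constant on a simplex of positive
    area, so the sign passes to the gradients themselves. *)
Lemma nonobtuse_dot t j i l : D != 0 -> 0 <= t <= T -> i != l ->
  dotv (grad t j i) (grad t j l) <= 0.
Proof.
move=> Dn0 tT il; case: nonobt => [/eqP|no]; first by rewrite (negbTE Dn0).
have tril : tri j i != tri j l by rewrite (inj_eq (@tri_inj _ _ _ _ _ _ (qP tT) j)).
have := no _ _ tril t tT j.
have [Wi ci] := chiP (qP tT) tri_surj (tri j i).
have [Wl cl] := chiP (qP tT) tri_surj (tri j l).
rewrite (simplex_int_cst (c := dotv (grad t j i) (grad t j l))).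
  by rewrite pmulr_rle0//; exact: (area_gt0 qP).
move=> z oz; rewrite (sgrad_dot qP tT Wi Wl oz) /stiff.
have inj := @tri_inj _ _ _ _ _ _ (qP tT) j.
rewrite (bigD1 i)//= [X in _ + X]big1 ?addr0; last first.
  move=> i' ii'; apply: big1 => l' _.
  by rewrite ci (inj_eq inj) (negbTE ii') !mul0r.
rewrite (bigD1 l)//= big1 ?addr0 ?ci ?cl ?eqxx ?mul1r//.
by move=> l' ll'; rewrite cl (inj_eq inj) (negbTE ll') mulr0 mul0r.
Qed.

Lemma psi_ge0 : (forall k, 0 <= psi k 0) ->
  forall t, 0 <= t <= T -> forall k, 0 <= psi k t.
Proof.
move=> psi00.
(* The claim for all sets of vertices contains that for singletons. *)
suff z0 t (S : {set 'I_K}) : 0 <= t <= T -> 0 <= \sum_(k in S) mass k t * psi k t.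
  move=> t tT k; have := z0 t [set k]%SET tT.
  by rewrite big_set1 pmulr_rge0//; exact: (mass_gt0 qP tri_surj).
move=> tT; pose g (S : {set 'I_K}) t := \sum_(k in S) mass k t * psi k t.
pose dg (S : {set 'I_K}) t := \sum_(k in S) - D * flux k t.
apply: (@family_min_principle R _ g dg T T0) (tT) S => {t tT}.
- move=> S; apply: continuous_sumr => k _; apply: continuousMr.
    exact: (mass_continuous T0 cq).
  exact: (psi_continuous T0 cq tri_surj WPsi).
- move=> S t tT; apply: is_derive1_sum => k _.
  exact: (nodal_equation T0 cq qP tri_surj WPsi S5).
- move=> S; apply: sumr_ge0 => k _; rewrite mulr_ge0// ltW//.
  by apply: (mass_gt0 qP tri_surj); rewrite lexx ltW.
move=> t tT S Smin; have tT' := le_oo tT.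
rewrite /dg -mulr_sumr; have [->|Dn0] := eqVneq D 0; first by rewrite oppr0 mul0r.
rewrite mulNr oppr_ge0 pmulr_rle0 ?lt_def ?Dn0// sum_flux.
have m0 k : 0 < mass k t by exact: (mass_gt0 qP tri_surj).
(* Removing a vertex from a minimizing set, or adding one to it, cannot lower the sum. *)
have inS k : k \in S -> psi k t <= 0.
  move=> kS; have := Smin (S :\ k)%SET; rewrite /g (big_setD1 _ kS)/=.
  by rewrite gerDr pmulr_rle0.
have notinS k : k \notin S -> 0 <= psi k t.
  move=> kS; have := Smin (k |: S)%SET; rewrite /g (big_setU1 _ kS)/=.
  by rewrite lerDr pmulr_rge0.
apply: sumr_le0 => j _; rewrite pmulr_rle0; last exact: (area_gt0 qP).
apply: sumr_le0 => i _.
under eq_bigr do rewrite -mulrA; rewrite -mulr_sumr.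
have [iS|iS] := boolP (tri j i \in S).
  apply: mulr_le0_ge0; first exact: inS.
  (* The sum over [S] contains the positive diagonal term. As the gradients add up to zero, it
     equals minus the sum over the complement of [S], where only off-diagonal terms occur. *)
  rewrite (eq_bigr (fun l => dotv (grad t j i) (grad t j l) -
      (tri j l \notin S)%:R * dotv (grad t j i) (grad t j l))); last first.
    by move=> l _; case: (tri j l \in S); rewrite /= ?(mul1r, mul0r, subr0, subrr).
  rewrite sumrB -dotv_sumr bary_grad_sum dotv0r sub0r oppr_ge0.
  apply: sumr_le0 => l _; have [lS|lS] := boolP (tri j l \in S); first by rewrite mul0r.
  rewrite mul1r; apply: nonobtuse_dot => //; apply: contraNneq lS => <-//.
apply: mulr_ge0_le0; first exact: notinS.
apply: sumr_le0 => l _; have [lS|lS] := boolP (tri j l \in S); last by rewrite mul0r.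
by rewrite mul1r; apply: nonobtuse_dot => //; apply: contraNneq iS => ->.
Qed.

Lemma Psi_ge0 : (forall z, surf tri (q 0) z -> 0 <= Psi 0 z) ->
  forall t, 0 <= t <= T -> forall z, surf tri (q t) z -> 0 <= Psi t z.
Proof.
move=> P0 t tT z [j _ jz]; have [_ _ _ WP] := WPsi.
rewrite (Wspace_bary (qP tT) (WP t tT) jz); apply: sumr_ge0 => i _.
have ndj : Defs.nondegenerate (sv tri (q t) j).
  by apply: surface_nondegenerate; exact: qP.
rewrite mulr_ge0//; last by have [b0 _] := (closed_simplexE z ndj).1 jz.
by apply: psi_ge0 => // k; apply: P0; exact: surf_q.
Qed.

End conservation.

(** * Curvature and surface energy in the plane *)

Section capillary_identity.
Context {R : realType} {m K J : nat} (tri : 'I_J -> 'I_m.+1 -> 'I_K).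
Notation V := 'rV[R]_m.+1.
Variables (q : R -> 'I_K -> V) (t : R).
Hypothesis qP : polyhedral_surface tri (q t).
Hypothesis tri_surj : forall k, exists j, k \in vset tri j.

Local Notation area := (surf_area tri q).
Local Notation mass := (mass tri q).
Local Notation grad j i := (bary_grad (sv tri (q t) j) i).
Local Notation vertex_limit := (vertex_limit tri (q t)).
Local Notation nodal_vec := (nodal_vec tri (q t)).

Lemma lumpV_nodal (u w : V -> V) (a b : 'I_K -> V) :
  vertex_limit u a -> vertex_limit w b ->
  ip_lumpV tri (q t) u w = \sum_k mass k t * dotv (a k) (b k).
Proof.
move=> ua wb; rewrite sum_mass.
apply: (lumpedE (F := fun j i => dotv (a (tri j i)) (b (tri j i)))) => j i.
by apply: cvg_dotv; [exact: ua|exact: wb].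
Qed.

Lemma lump_nodal (u : V -> R) (a : 'I_K -> R) : vertex_limit u a ->
  ip_lumpS tri (q t) u (cst 1) = \sum_k mass k t * a k.
Proof.
move=> ua; rewrite sum_mass.
apply: (lumpedE (F := fun j i => a (tri j i))) => j i.
by under eq_fun do rewrite mulr1; exact: ua.
Qed.

(** A hat function times a unit vector isolates one component of one vertex value. Applied to (S3),
    this identifies the velocity of each vertex with the fluid velocity there. *)
Lemma lumpV_inj (u w : V -> V) (a b : 'I_K -> V) :
  (forall k, mass k t != 0) -> vertex_limit u a -> vertex_limit w b ->
  (forall z, Vspace tri (q t) z -> ip_lumpV tri (q t) u z = ip_lumpV tri (q t) w z) ->
  a = b.
Proof.
move=> m0 ua wb uw; apply/funext => k; apply/rowP => i.
have := uw _ (Vspace_nodal_vec qP tri_surj (fun l => (l == k)%:R *: delta_mx 0 i)).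
have nl := vertex_limit_Vspace
  (Vspace_nodal_vec qP tri_surj (fun l => (l == k)%:R *: delta_mx 0 i)).
rewrite (lumpV_nodal ua nl) (lumpV_nodal wb nl).
have E (c : 'I_K -> V) : \sum_l mass l t *
    dotv (c l) ((nodal_vec (fun l => (l == k)%:R *: delta_mx 0 i) \o q t) l) =
    mass k t * c k 0 i.
  under eq_bigr do rewrite /= (nodal_vec_vertex qP tri_surj) dotvZr mulrCA.
  rewrite sum_delta; congr (_ * _); rewrite /dotv.
  under eq_bigr do rewrite mxE eqxx/= mulrC eq_sym.
  by rewrite -(sum_delta (fun j => c k 0 j)); apply: eq_bigr => j _; rewrite eq_sym.
by rewrite !E; apply: mulfI.
Qed.

(** The surface gradient of the identity is the tangential projection, which fixes the gradients of
    the hat functions; what remains is the surface divergence of [w]. *)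
Lemma surf_grad_id (w : V -> V) : Vspace tri (q t) id -> Vspace tri (q t) w ->
  ip_surfM tri (q t) (sgradv tri (q t) id) (sgradv tri (q t) w) =
  \sum_j area t j * \sum_i dotv (w (q t (tri j i))) (grad j i).
Proof.
move=> Vi Vw; apply: eq_bigr => j _; apply: simplex_int_cst => z oz.
have ndj : Defs.nondegenerate (sv tri (q t) j) by exact: surface_nondegenerate.
transitivity (\sum_i \sum_l (\sum_a q t (tri j a) 0 i * grad j a 0 l) *
    (\sum_b w (q t (tri j b)) 0 i * grad j b 0 l)).
  apply: eq_bigr => i _; apply: eq_bigr => l _.
  rewrite !mxE (sgrad_Wspace qP (Vi i) oz) (sgrad_Wspace qP (Vw i) oz) !summxE.
  by congr (_ * _); apply: eq_bigr => a _; rewrite mxE.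
transitivity (\sum_i \sum_b w (q t (tri j b)) 0 i * grad j b 0 i).
  apply: eq_bigr => i _.
  under eq_bigr do rewrite mulr_sumr.
  rewrite exchange_big; apply: eq_bigr => b _.
  under eq_bigr do rewrite mulrCA.
  rewrite -mulr_sumr; congr (_ * _).
  rewrite [in RHS](tangent_expand ndj (bary_grad_tangent (sv tri (q t) j) b)) summxE.
  under eq_bigr do rewrite mulr_suml.
  rewrite exchange_big; apply: eq_bigr => a _.
  rewrite mxE mulr_suml; apply: eq_bigr => l _.
  by rewrite [RHS]mulrC mulrA.
by rewrite exchange_big; apply: eq_bigr => i _.
Qed.

(** The gradient term jumps across vertices, so its lumped value is taken simplex by simplex and
    does not reduce to a sum over [mass]. *)
Lemma vertex_limit_capillary (c : 'I_K -> R) (f : V -> R) (kap u : V -> V) (a : 'I_K -> V)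
    (eta : V -> R) :
  vertex_limit f c -> Vspace tri (q t) kap -> vertex_limit u a ->
  Wspace tri (q t) eta -> (forall k, eta (q t k) = c k) ->
  ip_lumpV tri (q t) (fun z => f z *: kap z + sgrad tri (q t) eta z) u =
  \sum_k mass k t * (c k * dotv (kap (q t k)) (a k)) +
  m.+1%:R^-1 * \sum_j area t j * \sum_i \sum_l c (tri j l) * dotv (grad j l) (a (tri j i)).
Proof.
move=> fc Vk ua We etac.
rewrite sum_mass -mulrDr -big_split/=.
rewrite /ip_lumpV (lumpedE (F := fun j i => dotv
    (c (tri j i) *: kap (q t (tri j i)) + \sum_l c (tri j l) *: grad j l) (a (tri j i)))); last first.
  move=> j i; apply: cvg_dotv; last exact: ua.
  apply: cvgD.
    by apply: cvgZ; [exact: fc|exact: (vertex_limit_Vspace Vk)].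
  apply: cvg_near_cst.
  have := withinT (open_simplex (sv tri (q t) j)) (nbhs_filter (sv tri (q t) j i)).
  apply: filterS => z oz; rewrite (sgrad_Wspace qP We oz).
  by apply: eq_bigr => l _; rewrite etac.
congr (_ * _); apply: eq_bigr => j _; rewrite -mulrDr -big_split/=; congr (_ * _).
apply: eq_bigr => i _; rewrite dotvDl dotvZl; congr (_ + _).
by rewrite dotv_suml; apply: eq_bigr => l _; rewrite dotvZl.
Qed.

End capillary_identity.

Section segment.
Context {R : realType}.
Implicit Types (v : 'I_2 -> 'rV[R]_2).

Definition edge v := v (lift ord0 ord0) - v ord0.

Lemma big_ord2 (F : 'I_2 -> R) : \sum_i F i = F ord0 + F (lift ord0 ord0).
Proof. by rewrite !big_ord_recl big_ord0 addr0. Qed.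

Lemma edge_dot_gt0 v : Defs.nondegenerate v -> 0 < dotv (edge v) (edge v).
Proof.
move=> ndv; rewrite lt_def dotv_ge0 andbT; apply/eqP => /dotv_eq0/eqP.
by rewrite subr_eq0 => /eqP/nondegenerate_inj-/(_ ndv).
Qed.

Lemma bary_grad0 v : bary_grad v ord0 = - bary_grad v (lift ord0 ord0).
Proof. by rewrite bary_grad_ord0 big_ord_recl big_ord0 addr0. Qed.

Lemma bary_grad1 v : Defs.nondegenerate v ->
  bary_grad v (lift ord0 ord0) = (dotv (edge v) (edge v))^-1 *: edge v.
Proof.
move=> ndv; have [l [l0 gE]] := bary_grad_tangent v (lift ord0 ord0).
have {}gE : bary_grad v (lift ord0 ord0) = l (lift ord0 ord0) *: edge v.
  rewrite gE !big_ord_recl big_ord0 addr0 /edge scalerBr addrC; congr (_ + _).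
  by move: l0; rewrite big_ord2 => /eqP; rewrite addr_eq0 => /eqP ->; rewrite scaleNr.
have := bary_grad_edge (lift ord0 ord0) (lift ord0 ord0) ndv.
rewrite eqxx subr0 -/(edge v) gE dotvZl => le1; congr (_ *: _).
have e0 := edge_dot_gt0 ndv.
by apply: (mulIf (lt0r_neq0 e0)); rewrite le1 mulVf// gt_eqF.
Qed.

Lemma simplex_jac2 v : simplex_jac v = Num.sqrt (dotv (edge v) (edge v)).
Proof.
rewrite /simplex_jac det_mx11 mxE; congr Num.sqrt.
by apply: eq_bigr => i _; rewrite !mxE.
Qed.

(** The two gradients on a segment are opposite nonzero vectors: for curves the angle condition
    always holds, and strictly. *)
Lemma bary_grad_dot_lt0 v i l : Defs.nondegenerate v -> i != l ->
  dotv (bary_grad v i) (bary_grad v l) < 0.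
Proof.
move=> ndv; have e0 := edge_dot_gt0 ndv.
have g0 : 0 < dotv (bary_grad v (lift ord0 ord0)) (bary_grad v (lift ord0 ord0)).
  by rewrite bary_grad1// dotvZl dotvZr mulrA !mulr_gt0// invr_gt0.
have [i' ->|->] := unliftP ord0 i; have [l' ->|->] := unliftP ord0 l => //.
- by rewrite !ord1 eqxx.
- by rewrite ord1 bary_grad0 dotvNr oppr_lt0.
- by rewrite ord1 bary_grad0 dotvNl oppr_lt0.
Qed.

End segment.

(** * Change of length and work of the capillary force *)

Section curve.
Context {R : realType} {K J : nat} (tri : 'I_J -> 'I_2 -> 'I_K).
Notation V := 'rV[R]_2.
Variables (T : R) (q : R -> 'I_K -> V).
Hypothesis T0 : 0 < T.
Hypothesis cq : forall k, C1_on `[0, T] (fun t => q t k).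
Hypothesis qP : forall t, 0 <= t <= T -> polyhedral_surface tri (q t).
Hypothesis tri_surj : forall k, exists j, k \in vset tri j.

Local Notation area := (surf_area tri q).
Local Notation mass := (mass tri q).
Local Notation grad t j i := (bary_grad (sv tri (q t) j) i).

Let le_oo t : 0 < t < T -> 0 <= t <= T.
Proof. by move=> /andP[t0 tT]; rewrite !ltW. Qed.

Definition velocity t k : V := derive_within `[0, T] (fun s => q s k) t.

(** Length times the surface divergence of the velocity, as in the transport theorem. *)
Definition area' t j := area t j * \sum_i dotv (velocity t (tri j i)) (grad t j i).

Lemma area_derive t j : 0 < t < T -> is_derive t 1 (area^~ j) (area' t j).
Proof.
move=> tT; pose e s := edge (sv tri (q s) j).
have ndj : Defs.nondegenerate (sv tri (q t) j).
  by apply: surface_nondegenerate; apply: qP; exact: le_oo.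
have aE s : area s j = Num.sqrt (dotv (e s) (e s)).
  by rewrite /surf_area simplex_areaE simplex_jac2 divr1.
have dq k i : is_derive t 1 (fun s => q s k 0 i) (velocity t k 0 i).
  apply: is_derive_coord; apply: is_derive_within; first exact: nbhs_itvcc.
  by apply: (cq k).1; rewrite /= in_itv/= le_oo.
pose de := velocity t (tri j (lift ord0 ord0)) - velocity t (tri j ord0).
have dee : is_derive t 1 (fun s => dotv (e s) (e s)) (2 * dotv de (e t)).
  rewrite mulr_natl mulr2n {2}dotvC -big_split/=; apply: is_derive1_sum => i _.
  have dei : is_derive t 1 (fun s => e s 0 i) (de 0 i).
    rewrite /e /edge; under eq_fun do rewrite !mxE.
    by rewrite !mxE; apply: is_derive1B; exact: dq.
  exact: is_derive1M.
have ee0 : 0 < dotv (e t) (e t) by exact: edge_dot_gt0.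
have ds : is_derive t 1 (fun s => Num.sqrt (dotv (e s) (e s)))
    ((2 * Num.sqrt (dotv (e t) (e t)))^-1 * (2 * dotv de (e t))).
  by apply: is_derive1_comp; exact: is_derive1_sqrt.
rewrite (_ : area^~ j = (fun s => Num.sqrt (dotv (e s) (e s)))); last first.
  by apply/funext => s; rewrite aE.
apply: (is_derive_eq ds); rewrite /area' aE big_ord2 bary_grad0 dotvNr addrC -dotvBl -/de.
rewrite bary_grad1// dotvZr -/(e t).
set L := Num.sqrt _; have L0 : 0 < L by rewrite sqrtr_gt0.
have -> : dotv (e t) (e t) = L ^+ 2 by rewrite sqr_sqrtr// ltW.
by field; rewrite gt_eqF.
Qed.

Definition mass' k t : R := 2^-1 * \sum_j area' t j * \sum_i (tri j i == k)%:R.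

Lemma mass_derive t k : 0 < t < T -> is_derive t 1 (mass k) (mass' k t).
Proof.
move=> tT; apply: is_derive1Zl; apply: is_derive1_sum => j _.
by apply: is_derive1Zr; exact: area_derive.
Qed.

Lemma sum_mass' (c : 'I_K -> R) t :
  \sum_k mass' k t * c k = 2^-1 * \sum_j area' t j * \sum_i c (tri j i).
Proof.
under eq_bigr do rewrite -mulrA mulr_suml.
rewrite -mulr_sumr exchange_big; congr (_ * _); apply: eq_bigr => j _.
under eq_bigr do rewrite -mulrA mulr_suml.
rewrite -mulr_sumr exchange_big; congr (_ * _); apply: eq_bigr => i _.
by under eq_bigr do rewrite eq_sym; rewrite sum_delta.
Qed.

(** (S4) is tested with the interpolant of [c] times the velocity [V]. On a segment [c1 V1 - c0 V0]
    is the mean of [c] times [V1 - V0] plus [c1 - c0] times the mean of [V]; the gradient term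
    cancels the second part and leaves minus the mean of [c] times the change of length. *)
Lemma capillary_work t (c : 'I_K -> R) (f : V -> R) (kap u : V -> V)
    (a : 'I_K -> V) (eta : V -> R) :
  0 < t < T ->
  vertex_limit tri (q t) f c -> Vspace tri (q t) kap -> vertex_limit tri (q t) u a ->
  Wspace tri (q t) eta -> (forall k, eta (q t k) = c k) ->
  Vspace tri (q t) id ->
  (forall w, Vspace tri (q t) w ->
     ip_lumpV tri (q t) (mesh_velocity tri T q t) w = ip_lumpV tri (q t) u w) ->
  (forall w, Vspace tri (q t) w ->
     ip_lumpV tri (q t) kap w
     + ip_surfM tri (q t) (sgradv tri (q t) id) (sgradv tri (q t) w) = 0) ->
  ip_lumpV tri (q t) (fun z => f z *: kap z + sgrad tri (q t) eta z) u =
  - \sum_k mass' k t * c k.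
Proof.
move=> tT fc Vk ua We etac Vi S3 S4; have qPt := qP (le_oo tT).
have aV : velocity t = a.
  apply: (lumpV_inj qPt tri_surj _ _ ua S3) => [k|].
    by rewrite gt_eqF//; apply: (mass_gt0 qP tri_surj); exact: le_oo.
  have := vertex_limit_Vspace (Vspace_nodal_vec qPt tri_surj (velocity t)).
  rewrite (_ : _ \o _ = velocity t)//.
  by apply/funext => k; exact: (nodal_vec_vertex qPt tri_surj).
rewrite (vertex_limit_capillary qPt fc Vk ua We etac) -aV.
pose w := nodal_vec tri (q t) (fun k => c k *: velocity t k).
have Vw : Vspace tri (q t) w by exact: Vspace_nodal_vec.
have wq k : w (q t k) = c k *: velocity t k by exact: nodal_vec_vertex.
have := S4 w Vw.
rewrite (lumpV_nodal (vertex_limit_Vspace Vk) (vertex_limit_Vspace Vw)).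
under eq_bigr do rewrite /= wq dotvZr.
move=> /eqP; rewrite addr_eq0 (surf_grad_id qPt Vi Vw) => /eqP ->.
rewrite sum_mass' -sumrN !mulr_sumr -sumrN -big_split/=.
apply: eq_bigr => j _; rewrite /area' !big_ord2 !wq bary_grad0.
move: (area t j) (grad t j (lift ord0 ord0)) (c _) (c _) (velocity t _) (velocity t _).
move=> L g c0 c1 V0 V1; rewrite !dotvZl !dotvNr !dotvNl !(dotvC g).
by field.
Qed.

End curve.

Lemma ae_time_neq (R : realType) (T b : R) : ae_time T (fun t => t != b).
Proof.
exists [set b]; split => //; first exact: lebesgue_measure_set1.
move=> t /= /not_implyP[_ /negP]; rewrite negbK => /eqP.
exact.
Qed.

Lemma ae_time_forall (R : realType) (T : R) (I : finType) (Q : I -> R -> Prop) :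
  (forall i, ae_time T (Q i)) -> ae_time T (fun t => forall i, Q i t).
Proof.
move=> aeQ; rewrite /ae_time.
have H : {ae (@lebesgue_measure R), forall t : R, forall i, 0 < t < T -> Q i t}.
  exact: (@filter_forall _ I _ (almost_everywhere (@lebesgue_measure R)) _ aeQ).
apply: (@filterS _ (almost_everywhere (@lebesgue_measure R)) _ _ _ _ H) => t /= Qt tT i.
exact: Qt.
Qed.

(** * Energy of the surfactant on a curve *)

Section surfactant_energy.
Context {R : realType} {K J : nat} (tri : 'I_J -> 'I_2 -> 'I_K).
Notation V := 'rV[R]_2.
Variables (T : R) (q : R -> 'I_K -> V).
Hypothesis T0 : 0 < T.
Hypothesis cq : forall k, C1_on `[0, T] (fun t => q t k).
Hypothesis qP : forall t, 0 <= t <= T -> polyhedral_surface tri (q t).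
Hypothesis tri_surj : forall k, exists j, k \in vset tri j.
Variable Psi : R -> V -> R.
Hypothesis WPsi : W_time tri T q Psi.
Variable D : R.
Hypothesis D0 : 0 <= D.
Hypothesis S5 : forall zeta, W_time tri T q zeta ->
  ae_time T (fun t =>
    let mass s := ip_lumpS tri (q s) (Psi s) (zeta s) in
    derivable (mass : R -> R^o) t 1 /\
    derive1 mass t
    + D * ip_surfV tri (q t) (sgrad tri (q t) (Psi t)) (sgrad tri (q t) (zeta t))
    = ip_lumpS tri (q t) (Psi t) (material_deriv tri T q zeta t)).

Local Notation area := (surf_area tri q).
Local Notation mass := (mass tri q).
Local Notation psi := (psi q Psi).
Local Notation flux := (flux tri q Psi).
Local Notation stiff := (stiff tri q).
Local Notation grad t j i := (bary_grad (sv tri (q t) j) i).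

Hypothesis psi0 : forall t, 0 <= t <= T -> forall k, 0 <= psi k t.

Let le_oo t : 0 < t < T -> 0 <= t <= T.
Proof. by move=> /andP[t0 tT]; rewrite !ltW. Qed.

Let dot_lt0 t j i l : 0 <= t <= T -> i != l -> dotv (grad t j i) (grad t j l) < 0.
Proof.
move=> tT; apply: bary_grad_dot_lt0; apply: surface_nondegenerate; exact: qP.
Qed.

Let a0 t j : 0 <= t <= T -> 0 < area t j.
Proof. exact: (area_gt0 qP). Qed.

Let m0 t k : 0 <= t <= T -> 0 < mass k t.
Proof. exact: (mass_gt0 qP tri_surj). Qed.

(** The diagonal part is proportional to [psi k t] and limits its rate of decay; for nonnegative
    values the rest is nonpositive and can only feed the vertex. *)
Lemma diag_flux k t (f := fun j l => (tri j l == k)%:R * dotv (grad t j l) (grad t j l)) :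
  0 <= t <= T ->
  flux k t = psi k t * (\sum_j area t j * \sum_l f j l) +
    \sum_j area t j * \sum_l \sum_(i | i != l)
      psi (tri j i) t * (tri j l == k)%:R * dotv (grad t j i) (grad t j l).
Proof.
move=> tT; rewrite mulr_sumr -big_split/=; apply: eq_bigr => j _.
rewrite mulrCA -mulrDr; congr (_ * _).
rewrite mulr_sumr -big_split/= /stiff exchange_big; apply: eq_bigr => l _.
rewrite (bigD1 l)//=; congr (_ + _); rewrite /f.
by case: eqP => [->|_]; rewrite ?mulr1 ?mul1r// mulr0 !mul0r mulr0.
Qed.

Let off_le0 k t j l i : 0 <= t <= T -> i != l ->
  psi (tri j i) t * (tri j l == k)%:R * dotv (grad t j i) (grad t j l) <= 0.
Proof.
by move=> tT il; rewrite mulr_ge0_le0 ?(ltW (dot_lt0 _ tT il))// mulr_ge0// psi0.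
Qed.

Lemma psi_zero_before k t0 s : 0 < s -> s <= t0 -> t0 < T -> psi k t0 = 0 -> psi k s = 0.
Proof.
move=> s0 st0 t0T p0.
have t0T' : 0 <= t0 <= T by rewrite (ltW t0T) (le_trans (ltW s0) st0).
pose A t := \sum_j area t j * \sum_l (tri j l == k)%:R * dotv (grad t j l) (grad t j l).
have cA : continuous (fun t => A (clamp T t)).
  apply: continuous_sumr => j _; apply: continuousMr; first exact: (area_continuous T0 cq).
  apply: continuous_sumr => l _; apply: continuousMr; first exact: cst_continuous.
  by move=> t; apply: cvg_dotv; exact: (@grad_continuous _ _ _ _ _ _ _ T0 cq qP).
have cc : continuous (fun t => D * A (clamp T t) / mass k (clamp T t)).
  apply: continuousMr; first by apply: continuousMr; [exact: cst_continuous|exact: cA].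
  move=> t; apply: cvgV; first by rewrite gt_eqF// m0// clamp_bound.
  exact: (mass_continuous T0 cq).
(* [C] is the largest ratio over [[0, T]] of the diagonal coefficient to the mass; it is attained
   because masses are continuous and positive. *)
have [b _ bP] := EVT_max (ltW T0) (continuous_subspaceT cc).
pose C := D * A (clamp T b) / mass k (clamp T b).
have CP t : 0 <= t <= T -> D * A t <= C * mass k t.
  move=> tT; have := bP t; rewrite in_itv/= clampE// => /(_ tT).
  by rewrite ler_pdivrMr ?m0.
(* (m psi)' >= - C m psi, so m psi e^(C t) is nondecreasing *)
pose z t := mass k t * psi k t * expR (C * t).
have dz t : 0 < t < T -> is_derive t 1 z
    (- D * flux k t * expR (C * t) + mass k t * psi k t * (expR (C * t) * C)).
  move=> tT; apply: is_derive1M; first exact: (nodal_equation T0 cq qP tri_surj WPsi S5).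
  have dC : is_derive t 1 (fun t => C * t) C.
    apply: is_derive_eq (is_derive1Zl C (is_derive_id t 1)) _.
    by rewrite mulr1.
  exact: is_derive1_comp.
have dz0 t : 0 < t < T ->
    0 <= - D * flux k t * expR (C * t) + mass k t * psi k t * (expR (C * t) * C).
  move=> tT; have tT' := le_oo tT.
  rewrite [expR _ * C]mulrC mulrA -mulrDl mulr_ge0 ?expR_ge0//.
  rewrite diag_flux//; set X := \sum_j _ * \sum_l \sum_(i | _) _.
  have X0 : X <= 0.
    apply: sumr_le0 => j _; rewrite pmulr_rle0 ?a0//.
    by apply: sumr_le0 => l _; apply: sumr_le0 => i; exact: off_le0.
  rewrite -/(A t).
  have -> : - D * (psi k t * A t + X) + mass k t * psi k t * C =
      (C * mass k t - D * A t) * psi k t + D * (- X) by ring.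
  by rewrite addr_ge0// mulr_ge0 ?psi0 ?subr_ge0 ?CP ?oppr_ge0.
have sT : 0 <= s <= T by rewrite (ltW s0) (le_trans st0 (ltW t0T)).
have z0 : 0 <= z s.
  rewrite /z mulr_ge0 ?expR_ge0// mulr_ge0 ?psi0//.
  by apply: ltW; exact: m0.
have sub x : x \in `[s, t0] -> 0 < x < T.
  by rewrite in_itv/= => /andP[sx xt]; rewrite (lt_le_trans s0 sx) (le_lt_trans xt).
(* By the mean value theorem [z s <= z t0 = 0], while [z s] is nonnegative. *)
have [c cst zc] : exists2 c, c \in `[s, t0] & z t0 - z s =
    (- D * flux k c * expR (C * c) + mass k c * psi k c * (expR (C * c) * C)) * (t0 - s).
  apply: (MVT_segment st0 (df := fun c =>
    - D * flux k c * expR (C * c) + mass k c * psi k c * (expR (C * c) * C))).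
    move=> x xst; apply: dz; apply: sub; move: xst; rewrite !in_itv/= => /andP[? ?].
    by rewrite !ltW.
  apply: continuous_in_subspaceT => x /set_mem/= xst.
  by apply: (is_derive1_continuous (dz _ _)); exact: sub.
have : z t0 - z s >= 0 by rewrite zc mulr_ge0 ?subr_ge0// dz0// sub.
have -> : z t0 = 0 by rewrite /z p0 mulr0 mul0r.
rewrite sub0r oppr_ge0 => zs; have /eqP : z s = 0 by apply/eqP; rewrite eq_le zs.
rewrite /z mulf_eq0 [expR _ == _]gt_eqF ?expR_gt0// orbF mulf_eq0.
by rewrite (gt_eqF (m0 k sT))/= => /eqP.
Qed.

Definition settled t : Prop := forall k, 0 < psi k t \/ \forall s \near t, psi k s = 0.

(** Each vertex has at most one bad time: by [psi_zero_before], a zero at a later time makes [psi k]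
    vanish around every earlier one. *)
Lemma ae_settled : ae_time T settled.
Proof.
apply: ae_time_forall => k.
have [b bP] : exists b, forall t, 0 < t < T -> t != b ->
    0 < psi k t \/ \forall s \near t, psi k s = 0.
  have [[b [bT nb]]|nex] := pselect (exists b, 0 < b < T /\
      ~ (0 < psi k b \/ \forall s \near b, psi k s = 0)); last first.
    exists 0 => t tT _; apply: contrapT => nt; apply: nex; exists t; split => //.
  have pb : psi k b = 0.
    apply/eqP; rewrite eq_le psi0 ?le_oo// andbT leNgt; apply/negP => pb.
    by apply: nb; left.
  exists b => t tT tb; have [pt|pt] := ltP 0 (psi k t); [by left|right].
  have {}pt : psi k t = 0 by apply/eqP; rewrite eq_le pt psi0// le_oo.
  have zb x : t < x -> x < T -> psi k x = 0 -> \forall s \near t, psi k s = 0.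
    move=> tx xT px; near=> s; apply: (@psi_zero_before k x) => //.
      by have /andP[] : 0 < s < T by near: s; exact: near_itv.
    by apply: ltW; near: s; exact: lt_nbhsl.
  have [tb'|bt] := ltP t b; first by apply: (zb b) => //; case/andP: bT.
  exfalso; apply: nb; right; near=> s; apply: (@psi_zero_before k t) => //.
  - by have /andP[] : 0 < s < T by near: s; exact: near_itv.
  - by apply: ltW; near: s; apply: lt_nbhsl; rewrite lt_neqAle eq_sym tb.
  - by case/andP: tT.
by apply: ae_timeS (ae_time_neq T b) => t; exact: bP.
Unshelve. all: by end_near. Qed.

Lemma sum_flux_weight t (w : 'I_K -> R) :
  \sum_k w k * flux k t = \sum_j area t j * stiff t j (psi ^~ t) w.
Proof.
under eq_bigr do rewrite mulr_sumr.
rewrite exchange_big; apply: eq_bigr => j _.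
under eq_bigr do rewrite mulrCA.
rewrite -mulr_sumr; congr (_ * _).
under eq_bigr do rewrite mulr_sumr.
rewrite exchange_big; apply: eq_bigr => i _.
under eq_bigr do rewrite mulr_sumr.
rewrite exchange_big; apply: eq_bigr => l _.
rewrite -(sum_delta (fun k => psi (tri j i) t * w k * dotv (grad t j i) (grad t j l)) (tri j l)).
apply: eq_bigr => k _; rewrite eq_sym; ring.
Qed.

Let mass_psi_derive k t : 0 < t < T -> exists2 psi' : R, is_derive t 1 (psi k) psi' &
  mass' tri T q k t * psi k t + mass k t * psi' = - D * flux k t.
Proof.
move=> tT; have [f fP] := psi_C1oo T0 cq qP tri_surj WPsi k.
have [df _] := fP t tT; exists (f t) => //.
have dm : is_derive t 1 (mass k) (mass' tri T q k t) by exact: (mass_derive cq qP).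
have d1 := is_derive1M dm df.
have d2 : is_derive t 1 (fun s => mass k s * psi k s) (- D * flux k t).
  exact: (nodal_equation T0 cq qP tri_surj WPsi S5).
by rewrite -[LHS](@derive_val _ _ _ _ _ _ _ d1) -[RHS](@derive_val _ _ _ _ _ _ _ d2).
Qed.

(* If psi_l vanishes near t, its equation says that a sum of nonpositive terms
   psi_i (grad chi_i . grad chi_l) is zero. *)
Lemma zero_neighbor t j i l : 0 < t < T -> D != 0 -> settled t ->
  psi (tri j l) t = 0 -> psi (tri j i) t = 0.
Proof.
move=> tT Dn0 st pl; have tT' := le_oo tT.
have [->//|il] := eqVneq i l.
have fl0 : flux (tri j l) t = 0.
  have [psi' dpsi psiE] := mass_psi_derive (tri j l) tT.
  have psi'0 : psi' = 0.
    case: (st (tri j l)) => [|nz]; first by rewrite pl ltxx.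
    have dz : is_derive t 1 (psi (tri j l)) 0.
      apply: near_eq_is_derive (is_derive1_cst 0 t).
      by apply: filterS nz => s ->.
    by rewrite -(@derive_val _ _ _ _ _ _ _ dpsi) (@derive_val _ _ _ _ _ _ _ dz).
  move: psiE; rewrite pl psi'0 !mulr0 addr0 => /esym/eqP.
  by rewrite mulf_eq0 oppr_eq0 (negbTE Dn0) => /eqP.
move: fl0; rewrite diag_flux// pl mul0r add0r => /eqP.
rewrite -oppr_eq0 -sumrN psumr_eq0; last first.
  move=> j' _; rewrite oppr_ge0 pmulr_rle0 ?a0//.
  by apply: sumr_le0 => l' _; apply: sumr_le0 => i'; exact: off_le0.
move=> /allP/(_ j (mem_index_enum j)); rewrite /= oppr_eq0 mulf_eq0 (gt_eqF (a0 j tT'))/=.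
rewrite -oppr_eq0 -sumrN psumr_eq0; last first.
  by move=> l' _; rewrite oppr_ge0; apply: sumr_le0 => i'; exact: off_le0.
move=> /allP/(_ l (mem_index_enum l)); rewrite /= -oppr_eq0 opprK -oppr_eq0 -sumrN.
rewrite psumr_eq0; last by move=> i' il'; rewrite oppr_ge0; exact: off_le0.
move=> /allP/(_ i (mem_index_enum i)); rewrite il eqxx mulr1 oppr_eq0 mulf_eq0.
by rewrite [dotv _ _ == _]lt_eqF ?dot_lt0// orbF => /eqP.
Qed.

Variables (F gam : R -> R) (rg : set R).
Hypothesis dF : forall r, rg r -> derivable F r 1.
Hypothesis gamF : forall r, rg r -> gam r = F r - r * derive1 F r.
Hypothesis F0 : F 0 = gam 0.
Hypothesis dF_mono : forall a b, rg a -> rg b -> a <= b -> derive1 F a <= derive1 F b.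
Hypothesis rg_psi : forall t k, 0 <= t <= T -> 0 < psi k t -> rg (psi k t).

(* F' need not be defined at 0; where psi_k vanishes near t, F(psi_k) is constant. *)
Let weight t k : R := if 0 < psi k t then derive1 F (psi k t) else 0.

(** Eliminating [m psi'] by the nodal equation turns [m' F + m F' psi'] into
    [m' (F - psi F') - D F' flux], whose bracket is gamma. Where [psi k] vanishes nearby,
    [F 0 = gam 0] gives the same form. *)
Lemma surfactant_energy_derive t : 0 < t < T -> settled t ->
  is_derive t 1 (fun s => \sum_k mass k s * F (psi k s))
    (\sum_k mass' tri T q k t * gam (psi k t) - D * \sum_k weight t k * flux k t).
Proof.
move=> tT st; have tT' := le_oo tT.
rewrite mulr_sumr -sumrB; apply: is_derive1_sum => k _.
have dm : is_derive t 1 (mass k) (mass' tri T q k t) by exact: (mass_derive cq qP).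
rewrite /weight; case: (st k) => [pk|nz].
  have [psi' dpsi psiE] := mass_psi_derive k tT; rewrite pk.
  have dFp : is_derive (psi k t) 1 F (derive1 F (psi k t)).
    by rewrite derive1E; apply: derivableP; apply: dF; exact: rg_psi.
  apply: (is_derive_eq (is_derive1M dm (is_derive1_comp dFp dpsi))).
  rewrite gamF; last exact: rg_psi.
  have -> : D * (derive1 F (psi k t) * flux k t) = - derive1 F (psi k t) * (- D * flux k t) by ring.
  have alg (a b c d e f : R) :
    a * b + c * (d * e) = a * (b - f * d) - - d * (a * f + c * e) by ring.
  by rewrite -psiE; exact: alg.
have pk : psi k t = 0 by exact: nbhs_singleton nz.
have dFp : is_derive t 1 (fun s => F (psi k s)) 0.
  apply: near_eq_is_derive (is_derive1_cst (F 0) t).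
  by apply: filterS nz => s ->.
apply: (is_derive_eq (is_derive1M dm dFp)).
by rewrite pk ltxx F0 mulr0 addr0 mul0r mulr0 subr0.
Qed.

Lemma diffusion_ge0 t : 0 < t < T -> settled t ->
  0 <= D * \sum_k weight t k * flux k t.
Proof.
move=> tT st; have tT' := le_oo tT; have [->|Dn0] := eqVneq D 0; first by rewrite mul0r.
rewrite mulr_ge0// sum_flux_weight; apply: sumr_ge0 => j _.
rewrite mulr_ge0 ?(ltW (a0 j tT'))// /stiff !big_ord2.
have zn i l := @zero_neighbor t j i l tT Dn0 st.
set g := dotv (grad t j (lift ord0 ord0)) (grad t j (lift ord0 ord0)).
rewrite bary_grad0 !dotvNr !dotvNl -/g.
set p0 := psi (tri j ord0) t; set p1 := psi (tri j (lift ord0 ord0)) t.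
set w0 := weight t (tri j ord0); set w1 := weight t (tri j (lift ord0 ord0)).
(* On a segment the form is a product of differences, so monotonicity of [F'] decides its sign. *)
have -> : p0 * w0 * - - g + p0 * w1 * - g + (p1 * w0 * - g + p1 * w1 * g) =
    (p1 - p0) * (w1 - w0) * g by ring.
rewrite mulr_ge0 ?dotv_ge0//.
have p00 : 0 <= p0 by exact: psi0.
have p10 : 0 <= p1 by exact: psi0.
(* A zero at one end forces a zero at the other, so the default weight 0 is never compared with a
   value of [F']. *)
move: p00; rewrite le_eqVlt => /predU1P[p00|p00].
  by have -> : p1 = 0; [apply: (zn _ ord0)|rewrite -p00 subrr mul0r].
move: p10; rewrite le_eqVlt => /predU1P[p10|p10].
  by have -> : p0 = 0; [apply: (zn _ (lift ord0 ord0))|rewrite -p10 subrr mul0r].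
rewrite /w0 /w1 /weight p00 p10.
have [p01|/ltW p10'] := leP p0 p1.
  by rewrite mulr_ge0// subr_ge0// dF_mono//; exact: rg_psi.
by rewrite mulr_le0// subr_le0// dF_mono//; exact: rg_psi.
Qed.

End surfactant_energy.

(** * The energy inequality *)

Section bulk_identities.
Context {R : realType} {m : nat}.
Notation V := 'rV[R]_m.+1.
Implicit Types (Om : set V) (u w : V -> V) (r : V -> R) (A : V -> 'M[R]_m.+1).

Lemma two_phase_ge0 Om M (el : 'I_M -> 'I_m.+2 -> V) (G : set V) (am ap : R) x :
  0 < am -> 0 < ap -> 0 <= two_phase Om el G am ap x.
Proof.
move=> am0 ap0; rewrite /two_phase; case: pickP => // o _.
case: asboolP => _; first exact: ltW.
by case: asboolP => _; [exact: ltW|rewrite mulr_ge0// addr_ge0// ltW].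
Qed.

Lemma normV_sqr Om r u : (forall x, 0 <= r x) ->
  normV Om (fun x => Num.sqrt (r x) *: u x) ^+ 2 = ipV Om (fun x => r x *: u x) u.
Proof.
move=> r0; rewrite sqr_sqrtr; last by apply: Rintegral_ge0 => x _; exact: dotv_ge0.
apply: eq_Rintegral => x _.
by rewrite !dotvZl dotvZr mulrA -expr2 sqr_sqrtr.
Qed.

Lemma frobeniusZl a (A B : 'M[R]_m.+1) : frobenius (a *: A) B = a * frobenius A B.
Proof.
rewrite /frobenius mulr_sumr; apply: eq_bigr => i _; rewrite mulr_sumr.
by apply: eq_bigr => j _; rewrite mxE mulrA.
Qed.

Lemma normM_sqr Om r A : (forall x, 0 <= r x) ->
  normM Om (fun x => Num.sqrt (r x) *: A x) ^+ 2 = ipM Om (fun x => r x *: A x) A.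
Proof.
move=> r0; rewrite sqr_sqrtr; last first.
  apply: Rintegral_ge0 => x _; apply: sumr_ge0 => i _; apply: sumr_ge0 => j _.
  by rewrite -expr2 sqr_ge0.
apply: eq_Rintegral => x _; rewrite !frobeniusZl.
rewrite /frobenius; under [in LHS]eq_bigr do under eq_bigr do rewrite mxE mulrCA.
under [in LHS]eq_bigr do rewrite -mulr_sumr.
by rewrite -mulr_sumr mulrA -expr2 sqr_sqrtr.
Qed.

(** With the velocity as test function the two terms in [dt_field] cancel, the convective term is
    antisymmetric, and the pressure is itself a test function of (S2). *)
Lemma momentum_eq_diag (p : problem R m) q U P kappa Psi t :
  momentum_eq (p := p) q U P kappa Psi t U ->
  ipS (Omega p) (div (Omega p) (U t)) (P t) = 0 ->
  2^-1 * derive1 (rhoU_ip q U U) t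
  + 2 * ipM (Omega p) (fun x => muh q t x *: strain (Omega p) (U t) x) (strain (Omega p) (U t))
  = ipV (Omega p) (force q t) (U t)
    + ip_lumpV (@tri _ _ p) (q t) (capillary q kappa Psi t) (U t).
Proof.
rewrite /momentum_eq => + P0.
have -> : ipV (Omega p) (fun x => rhoh q t x *: dt_field U t x) (U t) =
    ipV (Omega p) (fun x => rhoh q t x *: U t x) (dt_field U t).
  by apply: eq_Rintegral => x _; rewrite !dotvZl dotvC.
rewrite addrK.
set C := ipS _ (rhoh q t) _; have -> : C = 0.
  rewrite /C /ipS /Rintegral integral0_eq// => x _.
  by rewrite subrr mulr0.
have -> : ipS (Omega p) (P t) (div (Omega p) (U t)) = 0.
  by rewrite -[RHS]P0; apply: eq_Rintegral => x _; rewrite mulrC.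
by rewrite mulr0 addr0 subr0.
Qed.

End bulk_identities.

(** * Convexity of the surface energy *)

Section equation_of_state.
Context {R : realType} {m : nat} (p : problem R m).
Hypothesis adm : admissible p.

Lemma psi_range_open_nbhs r : psi_range_open p r -> nbhs r (psi_range_open p).
Proof.
move=> [r0 rpsi]; change (\forall s \near r, psi_range_open p s).
have [l rl lpsi] : exists2 l, r < l & (l%:E <= psi_inf p)%E.
  case: (psi_inf p) rpsi => [l| |] //; first by rewrite lte_fin => rl; exists l.
  by move=> _; exists (r + 1); rewrite ?ltrDl// leey.
near=> s; split; first by near: s; exact: lt_nbhsr.
apply: lt_le_trans lpsi; rewrite lte_fin; near: s; exact: lt_nbhsl.
Unshelve. all: by end_near. Qed.

Lemma gam_continuous : {within psi_range p, continuous (gam p)}.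
Proof.
apply/subspace_continuousP => r pr.
exact: (derivable_within_continuous ((adm_gam adm).1 r pr)).
Qed.

(** Differentiating [gam r = F r - r F' r] gives [gam' r = - r F'' r], so that [gam' <= 0] yields
    [F'' >= 0]. Inside the range the derivative relative to [psi_range] is the ordinary one. *)
Lemma dFen_derive r : psi_range_open p r ->
  is_derive r 1 (derive1 (Fen p)) (derive1 (derive1 (Fen p)) r) /\
  0 <= derive1 (derive1 (Fen p)) r.
Proof.
move=> pr; have [dF ddF _] := adm_F_C2 adm pr; have [r0 rpsi] := pr.
have d2 : is_derive r 1 (derive1 (Fen p)) (derive1 (derive1 (Fen p)) r).
  by rewrite [X in is_derive _ _ _ X]derive1E; exact: derivableP.
split=> //.
have d1 : is_derive r 1 (Fen p) (derive1 (Fen p) r).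
  by rewrite derive1E; exact: derivableP.
have dg : is_derive r 1 (gam p) (- (r * derive1 (derive1 (Fen p)) r)).
  have d3 := is_derive1B d1 (is_derive1M (is_derive_id r 1) d2).
  have d4 : is_derive r 1 (fun s => Fen p s - s * derive1 (Fen p) s)
      (- (r * derive1 (derive1 (Fen p)) r)).
    by apply: (is_derive_eq d3); rewrite mul1r opprD addrA subrr add0r.
  apply: near_eq_is_derive d4.
  by apply: filterS (psi_range_open_nbhs pr) => s ps; rewrite (adm_gamF adm ps).
have prr : psi_range p r by split=> //; exact: ltW.
have dw : is_derive r 1 (gam p) (derive_within (psi_range p) (gam p : R -> R^o) r).
  apply: is_derive_within; last exact: (adm_gam adm).1.
  by apply: filterS (psi_range_open_nbhs pr) => s [s0 sp]; split=> //; exact: ltW.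
have := adm_gam_le0 adm prr.
rewrite -(@derive_val _ _ _ _ _ _ _ dw) (@derive_val _ _ _ _ _ _ _ dg).
by rewrite oppr_le0 pmulr_rge0.
Qed.

Lemma dFen_mono a b : psi_range_open p a -> psi_range_open p b -> a <= b ->
  derive1 (Fen p) a <= derive1 (Fen p) b.
Proof.
move=> [a0 _] [_ bp] ab.
have sub x : x \in `[a, b] -> psi_range_open p x.
  rewrite in_itv/= => /andP[ax xb]; split; first exact: lt_le_trans ax.
  by apply: le_lt_trans bp; rewrite lee_fin.
have [c cab ->] : exists2 c, c \in `[a, b] & derive1 (Fen p) b =
    derive1 (Fen p) a + derive1 (derive1 (Fen p)) c * (b - a).
  have [||c cab cE] := @MVT_segment R (derive1 (Fen p)) (derive1 (derive1 (Fen p))) a b ab.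
  - move=> x xab; apply: (dFen_derive _).1; apply: sub; move: xab; rewrite !in_itv/= => /andP[? ?].
    by rewrite !ltW.
  - apply: continuous_in_subspaceT => x /set_mem/= xab.
    exact: (is_derive1_continuous (dFen_derive (sub _ xab)).1).
  - by exists c => //; rewrite -cE addrC subrK.
by rewrite lerDl mulr_ge0 ?subr_ge0//; exact: (dFen_derive (sub _ cab)).2.
Qed.

End equation_of_state.

(** * Assembly of the energy inequality *)

Section energy_inequality.
Context {R : realType} (p : problem R 1).
Notation V := 'rV[R]_2.
Variables (q : R -> 'I_(nvert p) -> V) (U : R -> V -> V) (P : R -> V -> R)
  (kappa : R -> V -> V) (Psi : R -> V -> R).
Hypothesis adm : admissible p.
Hypothesis sol : solution q U P kappa Psi.
Notation T := (Tend p).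
Notation tr := (@tri _ _ p).
Hypothesis Psi0 : forall t, 0 <= t <= T -> forall z, surf tr (q t) z -> 0 <= Psi t z.
Hypothesis Psi_lt : forall t, 0 <= t <= T ->
  forall z, surf tr (q t) z -> ((Psi t z)%:E < psi_inf p)%E.

Let T0 := adm_T adm.
Let cq := sol_q sol.
Let qP := sol_surf sol.
Let tri_surj : forall k, exists j, k \in vset tr j.
Proof. by case: (adm_complex adm). Qed.
Let WPsi := sol_Psi sol.
Let S5 := sol_S5 sol.

Let le_oo t : 0 < t < T -> 0 <= t <= T.
Proof. by move=> /andP[t0 tT]; rewrite !ltW. Qed.

Let psi0 t : 0 <= t <= T -> forall k, 0 <= psi q Psi k t.
Proof. by move=> tT k; apply: Psi0 => //; exact: surf_q. Qed.

Lemma energyE s : 0 <= s <= T -> energy q U Psi s =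
  2^-1 * rhoU_ip q U U s + \sum_k mass tr q k s * Fen p (psi q Psi k s).
Proof.
move=> sT; rewrite /energy normV_sqr; last first.
  by move=> x; apply: two_phase_ge0; [exact: adm_rho_m|exact: adm_rho_p].
congr (_ + _); apply: lump_nodal.
have [_ _ _ WP] := WPsi.
apply: (vertex_limit_comp (A := psi_range p) (WP s sT)); last exact: adm_F_cont.
by move=> z sz; split; [exact: Psi0|exact: Psi_lt].
Qed.

(** The velocity is a finite combination of functions continuous up to the boundary of the domain,
    and the interface lies inside the domain. *)
Lemma vertex_limit_U t : 0 <= t <= T -> vertex_limit tr (q t) (U t) (U t \o q t).
Proof.
move=> tT; have [N [phi [c [Uphi _ UE]]]] := sol_U sol.
move=> j i; apply: cvg_rowP => b.
have E x : U t x 0 b = \sum_i c i t * phi i x 0 b.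
  by rewrite UE// summxE; apply: eq_bigr => k _; rewrite mxE.
under eq_fun do rewrite E; rewrite /= E; apply: cvg_sumr => k _.
apply: cvgM; first exact: cvg_cst.
apply: cvg_row_coord; apply: (vertex_limit_within (A := closure (Omega p))).
  by apply: subset_trans (@subset_closure _ _); exact: (sol_surf_in sol).
by have [] := adm_Uh adm (Uphi k).
Qed.

Lemma energy_inequality : ae_time T (fun t =>
  derivable (energy q U Psi) t 1 /\
  derive1 (energy q U Psi) t
  + 2 * (normM (Omega p) (fun x =>
           Num.sqrt (muh q t x) *: strain (Omega p) (U t) x)) ^+ 2
  <= ipV (Omega p) (force q t) (U t)).
Proof.
have [aeP _ _] := sol_P sol; have [aeK _ _] := sol_kappa sol.
have aeS := ae_settled T0 cq qP tri_surj WPsi (adm_D adm) S5 psi0.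
(* Finitely many null sets are discarded; that of (S1) belongs to the test function [U]. *)
have := ae_timeI
  (ae_timeI (ae_timeI (sol_S1 sol (sol_U sol)) (sol_S2 sol))
    (ae_timeI (sol_S3 sol) (sol_S4 sol)))
  (ae_timeI (ae_timeI aeP aeK) aeS).
apply: ae_timeS => t tT [[[[dr S1] S2] [S3 S4]] [[PP VK] St]].
have tT' := le_oo tT; have [_ _ _ WP] := WPsi.
have rg_psi s k : 0 <= s <= T -> 0 < psi q Psi k s -> psi_range_open p (psi q Psi k s).
  by move=> sT p0; split => //; apply: Psi_lt => //; exact: surf_q.
have dF r : psi_range_open p r -> derivable (Fen p) r 1.
  by move=> pr; have [] := adm_F_C2 adm pr.
have F0 : Fen p 0 = gam p 0 by apply/eqP; rewrite -subr_eq0 (adm_F0 adm).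
have dS := surfactant_energy_derive T0 cq qP tri_surj WPsi S5 dF (adm_gamF adm) F0 rg_psi tT St.
have dge0 := diffusion_ge0 T0 cq qP tri_surj WPsi (adm_D adm) S5 psi0 (dFen_mono adm)
  rg_psi tT St.
have cap : ip_lumpV tr (q t) (capillary q kappa Psi t) (U t) =
    - \sum_k mass' tr T q k t * gam p (psi q Psi k t).
  apply: (capillary_work qP tri_surj tT _ VK (vertex_limit_U tT')) => //.
  - apply: (vertex_limit_comp (A := psi_range p) (WP t tT')); last exact: gam_continuous.
    by move=> z sz; split; [exact: Psi0|exact: Psi_lt].
  - exact: (Wspace_sum_chi (qP tT') tri_surj).
  - by move=> k; exact: (sum_chi_vertex (qP tT') tri_surj).
  - exact: (sol_id sol).
have dR : is_derive t 1 (rhoU_ip q U U) (derive1 (rhoU_ip q U U) t).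
  by rewrite derive1E; exact: derivableP.
have := is_derive1D (is_derive1Zl 2^-1 dR) dS; set dE := (X in is_derive _ _ _ X) => dEP.
have {}dEP : is_derive t 1 (energy q U Psi) dE.
  apply: near_eq_is_derive dEP; near=> s.
  by rewrite energyE// le_oo//; near: s; exact: near_itv.
split; first by case: dEP.
rewrite derive1E (@derive_val _ _ _ _ _ _ _ dEP) normM_sqr; last first.
  by move=> x; apply: two_phase_ge0; [exact: adm_mu_m|exact: adm_mu_p].
(* The capillary work cancels the [mass'] part of the surface energy; only the sign of the diffusion
   term turns the identity into an inequality. *)
have := momentum_eq_diag S1 (S2 _ PP); rewrite cap /dE.
move: dge0; lra.
Unshelve. all: by end_near. Qed.

End energy_inequality.

Unset Implicit Arguments.
Set Strict Implicit.

Theorem theorem3p3 (R : realType) (m : nat) (p : problem R m)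
    (q : R -> 'I_(nvert p) -> 'rV[R]_m.+1)
    (U : R -> 'rV[R]_m.+1 -> 'rV[R]_m.+1)
    (P : R -> 'rV[R]_m.+1 -> R)
    (kappa : R -> 'rV[R]_m.+1 -> 'rV[R]_m.+1)
    (Psi : R -> 'rV[R]_m.+1 -> R) :
  (m.+1 = 2 \/ m.+1 = 3)%N ->
  admissible p ->
  solution q U P kappa Psi ->
  [/\ (forall t : R, 0 < t < Tend p ->
         is_derive t 1
           (fun s : R => ip_surfS (@tri _ _ p) (q s) (Psi s) (cst 1)) 0),
      (Dgam p = 0 \/ (nonobtuse q /\ bounded_divergence q) ->
       (forall z, surf (@tri _ _ p) (q 0) z -> 0 <= Psi 0 z) ->
       forall t : R, 0 < t <= Tend p ->
         forall z, surf (@tri _ _ p) (q t) z -> 0 <= Psi t z)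
    & (m.+1 = 2%N ->
       (forall t : R, 0 <= t <= Tend p ->
          forall z, surf (@tri _ _ p) (q t) z -> 0 <= Psi t z) ->
       (forall t : R, 0 <= t <= Tend p ->
          forall z, surf (@tri _ _ p) (q t) z ->
            ((Psi t z)%:E < psi_inf p)%E) ->
       ae_time (Tend p) (fun t =>
         derivable (energy q U Psi) t 1 /\
         derive1 (energy q U Psi) t
         + 2 * (normM (Omega p) (fun x =>
                  Num.sqrt (muh q t x) *: strain (Omega p) (U t) x)) ^+ 2
         <= ipV (Omega p) (force q t) (U t)))].
Proof.
move=> _ adm sol.
have T0 := adm_T adm; have cq := sol_q sol; have qP := sol_surf sol.
have [tri_surj _ _] := adm_complex adm; have WPsi := sol_Psi sol.
have S5 := sol_S5 sol.
split=> [t tT|nonobt P0 t /andP[t0 tT]|m2].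
- exact: (total_mass_conserved T0 cq qP tri_surj WPsi S5 tT).
- have D0 := adm_D adm.
  apply: (Psi_ge0 T0 cq qP tri_surj WPsi S5 D0) => //; last by rewrite ltW.
  by case: nonobt => [->|[no _]]; [left|right].
case: m2 => m1; subst m.
exact: energy_inequality adm sol.
Qed.
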